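(* Let $\mathbb{E}$ be the Engel group equipped with a homogeneous distance $d$ and a graded left invariant Riemannian metric $g$. Let $\Sigma\subset\mathbb{E}$ be a $C^1$ smooth surface with degree $d(\Sigma)=4$. If $p\in\Sigma$ is a point of maximum degree, then $$\theta^4(\mu_\Sigma,p)=\beta_d(A_p\Sigma).$$
   Context: Engel group. $\mathbb{E}$ is the connected, simply connected Lie group whose Lie algebra $\mathrm{Lie}(\mathbb{E})=V_1\oplus V_2\oplus V_3$ has a basis $(X_1,X_2,X_3,X_4)$ with only nontrivial brackets $[X_1,X_2]=X_3$, $[X_1,X_3]=X_4$; $V_1=\mathrm{span}\{X_1,X_2\}$, $V_2=\mathrm{span}\{X_3\}$, $V_3=\mathrm{span}\{X_4\}$. Via the exponential map, $\mathbb{E}$ is identified with a graded vector space $H_1\oplus H_2\oplus H_3$ ($H_j$ corresponding to $V_j$) with product given by the Baker-Campbell-Hausdorff formula and unit element $0$. Dilations: $\delta_r v=r^jv$ for $v\in H_j$, $r>0$. A homogeneous distance $d$ is a continuous, left invariant distance with $d(\delta_rx,\delta_ry)=r\,d(x,y)$; $\mathbb{B}(x,r)$ is the closed ball. A graded basis $(Y_1,\dots,Y_4)$ of $\mathrm{Lie}(\mathbb{E})$ is a basis with $Y_1,Y_2\in V_1$, $Y_3\in V_2$, $Y_4\in V_3$; the degrees are $d_1=d_2=1$, $d_3=2$, $d_4=3$. A left invariant Riemannian metric $g$ is graded if some graded basis is orthonormal; one such $g$ is fixed, $|\cdot|_g$ also denotes its norm on $2$-vectors, and $|\cdot|$ is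 the norm of the scalar product induced by $g$ on $\mathbb{E}\cong T_0\mathbb{E}$. Degree. For a $2$-dimensional $C^1$ submanifold (surface) $\Sigma$ and $p\in\Sigma$, let $\tau_\Sigma(p)=t_1\wedge t_2$ with $(t_1,t_2)$ a basis of $T_p\Sigma$ and let $\xi_{p,\Sigma}=\sum_{i<j}c_{ij}Y_i\wedge Y_j$ be the left invariant $2$-vector field with $\xi_{p,\Sigma}(p)=\tau_\Sigma(p)$. Then $d_\Sigma(p)=\max\{d_i+d_j:c_{ij}\ne0\}$, $d(\Sigma)=\max_\Sigma d_\Sigma$, and $p$ has maximum degree if $d_\Sigma(p)=d(\Sigma)$. Put $\xi_{p,\Sigma,M}=\sum_{d_i+d_j=M}c_{ij}Y_i\wedge Y_j$. With $M=d_\Sigma(p)$, $\mathcal{A}_p\Sigma=\{X\in\mathrm{Lie}(\mathbb{E}):X\wedge\xi_{p,\Sigma,M}=0\}$ and the homogeneous tangent space is $A_p\Sigma=\exp(\mathcal{A}_p\Sigma)\subset\mathbb{E}$. Intrinsic measure. With $N=d(\Sigma)$, for any Riemannian metric $\tilde g$ choose $\tau_\Sigma$ (not necessarily continuous) with $|\tau_\Sigma|_{\tilde g}=1$ and put $\tau^{\tilde g}_{\Sigma,N}(p)=\xi_{p,\Sigma,N}(p)$; then $\mu_\Sigma=|\tau^{\tilde g}_{\Sigma,N}|_g\,\sigma_{\tilde g}$, with $\sigma_{\tilde g}$ the Riemannian surface measure on $\Sigma$ induced by $\tilde g$ (independent of $\tilde g$), regarded as a measure on $\mathbb{E}$ concentrated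 on $\Sigma$. Spherical Federer density. $\theta^a(\mu,p)=\inf_{\varepsilon>0}\sup\{2^a\mu(B)/\mathrm{diam}(B)^a:\ p\in B,\ B\text{ a closed ball of positive radius},\ \mathrm{diam}(B)<\varepsilon\}$. Spherical factor. For a $k$-dimensional linear subspace $V\subset\mathbb{E}$, $\beta_d(V)=\max_{d(u,0)\le1}\mathcal{H}^k_{|\cdot|}(\mathbb{B}(u,1)\cap V)$, with $\mathcal{H}^k_{|\cdot|}$ the standard Euclidean Hausdorff measure of $|\cdot|$. *)

(* Defs.v *)
From HB Require Import structures.
From mathcomp Require Import all_boot all_order all_algebra.
From mathcomp Require Import all_classical all_reals all_analysis.
From mathcomp Require Import ring.
Import Order.TTheory GRing.Theory Num.Theory.
Import numFieldNormedType.Exports.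

Set Implicit Arguments.
Unset Strict Implicit.
Unset Printing Implicit Defensive.

Local Open Scope classical_set_scope.
Local Open Scope ring_scope.

(* The Engel group E and its Lie algebra Lie(E) are both modelled on 'rV[R]_4,
   with coordinates with respect to the basis (X_1, X_2, X_3, X_4), indexed
   from 0.  The group law is the Baker-Campbell-Hausdorff product, so that the
   exponential map Lie(E) -> E is the identity of 'rV[R]_4. *)

Section Calculus.
Context {R : realType}.

(* [Ck k U f]: f is of class C^k on the (open) set U. *)
Fixpoint Ck {V W : normedModType R} (k : nat) (U : set V) (f : V -> W) : Prop :=
  (forall x, U x -> {for x, continuous f}) /\
  if k is k'.+1 then
    forall v : V, (forall x, U x -> derivable f x v) /\ Ck k' U ('D_v f)
  else True.

End Calculus.

Section EngelGroup.
Context {R : realType}.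
Notation E := 'rV[R]_4.

Definition deg (i : 'I_4) : nat := nth 0%N [:: 1; 1; 2; 3]%N i.

(* The layer V_j. *)
Definition layer (j : nat) : set E :=
  [set v | forall i, deg i != j -> v 0 i = 0].

Definition bracket (x y : E) : E :=
  (x 0 (inord 0) * y 0 (inord 1) - x 0 (inord 1) * y 0 (inord 0))
     *: delta_mx 0 (inord 2)
  + (x 0 (inord 0) * y 0 (inord 2) - x 0 (inord 2) * y 0 (inord 0))
     *: delta_mx 0 (inord 3).

(* The BCH series, which stops at order three since Lie(E) has step three. *)
Definition engel_mul (x y : E) : E :=
  x + y + 2^-1 *: bracket x y
  + 12^-1 *: (bracket x (bracket x y) + bracket y (bracket y x)).

Definition dilation (r : R) (x : E) : E := \row_i (r ^+ deg i * x 0 i).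

(* The value at p of the left invariant vector field X with X(0) = v. *)
Definition left_field (v p : E) : E := 'D_v (engel_mul p) 0.

Lemma bracketZ k x y : bracket x (k *: y) = k *: bracket x y.
Proof. by rewrite /bracket !mxE; apply/rowP => i; rewrite !mxE; ring. Qed.
Lemma bracketZl k x y : bracket (k *: x) y = k *: bracket x y.
Proof. by rewrite /bracket !mxE; apply/rowP => i; rewrite !mxE; ring. Qed.

Lemma left_fieldE (v p : E) :
  left_field v p = v + 2^-1 *: bracket p v + 12^-1 *: bracket p (bracket p v).
Proof.
rewrite /left_field /derive.
set A := RHS; set B := 12^-1 *: bracket v (bracket v p).
apply/cvg_lim => //.
have b0 x : bracket x 0 = 0 by apply/rowP => i; rewrite !mxE; ring.
have b0l x : bracket 0 x = 0 by apply/rowP => i; rewrite !mxE; ring.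
have : A + h *: B @[h --> (0 : R)^'] --> A + 0 *: B.
  apply: cvgD; first exact: cvg_cst.
  apply: cvgZ; last exact: cvg_cst.
  exact: nbhs_dnbhs.
rewrite scale0r addr0; apply: cvg_trans; apply: near_eq_cvg.
near=> h.
have h0 : h != 0 by near: h; exact: nbhs_dnbhs_neq.
rewrite /= addr0 /engel_mul /A /B !b0 !b0l !scaler0 !addr0 ?scaler0 ?addr0.
rewrite !(bracketZ,bracketZl).
set b1 := bracket p v; set b2 := bracket p b1; set b3 := bracket v (bracket v p).
apply/rowP => i; rewrite !mxE; field; exact: h0.
Unshelve. all: by end_near. Qed.

Record homogeneous_distance (d : E -> E -> R) : Prop := {
  hdist_ge0 : forall x y, 0 <= d x y ;
  hdist_eq0 : forall x y, d x y = 0 <-> x = y ;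
  hdist_sym : forall x y, d x y = d y x ;
  hdist_triangle : forall x y z, d x z <= d x y + d y z ;
  hdist_continuous : continuous (fun xy : E * E => d xy.1 xy.2) ;
  hdist_left_invariant : forall z x y,
    d (engel_mul z x) (engel_mul z y) = d x y ;
  hdist_dilation : forall r x y,
    0 < r -> d (dilation r x) (dilation r y) = r * d x y }.

Definition closed_ball_of (d : E -> E -> R) (x : E) (r : R) : set E :=
  [set y | d x y <= r].

(* Bases of Lie(E) are given by the rows of a matrix. *)
Definition graded_basis (Y : 'M[R]_4) : Prop :=
  Y \in unitmx /\ forall i, layer (deg i) (row i Y).

(* A metric is given at each point by its Gram matrix in the coordinates. *)
Definition inner (G : 'M[R]_4) (v w : E) : R := (v *m G *m w^T) 0 0.

Definition vnorm (G : 'M[R]_4) (v : E) : R := Num.sqrt (inner G v v).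

Record riemannian_metric (g : E -> 'M[R]_4) : Prop := {
  metric_smooth : forall k, Ck k [set: E] g ;
  metric_sym : forall p, (g p)^T = g p ;
  metric_pos : forall p v, v != 0 -> 0 < inner (g p) v v }.

Definition left_invariant_metric (g : E -> 'M[R]_4) : Prop :=
  forall z p v w,
    inner (g (engel_mul z p)) ('D_v (engel_mul z) p) ('D_w (engel_mul z) p)
    = inner (g p) v w.

Definition graded_metric (g : E -> 'M[R]_4) : Prop :=
  left_invariant_metric g /\
  exists2 Y, graded_basis Y & forall p i j,
    inner (g p) (left_field (row i Y) p) (left_field (row j Y) p)
    = (i == j)%:R.

(* A 2-vector \sum_(i < j) w_ij e_i /\ e_j is represented by the skew-symmetric
   matrix (w_ij). *)
Definition wedge (v w : E) : 'M[R]_4 := v^T *m w - w^T *m v.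

(* Component (i, j, k) of the 3-vector v /\ xi. *)
Definition wedge12 (v : E) (xi : 'M[R]_4) (i j k : 'I_4) : R :=
  v 0 i * xi j k - v 0 j * xi i k + v 0 k * xi i j.

(* Norm on 2-vectors of the scalar product induced by G, for which
   <a /\ b, c /\ d> = <a, c> <b, d> - <a, d> <b, c>; see [inner2_wedge]. *)
Definition inner2 (G w w' : 'M[R]_4) : R := 2^-1 * \tr (w *m G *m w'^T *m G).

Definition norm2 (G w : 'M[R]_4) : R := Num.sqrt (inner2 G w w).

Lemma inner2_wedge (G : 'M[R]_4) (a b c d : E) : G^T = G ->
  inner2 G (wedge a b) (wedge c d)
  = inner G a c * inner G b d - inner G a d * inner G b c.
Proof.
move=> Gs.
have tr2 (u v w z : E) :
    \tr (u^T *m v *m G *m (w^T *m z) *m G) = inner G v w * inner G z u.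
  have -> : u^T *m v *m G *m (w^T *m z) *m G
          = u^T *m (v *m G *m w^T) *m (z *m G) by rewrite !mulmxA.
  rewrite [v *m G *m w^T]mx11_scalar -/(inner G v w) mul_mx_scalar -scalemxAl.
  by rewrite mxtraceZ mxtrace_mulC trace_mx11.
have sym (u v : E) : inner G u v = inner G v u.
  rewrite /inner -[in LHS](trmxK (u *m G *m v^T)) mxE.
  by rewrite !trmx_mul trmxK Gs mulmxA.
have trB (A B : 'M[R]_4) : \tr (A - B) = \tr A - \tr B by exact: raddfB.
have wT : (wedge c d)^T = d^T *m c - c^T *m d.
  by rewrite /wedge [LHS]raddfB /= !trmx_mul !trmxK.
rewrite /inner2 wT /wedge !mulmxBl !mulmxBr !mulmxBl.
rewrite !trB !tr2 (sym d a) (sym c b) (sym c a) (sym d b).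
by field.
Qed.

End EngelGroup.

Section Surfaces.
Context {R : realType}.
Notation E := 'rV[R]_4.
Implicit Types (S : set E) (Y : 'M[R]_4) (p : E).

Definition d1 (phi : R * R -> E) : R * R -> E := 'D_((1, 0) : R * R) phi.
Definition d2 (phi : R * R -> E) : R * R -> E := 'D_((0, 1) : R * R) phi.

(* A local parametrization of S: an injective C^1 immersion of an open W which
   is a homeomorphism onto a relatively open subset of S. *)
Record chart S (W : set (R * R)) (phi : R * R -> E) : Prop := {
  chart_open : open W ;
  chart_C1 : Ck 1 W phi ;
  chart_immersion : forall q, W q -> row_free (col_mx (d1 phi q) (d2 phi q)) ;
  chart_inj : {in W &, injective phi} ;
  chart_homeo : forall O : set (R * R), open O -> O `<=` W ->
    exists2 U : set E, open U & phi @` O = S `&` U }.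

Definition C1_surface S : Prop :=
  forall p, S p -> exists W phi, chart S W phi /\ (phi @` W) p.

Definition tangent S p : set E :=
  [set v | exists W phi q,
     [/\ chart S W phi, W q, phi q = p & exists u : R * R, v = 'D_u phi q]].

Definition basis2 (T : set E) (t1 t2 : E) : Prop :=
  row_free (col_mx t1 t2) /\ T = [set v | (v <= col_mx t1 t2)%MS].

(* tau_Sigma(p), for some choice of a basis of the tangent space. *)
Definition tangent2 S p : 'M[R]_4 :=
  xget 0 [set w | exists t1 t2, basis2 (tangent S p) t1 t2 /\ w = wedge t1 t2].

Definition frame Y p : 'M[R]_4 := \matrix_i left_field (row i Y) p.

(* The coefficients c_ij of w = \sum_(i < j) c_ij Y_i(p) /\ Y_j(p);
   see [coef2P]. *)
Definition coef2 Y p (w : 'M[R]_4) : 'M[R]_4 :=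
  (invmx (frame Y p))^T *m w *m invmx (frame Y p).

(* \sum_(i < j, d_i + d_j = N) c_ij F_i /\ F_j, where F_i is the i-th row of F. *)
Definition graded_part (F c : 'M[R]_4) (N : nat) : 'M[R]_4 :=
  \sum_(i < 4) \sum_(j < 4 | (i < j)%N && (deg i + deg j == N)%N)
     c i j *: wedge (row i F) (row j F).

Lemma coef2P Y p (w : 'M[R]_4) : frame Y p \in unitmx -> w^T = - w ->
  w = \sum_(i < 4) \sum_(j < 4 | (i < j)%N)
        coef2 Y p w i j *: wedge (row i (frame Y p)) (row j (frame Y p)).
Proof.
set F := frame Y p => Fu w_skew.
set c := coef2 Y p w.
have wE : w = F^T *m c *m F.
  rewrite /c /coef2 -/F !mulmxA -trmx_mul mulVmx // trmx1 mul1mx.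
  by rewrite -mulmxA mulVmx // mulmx1.
have c_skew i j : c j i = - c i j.
  have : c^T = - c.
    by rewrite /c /coef2 !trmx_mul trmxK w_skew mulNmx mulmxN mulmxA.
  by move/matrixP/(_ i j); rewrite !mxE.
have c_diag i : c i i = 0.
  by have /eqP := c_skew i i; rewrite -addr_eq0 -mulr2n mulrn_eq0 /= => /eqP.
pose f i j := c i j *: ((row i F)^T *m row j F).
have {1}-> : w = \sum_i \sum_j f i j.
  rewrite wE; apply/matrixP => k l; rewrite mxE summxE.
  under eq_bigr do rewrite mxE mulr_suml.
  rewrite exchange_big /=; apply: eq_bigr => i _; rewrite summxE.
  apply: eq_bigr => j _; rewrite /f !mxE big_ord1 !mxE; by ring.
transitivity (\sum_(i < 4) (\sum_(j < 4 | (i < j)%N) f i j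
                              + \sum_(j < 4 | (j < i)%N) f i j)).
  apply: eq_bigr => i _; rewrite (bigD1 i) //= {1}/f c_diag scale0r add0r.
  rewrite (bigID (fun j : 'I_4 => (i < j)%N)) /=; congr +%R; apply: eq_bigl => j.
    by rewrite andbC; case: ltngtP => //= ij; rewrite -val_eqE/= gtn_eqF.
  by rewrite -val_eqE /=; case: ltngtP.
rewrite big_split /= [X in _ + X](exchange_big_dep xpredT) //= -big_split /=.
apply: eq_bigr => i _; rewrite -big_split /=; apply: eq_bigr => j _.
by rewrite /f (c_skew i j) scaleNr -scalerBr.
Qed.

(* d_Sigma(p) *)
Definition pdegree Y S p : nat :=
  \max_(ij : 'I_4 * 'I_4 |
        (ij.1 < ij.2)%N && (coef2 Y p (tangent2 S p) ij.1 ij.2 != 0))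
     (deg ij.1 + deg ij.2)%N.

(* d(Sigma); pointwise degrees do not exceed d_3 + d_4 = 5. *)
Definition degree Y S : nat :=
  \max_(m < 6 | `[< exists2 p, S p & pdegree Y S p = m >]) m.

(* xi_{p, Sigma, N} as an element of the second exterior power of Lie(E). *)
Definition xi_part Y S p (N : nat) : 'M[R]_4 :=
  graded_part Y (coef2 Y p (tangent2 S p)) N.

(* exp is the identity in our coordinates: this is both the Lie algebra
   (as a set of vectors v) and the homogeneous tangent space A_p Sigma. *)
Definition homogeneous_tangent Y S p : set E :=
  [set v | forall i j k, wedge12 v (xi_part Y S p (pdegree Y S p)) i j k = 0].

End Surfaces.

(* E with its Borel sigma-algebra. *)
Notation borelE R := (g_sigma_algebraType (@open 'rV[R]_4)).

Section Measures.
Context {R : realType}.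
Notation E := 'rV[R]_4.
Implicit Types (S : set E) (Y : 'M[R]_4) (p : E).

(* The Riemannian surface measure on S induced by gt, as a Borel measure on E:
   it is concentrated on S and in each chart it has the usual density
   |d_1 phi /\ d_2 phi| = sqrt (det (<d_a phi, d_b phi>)). *)
Definition surface_measure (gt : E -> 'M[R]_4) S
    (sigma : {measure set (borelE R) -> \bar R}) : Prop :=
  sigma (~` S) = 0%E /\
  forall W phi, chart S W phi ->
  forall A : set (borelE R), measurable A -> A `<=` phi @` W ->
    sigma A = (\int[(@lebesgue_measure R \x @lebesgue_measure R)%E]_(q in
                 (W `&` phi @^-1` A))
                (norm2 (gt (phi q)) (wedge (d1 phi q) (d2 phi q)))%:E)%E.

Definition unit_tangent2 (gt : E -> 'M[R]_4) S p : 'M[R]_4 :=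
  (norm2 (gt p) (tangent2 S p))^-1 *: tangent2 S p.

(* The value at p of the left invariant 2-vector field xi_{p, Sigma, N}
   associated with the gt-unit tangent 2-vector. *)
Definition tau_part (gt : E -> 'M[R]_4) Y S (N : nat) p : 'M[R]_4 :=
  graded_part (frame Y p) (coef2 Y p (unit_tangent2 gt S p)) N.

(* mu_Sigma *)
Definition intrinsic_measure (g gt : E -> 'M[R]_4) Y S
    (sigma : {measure set (borelE R) -> \bar R}) (A : set E) : \bar R :=
  (\int[sigma]_(x in (A `&` S))
     (norm2 (g x) (tau_part gt Y S (degree Y S) x))%:E)%E.

Definition diam (d : E -> E -> R) (A : set E) : \bar R :=
  ereal_sup [set t | exists x y, [/\ A x, A y & t = (d x y)%:E]].

(* theta^a(mu, p) *)
Definition spherical_density (d : E -> E -> R) (a : R)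
    (mu : set E -> \bar R) p : \bar R :=
  ereal_inf [set s | exists2 eps : R, 0 < eps & s =
    ereal_sup [set t | exists x r, let B := closed_ball_of d x r in
      [/\ 0 < r, B p, (diam d B < eps%:E)%E &
          t = ((2 `^ a / fine (diam d B) `^ a)%:E * mu B)%E]]].

(* The volume of the unit ball of R^k, by omega_(k+2) = 2 pi / (k + 2) omega_k. *)
Fixpoint unit_ball_volume (k : nat) : R :=
  match k with
  | 0 => 1
  | 1 => 2
  | (k'.+2 as k) => 2 * pi / k%:R * unit_ball_volume k'
  end.

(* The k-dimensional Hausdorff measure (k > 0) of the distance rho, normalized
   as the Lebesgue measure on Euclidean k-planes. *)
Definition hausdorff_pre (rho : E -> E -> R) (k : nat) (delta : R)
    (A : set E) : \bar R :=
  ereal_inf [set s | exists F : nat -> set E,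
    [/\ A `<=` \bigcup_n F n, forall n, (diam rho (F n) <= delta%:E)%E &
        s = (\sum_(0 <= n <oo)
               (unit_ball_volume k * (fine (diam rho (F n)) / 2) ^+ k)%:E)%E]].

Definition hausdorff (rho : E -> E -> R) (k : nat) (A : set E) : \bar R :=
  ereal_sup [set hausdorff_pre rho k delta A | delta in [set x : R | 0 < x]].

(* The distance of the scalar product induced by g on E = T_0 E. *)
Definition euclidean (g : E -> 'M[R]_4) (x y : E) : R := vnorm (g 0) (x - y).

(* The values whose maximum is beta_d(V), for V of dimension k. *)
Definition spherical_values (d : E -> E -> R) (g : E -> 'M[R]_4) (k : nat)
    (V : set E) : set (\bar R) :=
  [set hausdorff (euclidean g) k (closed_ball_of d u 1 `&` V)
     | u in [set u | d u 0 <= 1]].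

Definition is_spherical_factor (d : E -> E -> R) (g : E -> 'M[R]_4) (k : nat)
    (V : set E) (b : \bar R) : Prop :=
  spherical_values d g k V b /\ ubound (spherical_values d g k V) b.

End Measures.

(* Main.v *)
Require Import Defs.
From HB Require Import structures.
From mathcomp Require Import all_boot all_order all_algebra.
From mathcomp Require Import all_classical all_reals all_analysis.
From mathcomp Require Import measurable_realfun.
From mathcomp Require Import ring lra.
Import Order.TTheory GRing.Theory Num.Theory.
Import numFieldNormedType.Exports.

Set Implicit Arguments.
Unset Strict Implicit.
Unset Printing Implicit Defensive.

Local Open Scope classical_set_scope.
Local Open Scope ring_scope.

(** Both sides of the identity are the largest area that a unit ball containing 0
    cuts out of the homogeneous tangent plane. The proof rescales the surface around
    p and shows that it converges to this plane well enough for the measures of all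
    small balls to be read on the plane.

    The plane. Coefficients of 2-vectors in the left invariant frame X_1, ..., X_4
    form skew matrices. A change between graded bases mixes only coefficients of the
    same degree ([mask_conj]), so degree 4 means two things: the coefficient on
    X_3 /\ X_4 of the tangent 2-vector vanishes on all of the surface, and at p the
    part of degree 4 is h /\ X_4 with h horizontal and nonzero. Thus the homogeneous
    tangent plane is spanned by h and X_4 ([homogeneous_tangentE]); with v and e the
    normalized vectors, z |-> z_1 v + z_2 e is an isometric parametrization.

    The chart. The surface measure may be computed in any chart. The inverse function
    theorem provides one, Phi, for which z_1 and z_2 are the scalar products of
    p^-1 Phi(z) with v and e ([adapted_chart]). The product of the densities of the
    intrinsic measure and of the surface measure is the norm of h /\ X_4, whatever
    the auxiliary metric is ([tau_density_jac]), and in this chart it equals 1 at 0.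

    The contact. Let f(z) = p^-1 Phi(z). The dilation by 1 / r of f(r z_1, r^3 z_2)
    converges to z_1 v + z_2 e provided that the X_3-coordinate of f is
    o(z_1^2) + O(z_2). This does not follow from f being of class C^1. It comes from
    the vanishing coefficient: along the curve z_2 = 0 the horizontal coordinates are
    z_1 v + o(z_1) with derivative v + o(1), so they sweep an area o(z_1^2), and the
    vanishing of the coefficient on X_3 /\ X_4 forces the X_3-coordinate to follow
    this area ([contact_estimate], [second_order]). No regularity beyond C^1 enters.

    The density. A ball of radius r containing p has diameter 2 r and is centred at p
    times the dilation by r of some u with d(u, 0) <= 1. By the convergence, its
    intersection with the surface lies between the rescaled sections of the plane by
    balls of radii 1 - eps and 1 + eps centred at u, uniformly in u
    ([ball_sandwich]); so its measure is r^4 times the area of the section by the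
    unit ball, up to factors close to 1 ([small_ball_measure]). Changing the radius
    is a dilation of the centre, and the areas attain their maximum over u because
    they are upper semicontinuous ([strip_max]); hence the density is this maximum
    ([spherical_density_max]).

    The spherical factor. For compact subsets of an isometrically embedded plane the
    Hausdorff measure is the area ([hausdorff_plane]). One inequality is the
    isodiametric inequality, proved by Steiner symmetrization. For the other one,
    filling a square with its inscribed disc improves any constant bounding the
    premeasure of squares by their area, until the constant is 1. *)

(** * Strict differentiability of maps of two variables *)

Section Sdiff.
Context {R : realType}.
Local Notation P := (R * R)%type.

Lemma prod_norm_le (x : P) (e : R) : (`|x| <= e) = (`|x.1| <= e) && (`|x.2| <= e).
Proof. by rewrite prod_normE ge_max. Qed.

Lemma prod_norm_lt (x : P) (e : R) : (`|x| < e) = (`|x.1| < e) && (`|x.2| < e).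
Proof. by rewrite prod_normE gt_max. Qed.

Lemma norm_fst_le (x : P) : `|x.1| <= `|x|.
Proof. by have := lexx `|x|; rewrite {1}prod_norm_le => /andP[]. Qed.

Lemma norm_snd_le (x : P) : `|x.2| <= `|x|.
Proof. by have := lexx `|x|; rewrite {1}prod_norm_le => /andP[]. Qed.

Lemma rV_norm_le n (x : 'rV[R]_n) (e : R) : 0 <= e ->
  (forall i, `|x 0 i| <= e) -> `|x| <= e.
Proof.
move=> e0 h; rewrite /Num.Def.normr/= mx_normrE; apply: bigmax_le => // -[i j] _ /=.
by rewrite ord1.
Qed.

Lemma rV_norm_ge n (x : 'rV[R]_n) i : `|x 0 i| <= `|x|.
Proof.
by rewrite [leRHS]/Num.Def.normr/= mx_normrE; exact: (le_bigmax _ _ (ord0, i)).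
Qed.

Lemma cont_coord (T : topologicalType) m n (f : T -> 'M[R]_(m, n)) x i j :
  {for x, continuous f} -> {for x, continuous (fun y => f y i j)}.
Proof.
by move=> cf; apply: (@continuous_comp _ _ _ f (fun M : 'M[R]_(m, n) => M i j)) => //;
  exact: coord_continuous.
Qed.

Lemma nbhs_normE (V : normedModType R) (q : V) (A : set V) :
  nbhs q A <-> exists2 r, 0 < r & forall y, `|y - q| < r -> A y.
Proof.
split=> [/nbhs_ballP[r r0 h]|[r r0 h]].
  by exists r => // y yq; apply: h; rewrite -ball_normE /= distrC.
by apply/nbhs_ballP; exists r => // y; rewrite -ball_normE /= distrC; exact: h.
Qed.

(** Strict differentiability at q, with partial derivatives a and b. Two moving
    points make the notion stable under composition and inversion without any
    appeal to the mean value theorem. *)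
Definition sdiff {V : normedModType R} (f : P -> V) (q : P) (a b : V) :=
  forall e, 0 < e -> exists2 r, 0 < r & forall x y, `|x - q| < r -> `|y - q| < r ->
    `|f x - f y - ((x - y).1 *: a + (x - y).2 *: b)| <= e * `|x - y|.

Section normed.
Context {V : normedModType R}.
Implicit Types (f g : P -> V) (q : P) (a b : V).

(** An error [C * e * `|x - y|] suffices, so error terms may be added freely. *)
Lemma sdiff_weak f q a b C : (forall e, 0 < e -> exists2 r, 0 < r & 
    forall x y, `|x - q| < r -> `|y - q| < r ->
    `|f x - f y - ((x - y).1 *: a + (x - y).2 *: b)| <= C * e * `|x - y|) ->
  sdiff f q a b.
Proof.
move=> h e e0.
have C0 : 0 < `|C| + 1 by rewrite ltr_wpDl.
have [r r0 hr] := h (e / (`|C| + 1)) (divr_gt0 e0 C0).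
exists r => // x y xq yq; apply: le_trans (hr _ _ xq yq) _.
rewrite ler_wpM2r// mulrCA ger_pMr// ler_pdivrMr// mul1r.
by rewrite (le_trans (ler_norm C))// lerDl.
Qed.

Lemma lin_norm_le (u : P) a b : `|u.1 *: a + u.2 *: b| <= (`|a| + `|b|) * `|u|.
Proof.
rewrite (le_trans (ler_normD _ _))// !normrZ mulrDl lerD// mulrC ler_wpM2l//.
- exact: norm_fst_le.
- exact: norm_snd_le.
Qed.

Lemma sdiff_lip f q a b : sdiff f q a b -> exists2 r, 0 < r &
  forall x y, `|x - q| < r -> `|y - q| < r ->
    `|f x - f y| <= (`|a| + `|b| + 1) * `|x - y|.
Proof.
move=> /(_ 1 ltr01)[r r0 h]; exists r => // x y xq yq.
rewrite -[f x - f y](subrK ((x - y).1 *: a + (x - y).2 *: b)).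
rewrite (le_trans (ler_normD _ _))// mulrDl addrC lerD//; last exact: h.
exact: lin_norm_le.
Qed.

Lemma sdiff_cont f q a b : sdiff f q a b -> {for q, continuous f}.
Proof.
move=> /sdiff_lip[r r0 h]; apply/cvgrPdist_le => e e0.
set C := _ + 1 in h.
have C0 : 0 < C by rewrite /C ltr_wpDl// addr_ge0.
suff : nbhs q [set y : P | `|f q - f y| <= e] by []. apply: (nbhs_normE _ _).2; exists (Num.min r (e / C)) => /=.
  by rewrite lt_min r0 divr_gt0.
move=> y; rewrite lt_min => /andP[yr ye].
rewrite (le_trans (h _ _ _ _))//; first by rewrite subrr normr0.
by rewrite distrC mulrC -ler_pdivlMr// ltW.
Qed.

Lemma sdiff_is_derive f q a b u : sdiff f q a b ->
  is_derive q u f (u.1 *: a + u.2 *: b).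
Proof.
move=> h; set l := _ + _.
have L : (fun k : R => k^-1 *: ((f \o shift q) (k *: u) - f q)) @ 0^' --> l.
  apply/cvgrPdist_le => e e0.
  have u0 : 0 < `|u| + 1 by rewrite ltr_wpDl.
  have [r r0 hr] := h (e / (`|u| + 1)) (divr_gt0 e0 u0).
  have ru0 : 0 < r / (`|u| + 1) by rewrite divr_gt0.
  near=> k.
  have k0 : k != 0 by near: k; exact: nbhs_dnbhs_neq.
  have kr : `|k| < r / (`|u| + 1).
    by near: k; exact: dnbhs0_lt.
  have := hr (k *: u + q) q; rewrite addrK subrr normr0 => /(_ _ r0).
  rewrite normrZ => hk.
  have {hk} : `|f (k *: u + q) - f q - ((k *: u).1 *: a + (k *: u).2 *: b)| <=
      e / (`|u| + 1) * (`|k| * `|u|).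
    apply: hk; rewrite ltr_pdivlMr// in kr; apply: le_lt_trans kr.
    by rewrite ler_wpM2l// lerDl.
  have -> : (k *: u).1 *: a + (k *: u).2 *: b = k *: l by rewrite /l scalerDr !scalerA.
  move=> hk /=.
  have -> : l - k^-1 *: (f (k *: u + q) - f q) =
     - (k^-1 *: (f (k *: u + q) - f q - k *: l)).
    by rewrite [in RHS]scalerBr scalerA mulVf// scale1r opprB.
  rewrite normrN normrZ normfV ler_pdivrMl ?normr_gt0//.
  rewrite (le_trans hk)// mulrCA ler_wpM2l// mulrAC ler_pdivrMr//.
  by rewrite ler_wpM2l ?ltW// ltrDl.
apply: DeriveDef; first by apply/cvg_ex; exists l.
exact: cvg_lim L.
Unshelve. all: by end_near. Qed.

Lemma sdiff_derive f q a b u : sdiff f q a b -> 'D_u f q = u.1 *: a + u.2 *: b.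
Proof. by move=> h; have [] := sdiff_is_derive u h. Qed.

Lemma sdiff_d1 f q a b : sdiff f q a b -> 'D_((1, 0) : P) f q = a.
Proof. by move=> /sdiff_derive ->; rewrite /= scale1r scale0r addr0. Qed.

Lemma sdiff_d2 f q a b : sdiff f q a b -> 'D_((0, 1) : P) f q = b.
Proof. by move=> /sdiff_derive ->; rewrite /= scale1r scale0r add0r. Qed.

Lemma sdiff_cst q a : sdiff (fun=> a) q 0 0.
Proof.
move=> e e0; exists 1 => // x y _ _.
by rewrite !scaler0 subrr addr0 subrr normr0 mulr_ge0// ltW.
Qed.

Lemma sdiffD f g q a b a' b' : sdiff f q a b -> sdiff g q a' b' ->
  sdiff (fun x => f x + g x) q (a + a') (b + b').
Proof.
move=> hf hg; apply: (@sdiff_weak _ _ _ _ 2) => e e0.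
have [r r0 hr] := hf _ e0; have [s s0 hs] := hg _ e0.
exists (Num.min r s); first by rewrite lt_min r0.
move=> x y; rewrite !lt_min => /andP[xr xs] /andP[yr ys].
have E (F1 F2 G1 G2 A A' B B' : V) : F1 + G1 - (F2 + G2) - ((A + A') + (B + B'))
    = (F1 - F2 - (A + B)) + (G1 - G2 - (A' + B')).
  by rewrite [A + A' + _]addrACA !opprD [F1 + G1 + _]addrACA; exact: addrACA.
rewrite !scalerDr E.
by rewrite (le_trans (ler_normD _ _))// -mulrA mulr2n mulrDl mul1r lerD ?hr ?hs.
Qed.

Lemma sdiffZ (k : R) f q a b : sdiff f q a b ->
  sdiff (fun x => k *: f x) q (k *: a) (k *: b).
Proof.
move=> hf; apply: (@sdiff_weak _ _ _ _ `|k|) => e e0.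
have [r r0 hr] := hf _ e0; exists r => // x y xr yr.
rewrite !(scalerA _ k) ![_ * k]mulrC -!scalerA -scalerDr -!scalerBr normrZ.
by rewrite -mulrA ler_wpM2l// hr.
Qed.

End normed.

Lemma sdiff_comp (V : normedModType R) (f : P -> V) (G : P -> P) y (a b : V) (a' b' : P) : sdiff f (G y) a b -> sdiff G y a' b' ->
  sdiff (f \o G) y (a'.1 *: a + a'.2 *: b) (b'.1 *: a + b'.2 *: b).
Proof.
move=> hf hG; have [r1 r10 hL] := sdiff_lip hG.
set L := _ + 1 in hL.
have L0 : 0 < L by rewrite /L ltr_wpDl// addr_ge0.
clearbody L.
apply: (@sdiff_weak _ _ _ _ _ (L + (`|a| + `|b|))) => e e0.
have [r r0 hr] := hf _ e0; have [s s0 hs] := hG _ e0.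
exists (Num.min (Num.min r1 s) (r / L)); first by rewrite !lt_min r10 s0 divr_gt0.
move=> u v; rewrite !lt_min => /andP[/andP[ur1 us] ur] /andP[/andP[vr1 vs] vr].
have close w : `|w - y| < r1 -> `|w - y| < r / L -> `|G w - G y| < r.
  move=> w1 w2; apply: le_lt_trans (hL _ _ w1 _) _; first by rewrite subrr normr0.
  by rewrite mulrC -ltr_pdivlMr.
set D := G u - G v; set E := (u - v).1 *: a' + (u - v).2 *: b'.
have -> : (f \o G) u - (f \o G) v - ((u - v).1 *: (a'.1 *: a + a'.2 *: b) +
      (u - v).2 *: (b'.1 *: a + b'.2 *: b))
  = (f (G u) - f (G v) - (D.1 *: a + D.2 *: b)) + ((D - E).1 *: a + (D - E).2 *: b).
  have -> : (u - v).1 *: (a'.1 *: a + a'.2 *: b) + (u - v).2 *: (b'.1 *: a + b'.2 *: b)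
     = E.1 *: a + E.2 *: b.
    have E1 : E.1 = (u - v).1 * a'.1 + (u - v).2 * b'.1 by [].
    have E2 : E.2 = (u - v).1 * a'.2 + (u - v).2 * b'.2 by [].
    rewrite E1 E2 !scalerDr !scalerA; move: (u - v) => w.
    by rewrite !scalerDl; exact: addrACA.
  have -> : (D - E).1 *: a + (D - E).2 *: b =
      (D.1 *: a + D.2 *: b) - (E.1 *: a + E.2 *: b).
    by rewrite /= !scalerBl opprD; exact: addrACA.
  by rewrite addrA subrK.
rewrite (le_trans (ler_normD _ _))// !mulrDl lerD//.
  rewrite (le_trans (hr _ _ (close _ ur1 ur) (close _ vr1 vr)))//.
  by rewrite [L * e]mulrC -mulrA ler_pM2l//; exact: hL.
rewrite -!mulrDl (le_trans (lin_norm_le _ _ _))// -mulrA ler_wpM2l ?addr_ge0//.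
exact: hs.
Qed.

Lemma sdiff_fst q : sdiff (fst : P -> R) q 1 0.
Proof.
move=> e e0; exists 1 => // x y _ _.
by rewrite scaler0 addr0 /= /GRing.scale/= mulr1 subrr normr0 mulr_ge0// ltW.
Qed.

Lemma sdiffM (f g : P -> R) q a b a' b' : sdiff f q a b -> sdiff g q a' b' ->
  sdiff (fun x => f x * g x) q (a * g q + f q * a') (b * g q + f q * b').
Proof.
move=> hf hg.
have [r1 r10 hF] := sdiff_lip hf; have [s1 s10 hG] := sdiff_lip hg.
set F := _ + 1 in hF; set G := _ + 1 in hG.
have F0 : 0 < F by rewrite /F ltr_wpDl// addr_ge0.
have G0 : 0 < G by rewrite /G ltr_wpDl// addr_ge0.
clearbody F G.
apply: (@sdiff_weak _ _ _ _ _ (`|g q| + `|f q| + F * G + G * F)) => e e0.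
have [r r0 hr] := hf _ e0; have [s s0 hs] := hg _ e0.
exists (Num.min (Num.min (Num.min r s) (Num.min r1 s1)) e).
  by rewrite !lt_min r0 s0 r10 s10.
move=> x y; rewrite !lt_min => /andP[/andP[/andP[xr xs] /andP[xr1 xs1]] xe].
move=> /andP[/andP[/andP[yr ys] /andP[yr1 ys1]] ye].
set u := x - y.
have -> : f x * g x - f y * g y -
  (u.1 *: (a * g q + f q * a') + u.2 *: (b * g q + f q * b'))
  = (f x - f y - (u.1 *: a + u.2 *: b)) * g q +
    f q * (g x - g y - (u.1 *: a' + u.2 *: b')) + (f x - f y) * (g x - g q)
    + (f y - f q) * (g x - g y).
  by rewrite /GRing.scale/=; ring.
have qr1 : `|q - q| < r1 by rewrite subrr normr0.
have qs1 : `|q - q| < s1 by rewrite subrr normr0.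
have T (T1 T2 T3 T4 c1 c2 c3 c4 : R) : `|T1| <= c1 -> `|T2| <= c2 -> `|T3| <= c3 ->
    `|T4| <= c4 -> `|T1 + T2 + T3 + T4| <= c1 + c2 + c3 + c4.
  by move=> h1 h2 h3 h4; do 3 rewrite (le_trans (ler_normD _ _))// lerD//.
have -> : (`|g q| + `|f q| + F * G + G * F) * e * `|u| = `|g q| * e * `|u| +
   `|f q| * e * `|u| + F * G * e * `|u| + G * F * e * `|u| by ring.
apply: T.
- by rewrite normrM -mulrA mulrC ler_wpM2l// hr.
- by rewrite normrM -mulrA ler_wpM2l// hs.
- rewrite normrM.
  have h1 := hF _ _ xr1 yr1.
  have h2 : `|g x - g q| <= G * e.
    by rewrite (le_trans (hG _ _ xs1 qs1))// ler_pM2l// ltW.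
  have -> : F * G * e * `|u| = F * `|u| * (G * e) by ring.
  by rewrite ler_pM.
- rewrite normrM.
  have h1 := hG _ _ xs1 ys1.
  have h2 : `|f y - f q| <= F * e.
    by rewrite (le_trans (hF _ _ yr1 qr1))// ler_pM2l// ltW.
  have -> : G * F * e * `|u| = F * e * (G * `|u|) by ring.
  by rewrite ler_pM.
Qed.

Lemma sdiff_coord n (f : P -> 'rV[R]_n) q (a b : 'rV[R]_n) i : sdiff f q a b ->
  sdiff (fun x => f x 0 i) q (a 0 i) (b 0 i).
Proof.
move=> h e e0; have [r r0 hr] := h e e0; exists r => // x y xr yr.
rewrite (le_trans _ (hr _ _ xr yr))// (le_trans _ (rV_norm_ge _ i))//.
by rewrite !mxE.
Qed.

Lemma sdiff_rV n (f : P -> 'rV[R]_n) q (a b : 'rV[R]_n) :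
  (forall i, sdiff (fun x => f x 0 i) q (a 0 i) (b 0 i)) -> sdiff f q a b.
Proof.
move=> h e e0.
have H i := cid2 (h i e e0).
exists (\big[Num.min/1]_i s2val (H i)).
  by apply: lt_bigmin => // i _; case: (H i).
move=> x y xr yr; apply: rV_norm_le; first by rewrite mulr_ge0// ltW.
move=> i; have := s2valP' (H i) x y.
have lei : \big[Num.min/1]_i s2val (H i) <= s2val (H i) by exact: bigmin_le_cond.
by rewrite !mxE; apply; exact: lt_le_trans lei.
Qed.

Lemma sdiff_pair (f g : P -> R) q a b a' b' : sdiff f q a b -> sdiff g q a' b' ->
  sdiff (fun x => (f x, g x)) q (a, a') (b, b').
Proof.
move=> hf hg e e0; have [r r0 hr] := hf e e0; have [s s0 hs] := hg e e0.
exists (Num.min r s); first by rewrite lt_min r0.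
move=> x y; rewrite !lt_min => /andP[xr xs] /andP[yr ys].
by rewrite prod_norm_le /= hr// hs.
Qed.

Lemma mvt_ball (g dg : R -> R) (z r s t : R) : `|s - z| < r -> `|t - z| < r ->
  (forall c, `|c - z| < r -> is_derive c 1 g (dg c)) ->
  exists2 c, `|c - z| < r & g s - g t = dg c * (s - t).
Proof.
wlog st : s t / t <= s => [H sz tz h|].
  have [/H|/ltW /H] := leP t s; first exact.
  move=> /(_ tz sz h)[c cz E]; exists c => //.
  by rewrite -opprB E -mulrN opprB.
move=> sz tz h.
have inb c : c \in `[t, s] -> `|c - z| < r.
  rewrite in_itv/= => /andP[tc cs]; move: sz tz; rewrite !ltr_norml.
  by move=> /andP[_ h1] /andP[h2 _]; apply/andP; split; lra.
have [||c cts E] := @MVT_segment R g dg t s st.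
- move=> c; rewrite in_itv/= => /andP[/ltW h1 /ltW h2]; apply: h; apply: inb.
  by rewrite in_itv/= h1.
- apply: derivable_within_continuous => c ct.
  by have [] := h c (inb c ct).
- by exists c => //; exact: inb.
Qed.

Lemma is_derive_line (V : normedModType R) (f : P -> V) (u v : P) (c : R) (d : V) :
  is_derive (c *: v + u) v f d -> is_derive c 1 (fun c => f (c *: v + u)) d.
Proof.
move=> [d1 d2].
have E : (fun h : R => h^-1 *: (((fun c => f (c *: v + u)) \o shift c) (h *: 1) -
     f (c *: v + u))) = (fun h : R => h^-1 *: ((f \o shift (c *: v + u)) (h *: v) - f (c *: v + u))).
  apply/funext => k /=; congr (_ *: (f _ - _)).
  have -> : k *: (1 : R) = k by rewrite /GRing.scale/= mulr1.
  by rewrite scalerDl addrA.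
apply: DeriveDef; first by rewrite /derivable E.
by rewrite /derive E.
Qed.

(** The increment is split along the two axes; the mean value theorem applies
    to each leg, and continuity compares the partial derivatives with those at q. *)
Lemma C1_sdiff_real (W : set P) (f : P -> R) q : open W -> Ck 1 W f -> W q ->
  sdiff f q ('D_((1, 0) : P) f q) ('D_((0, 1) : P) f q).
Proof.
move=> oW [_ h] Wq e e0.
have [der1 [cont1 _]] := h (1, 0); have [der2 [cont2 _]] := h (0, 1).
have : \forall x \near q, [/\ W x, `|'D_((1, 0) : P) f q - 'D_((1, 0) : P) f x| <= e / 2 &
    `|'D_((0, 1) : P) f q - 'D_((0, 1) : P) f x| <= e / 2].
  have h1 : nbhs q W by exact: open_nbhs_nbhs.
  have e20 : 0 < e / 2 by rewrite divr_gt0.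
  have /cvgrPdist_le/(_ _ e20) h2 := cont1 q Wq.
  have /cvgrPdist_le/(_ _ e20) h3 := cont2 q Wq.
  by apply: filterS3 h1 h2 h3 => x.
move=> /nbhs_normE[r r0 hr]; exists r => // x y.
rewrite !prod_norm_lt => /andP[/= x1 x2] /andP[/= y1 y2].
have line (u v : P) (c : R) := @is_derive_line _ f u v c ('D_v f (c *: v + u)).
have [c1 c1r E1] : exists2 c1, `|c1 - q.1| < r &
    f (x.1, x.2) - f (y.1, x.2) = 'D_((1, 0) : P) f (c1, x.2) * (x.1 - y.1).
  apply: (@mvt_ball (fun c => f (c, x.2)) (fun c => 'D_((1, 0) : P) f (c, x.2)) _ _ _ _ x1 y1).
  move=> c cr; have := line (0, x.2) (1, 0) c.
  have E k : k *: ((1, 0) : P) + (0, x.2) = (k, x.2).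
    by congr pair; rewrite /= /GRing.scale/= ?mulr1 ?mulr0 ?addr0 ?add0r.
  rewrite E; under eq_fun do rewrite E.
  apply; apply/derivableP; apply: der1; have [] // := hr (c, x.2).
  by rewrite prod_norm_lt/= cr x2.
have [c2 c2r E2] : exists2 c2, `|c2 - q.2| < r &
    f (y.1, x.2) - f (y.1, y.2) = 'D_((0, 1) : P) f (y.1, c2) * (x.2 - y.2).
  apply: (@mvt_ball (fun c => f (y.1, c)) (fun c => 'D_((0, 1) : P) f (y.1, c)) _ _ _ _ x2 y2).
  move=> c cr; have := line (y.1, 0) (0, 1) c.
  have E k : k *: ((0, 1) : P) + (y.1, 0) = (y.1, k).
    by congr pair; rewrite /= /GRing.scale/= ?mulr1 ?mulr0 ?addr0 ?add0r.
  rewrite E; under eq_fun do rewrite E.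
  apply; apply/derivableP; apply: der2; have [] // := hr (y.1, c).
  by rewrite prod_norm_lt/= cr y1.
have -> : f x - f y - ((x - y).1 *: 'D_((1, 0) : P) f q + (x - y).2 *: 'D_((0, 1) : P) f q)
  = ('D_((1, 0) : P) f (c1, x.2) - 'D_((1, 0) : P) f q) * (x - y).1 +
    ('D_((0, 1) : P) f (y.1, c2) - 'D_((0, 1) : P) f q) * (x - y).2.
  have -> : f x - f y = f (x.1, x.2) - f (y.1, x.2) + (f (y.1, x.2) - f (y.1, y.2)).
    by rewrite addrA subrK; case: (x) (y) => ? ? [].
  by rewrite E1 E2 /GRing.scale/=; ring.
rewrite (le_trans (ler_normD _ _))// !normrM (splitr e) mulrDl.
have [|_ h1 _] := hr (c1, x.2); first by rewrite prod_norm_lt/= c1r x2.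
have [|_ _ h2] := hr (y.1, c2); first by rewrite prod_norm_lt/= c2r y1.
by rewrite lerD// ler_pM// ?norm_fst_le ?norm_snd_le// distrC.
Qed.

Lemma C1_sdiff n (W : set P) (f : P -> 'rV[R]_n) q : open W -> Ck 1 W f -> W q ->
  sdiff f q ('D_((1, 0) : P) f q) ('D_((0, 1) : P) f q).
Proof.
move=> oW [cf h] Wq; apply: sdiff_rV => i.
have coordE v x : W x -> ('D_v f x) 0 i = 'D_v (fun x => f x 0 i) x.
  by move=> Wx; rewrite derive_mx ?mxE//; exact: (h v).1.
rewrite !coordE//; apply: (C1_sdiff_real oW) => //; split.
  by move=> x Wx; apply: cont_coord; exact: cf.
move=> v; split=> [x Wx|]; first by have /derivable_mxP := (h v).1 x Wx.
split=> // x Wx; have [_ [c _]] := h v.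
have : {for x, continuous (fun x => ('D_v f x) 0 i)}.
  by apply: cont_coord; exact: c.
rewrite /prop_for /continuous_at coordE//; apply: cvg_trans; apply: near_eq_cvg.
have nW : nbhs x W by exact: open_nbhs_nbhs.
by apply: filterS nW => y Wy; rewrite coordE.
Qed.

End Sdiff.

Section Sdiff2.
Context {R : realType}.
Local Notation P := (R * R)%type.

(** The difference quotients at a point y near q are uniformly close to the
    derivative at q, hence so is their limit. *)
Lemma sdiff_C1 (V : normedModType R) (W : set P) (f a b : P -> V) :
  open W -> (forall q, W q -> sdiff f q (a q) (b q)) -> Ck 1 W f.
Proof.
move=> oW h; split=> [x /h/sdiff_cont //|v]; split.
  by move=> x /h/(sdiff_is_derive v)[].
split=> // q Wq; apply/cvgrPdist_le => e e0.
have v0 : 0 < `|v| + 1 by rewrite ltr_wpDl.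
have [r r0 hr] := h q Wq (e / (`|v| + 1)) (divr_gt0 e0 v0).
have := oW; rewrite openE => /(_ q Wq) /nbhs_normE[s s0 hs].
suff : nbhs q [set y : P | `|'D_v f q - 'D_v f y| <= e] by [].
apply: (nbhs_normE _ _).2; exists (Num.min r s); first by rewrite lt_min r0.
move=> y; rewrite lt_min => /andP[yr ys] /=.
have [dy _] := sdiff_is_derive v (h y (hs _ ys)).
pose l := v.1 *: a q + v.2 *: b q.
have El : 'D_v f q = l by exact: sdiff_derive v (h q Wq).
move: dy => /cvg_ex[m hm].
have Em : 'D_v f y = m by exact: cvg_lim hm.
suff H : `|l - m| <= e by rewrite -El -Em in H; exact: H.
apply/ler_addgt0Pr => k k0.
move/cvgrPdist_le : hm => /(_ k k0) hm.
near (0 : R)^' => t.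
have t0 : t != 0 by near: t; exact: nbhs_dnbhs_neq.
have hmt : `|m - t^-1 *: (f (t *: v + y) - f y)| <= k by near: t; exact: hm.
have tv : `|t| < (r - `|y - q|) / (`|v| + 1).
  by near: t; apply: dnbhs0_lt; rewrite divr_gt0// subr_gt0.
rewrite -(subrK (t^-1 *: (f (t *: v + y) - f y)) l) -addrA.
rewrite (le_trans (ler_normD _ _))// lerD//; last by rewrite distrC.
have := hr (t *: v + y) y _ yr; rewrite addrK => /(_ _)/wrap[].
  rewrite ltr_pdivlMr// in tv; rewrite -addrA (le_lt_trans (ler_normD _ _))//.
  rewrite -ltrBrDr; apply: le_lt_trans tv; rewrite normrZ ler_wpM2l// lerDl//.
rewrite normrZ => hk.
have E2 : (t *: v).1 *: a q + (t *: v).2 *: b q = t *: l by rewrite /l scalerDr !scalerA.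
rewrite E2 in hk.
have -> : l - t^-1 *: (f (t *: v + y) - f y) = - (t^-1 *: (f (t *: v + y) - f y - t *: l)).
  by rewrite [in RHS]scalerBr scalerA mulVf// scale1r opprB.
rewrite normrN normrZ normfV ler_pdivrMl ?normr_gt0//.
rewrite (le_trans hk)// mulrCA ler_wpM2l// mulrAC ler_pdivrMr//.
by rewrite ler_wpM2l ?ltW// ltrDl.
Unshelve. all: by end_near. Qed.

End Sdiff2.

(** * The inverse function theorem in the plane *)

Section InverseFunction.
Context {R : realType}.
Local Notation P := (R * R)%type.

Definition det2 (a b : P) : R := a.1 * b.2 - a.2 * b.1.

Definition solve2 (a b u : P) : P :=
  ((b.2 * u.1 - b.1 * u.2) / det2 a b, (a.1 * u.2 - a.2 * u.1) / det2 a b).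

Lemma solve2K (a b u : P) : det2 a b != 0 ->
  (solve2 a b u).1 *: a + (solve2 a b u).2 *: b = u.
Proof.
rewrite /det2 => d0; rewrite [RHS]surjective_pairing; congr pair;
  rewrite /= /GRing.scale/= /det2; by field.
Qed.
Lemma solve2L (a b u : P) : det2 a b != 0 ->
  solve2 a b (u.1 *: a + u.2 *: b) = u.
Proof.
move=> d0; rewrite [RHS]surjective_pairing; congr pair; rewrite /= /GRing.scale/=;
  move: d0; rewrite /det2 => d0; by field.
Qed.
Lemma solve2E (a b u : P) :
  solve2 a b u = u.1 *: solve2 a b (1, 0) + u.2 *: solve2 a b (0, 1).
Proof. by rewrite /solve2; congr pair; rewrite /= /GRing.scale/=; ring. Qed.

Lemma solve2_norm (a b u : P) :
  `|solve2 a b u| <= (`|solve2 a b (1, 0)| + `|solve2 a b (0, 1)|) * `|u|.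
Proof. by rewrite solve2E; exact: lin_norm_le. Qed.

Lemma solve2B (a b u v : P) : solve2 a b u - solve2 a b v = solve2 a b (u - v).
Proof. by rewrite /solve2; congr pair; rewrite /=; ring. Qed.

(** A linear map that expands all vectors is injective; the cofactors of a
    vanishing determinant would give kernel vectors. *)
Lemma solve2_unit (a b : P) (C : R) : (forall u : P, `|u| <= C * `|u.1 *: a + u.2 *: b|) ->
  det2 a b != 0.
Proof.
move=> h; apply/eqP => d0.
have K (u : P) : u.1 *: a + u.2 *: b = 0 -> u = 0.
  by move=> E; apply/eqP; rewrite -normr_le0; have := h u; rewrite E normr0 mulr0.
have /pair_equal_spec[b2 a2] : (b.2, - a.2) = 0 :> P.
  by apply: K; congr pair; [rewrite -[RHS]d0|]; rewrite /det2 /= /GRing.scale/=; ring.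
have /pair_equal_spec[b1 a1] : (b.1, - a.1) = 0 :> P.
  apply: K; congr pair; [|rewrite -[RHS]oppr0 -[in RHS]d0]; rewrite /det2 /= /GRing.scale/=; ring.
have /pair_equal_spec[/eqP] : (1, 0) = 0 :> P; last by rewrite oner_eq0.
apply: K; rewrite /= scale1r scale0r addr0 [LHS]surjective_pairing.
by congr pair; apply/eqP; rewrite -oppr_eq0; apply/eqP.
Qed.

(** After composition with the inverse A of the derivative at q0, the map is
    the identity up to an error of Lipschitz constant 1/2, hence it is injective
    and contracts at most by a factor 2. For surjectivity, a minimizer q of the defect
    [`|A y - A (F x)|] on a closed ball lies well inside, and moving q by the
    defect would halve it. Strict differentiability of the inverse follows since
    F is bi-Lipschitz, which also makes its derivative invertible near q0. *)
Theorem inverse_function (F : P -> P) (W : set P) (a b : P -> P) q0 :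
  open W -> W q0 -> (forall q, W q -> sdiff F q (a q) (b q)) ->
  det2 (a q0) (b q0) != 0 ->
  exists O N : set P, exists G : P -> P, [/\ open O, O q0, O `<=` W, open N &
    [/\ forall q, O q -> N (F q) /\ G (F q) = q,
      forall y, N y -> O (G y) /\ F (G y) = y &
      forall y, N y -> exists a' b', sdiff G y a' b']].
Proof.
move=> oW Wq0 sF d0.
set a0 := a q0 in d0; set b0 := b q0 in d0.
pose A := solve2 a0 b0.
pose K := `|A (1, 0)| + `|A (0, 1)| + 1.
have K0 : 0 < K by rewrite /K ltr_wpDl// addr_ge0.
have AK u : `|A u| <= K * `|u|.
  by rewrite (le_trans (solve2_norm _ _ _))// ler_wpM2r// lerDl.
have [r rW hr] : exists2 r, 0 < r & forall x y, `|x - q0| < r -> `|y - q0| < r ->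
    W x /\ `|A (F x) - A (F y) - (x - y)| <= 2^-1 * `|x - y|.
  have K20 : 0 < (2 * K)^-1 by rewrite invr_gt0 mulr_gt0.
  have [r r0 hr] := sF q0 Wq0 _ K20.
  have := oW; rewrite openE => /(_ q0 Wq0) /nbhs_normE[s s0 hs].
  exists (Num.min r s); first by rewrite lt_min r0.
  move=> x y; rewrite !lt_min => /andP[xr xs] /andP[yr ys]; split; first exact: hs.
  have -> : A (F x) - A (F y) - (x - y) =
      A (F x - F y - ((x - y).1 *: a0 + (x - y).2 *: b0)).
    by rewrite -{1}(solve2L (x - y) d0) /A !solve2B.
  rewrite (le_trans (AK _))// (le_trans (ler_wpM2l (ltW K0) (hr _ _ xr yr)))//.
  by rewrite mulrA invfM mulrCA divff ?gt_eqF// mulr1.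
have inj x y : `|x - q0| < r -> `|y - q0| < r -> `|x - y| <= 2 * `|A (F x) - A (F y)|.
  move=> xr yr; have [_ h] := hr x y xr yr.
  have := ler_normB (A (F x) - A (F y)) (A (F x) - A (F y) - (x - y)).
  by rewrite opprB addrC subrK; lra.
pose r1 := r / 2.
have r10 : 0 < r1 by rewrite divr_gt0.
have r1r : r1 < r by rewrite /r1; lra.
(* With r1 / 5 the minimizer stays at distance r1 / 5 from the boundary, which
   leaves room for a displacement by the defect. *)
pose O := [set x : P | `|x - q0| < r1 /\ `|A (F x) - A (F q0)| < r1 / 5].
pose N := [set y : P | `|A y - A (F q0)| < r1 / 5].
have surj y : N y -> exists2 q, O q & F q = y.
  move=> Ny.
  pose B := [set x : P | `|x - q0| <= r1].
  have cB : compact B.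
    have -> : B = `[q0.1 - r1, q0.1 + r1]%classic `*` `[q0.2 - r1, q0.2 + r1]%classic.
      apply/seteqP; split=> x; rewrite /B /= prod_norm_le !in_itv/= !ler_distl.
        by move=> /andP[].
      by move=> [-> ->].
    by apply: compact_setX; exact: segment_compact.
  have cont : {within B, continuous (fun x => `|A y - A (F x)|)}.
    apply: continuous_in_subspaceT => x; rewrite inE => Bx.
    have xr : `|x - q0| < r by exact: le_lt_trans r1r.
    have cF : {for x, continuous F} by apply: sdiff_cont (sF x (hr x x xr xr).1).
    apply/cvgrPdist_le => e e0.
    move/cvgrPdist_le : cF => /(_ (e / K) (divr_gt0 e0 K0)).
    apply: filterS => z hz.
    rewrite (le_trans (ler_dist_dist _ _))// opprB addrC addrA subrK.
    by rewrite solve2B (le_trans (AK _))// mulrC -ler_pdivlMr// distrC.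
  have B0 : B q0 by rewrite /B /= subrr normr0 ltW.
  have [q] := compact_EVT_min (ex_intro _ q0 B0) cB cont.
  rewrite inE => Bq min_q.
  have minq x : B x -> `|A y - A (F q)| <= `|A y - A (F x)|.
    by move=> Bx; apply: min_q; rewrite inE.
  have qr : `|q - q0| < r by exact: le_lt_trans r1r.
  have q0r : `|q0 - q0| < r by rewrite subrr normr0.
  set v := A y - A (F q) in minq.
  have v1 : `|v| < r1 / 5 by apply: le_lt_trans (minq _ B0) _.
  have FqN : `|A (F q) - A (F q0)| < 2 * (r1 / 5).
    have := ler_normB (A y - A (F q0)) v; rewrite /v opprB addrC addrA subrK => h.
    by have := Ny; rewrite /N /=; lra.
  have qd : `|q - q0| < 4 * (r1 / 5) by have := inj _ _ qr q0r; lra.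
  have v0 : v = 0.
    have B' : B (q + v).
      by rewrite /B /= -addrAC (le_trans (ler_normD _ _))//; lra.
    have q'r : `|q + v - q0| < r by exact: le_lt_trans r1r.
    have [_] := hr _ _ q'r qr; have := minq _ B'; rewrite [q + v]addrC addrK => h1.
    have -> : A (F (v + q)) - A (F q) - v = - (A y - A (F (v + q))).
      by rewrite /v !opprB addrA subrK.
    rewrite normrN => h2; apply/eqP; rewrite -normr_le0; lra.
  have EA : A (F q) = A y by apply/esym/subr0_eq.
  have EF : F q = y by rewrite -(solve2K (F q) d0) -/(A _) EA solve2K.
  exists q => //; split; last by rewrite EA.
  by lra.
have N_F q : O q -> N (F q) by case.
have Or q : O q -> `|q - q0| < r by move=> [h _]; exact: lt_trans r1r.
have Oinj x y : O x -> O y -> F x = F y -> x = y.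
  move=> Ox Oy E; apply/subr0_eq/eqP; rewrite -normr_le0.
  by have := inj _ _ (Or _ Ox) (Or _ Oy); rewrite E subrr normr0 mulr0.
pose G y := xget q0 [set q | O q /\ F q = y].
have GP y : N y -> O (G y) /\ F (G y) = y.
  move=> /surj[q Oq Fq]; rewrite /G.
  by case: xgetP => [x -> //|/(_ q)]; case.
have Fcont x : `|x - q0| < r -> {for x, continuous F}.
  by move=> xr; apply: sdiff_cont (sF x (hr x x xr xr).1).
have Alip u v : `|A u - A v| <= K * `|u - v| by rewrite /A solve2B; exact: AK.
have oN : open N.
  rewrite openE => y Ny; apply: (nbhs_normE _ _).2.
  exists ((r1 / 5 - `|A y - A (F q0)|) / K); first by rewrite divr_gt0// subr_gt0.
  move=> z; rewrite ltr_pdivlMr// mulrC => zy.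
  rewrite /N /= -(subrK (A y) (A z)) -addrA (le_lt_trans (ler_normD _ _))//.
  by have := Alip z y; lra.
have oO : open O.
  rewrite openE => x [x1 x2].
  have h1 : nbhs x [set z | `|z - q0| < r1].
    apply: (nbhs_normE _ _).2; exists (r1 - `|x - q0|); first by rewrite subr_gt0.
    move=> z zx /=; rewrite -(subrK x z) -addrA (le_lt_trans (ler_normD _ _))//.
    by rewrite -ltrBrDr.
  have h2 : nbhs x (F @^-1` N) by apply: Fcont; [exact: lt_trans r1r|exact: open_nbhs_nbhs].
  by apply: filterS2 h1 h2 => z.
exists O, N, G; split => //.
- by split; rewrite subrr normr0// divr_gt0.
- by move=> x /Or xr; have [] := hr x x xr xr.
split => //.
  move=> q Oq; split; first exact: N_F.
  have [OG FG] := GP _ (N_F _ Oq); exact: Oinj.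
have lip x y : `|x - q0| < r -> `|y - q0| < r -> `|x - y| <= 2 * K * `|F x - F y|.
  by move=> xr yr; have := inj _ _ xr yr; have := Alip (F x) (F y); lra.
move=> y Ny; have [Oq Fq] := GP _ Ny; set q := G y in Oq Fq.
have Wq : W q by have [] := hr q q (Or _ Oq) (Or _ Oq).
have sq := sF q Wq; set a1 := a q in sq; set b1 := b q in sq.
have dq : det2 a1 b1 != 0.
  apply: (@solve2_unit _ _ (4 * K)) => u.
  have K40 : 0 < (4 * K)^-1 by rewrite invr_gt0 mulr_gt0.
  have [s s0 hs] := sq _ K40.
  have := oO; rewrite openE => /(_ q Oq) /nbhs_normE[s' s'0 hs'].
  pose t := Num.min s s' / (2 * (`|u| + 1)).
  have u0 : 0 < `|u| + 1 by rewrite ltr_wpDl.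
  have t0 : 0 < t by rewrite divr_gt0 ?lt_min ?s0// mulr_gt0.
  have tu : `|t *: u| < Num.min s s'.
    rewrite normrZ gtr0_norm// /t mulrAC ltr_pdivrMr ?mulr_gt0//.
    by rewrite ltr_pM2l ?lt_min ?s0//; have := normr_ge0 u; lra.
  clearbody t; move: (tu); rewrite lt_min => /andP[tus tus'].
  have := hs (t *: u + q) q; rewrite addrK subrr normr0 => /(_ tus s0).
  have := lip (t *: u + q) q _ (Or _ Oq); rewrite addrK => /(_ _)/wrap[].
    by apply: Or; apply: hs'; rewrite addrK.
  have -> : (t *: u).1 *: a1 + (t *: u).2 *: b1 = t *: (u.1 *: a1 + u.2 *: b1).
    by rewrite scalerDr !scalerA.
  set D := F _ - F q; set L := _ *: a1 + _ => h1 h2.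
  have h3 := ler_normD (D - t *: L) (t *: L); rewrite subrK in h3.
  have h4 : 2 * K * `|D| <= 2 * K * ((4 * K)^-1 * `|t *: u| + `|t *: L|).
    by rewrite ler_pM2l ?mulr_gt0//; lra.
  have h5 : 2 * K * ((4 * K)^-1 * `|t *: u| + `|t *: L|) = 2^-1 * `|t *: u| + 2 * K * `|t *: L|.
    by field; rewrite gt_eqF.
  have : `|t *: u| <= 4 * K * `|t *: L| by lra.
  by rewrite !normrZ mulrCA ler_pM2l ?normr_gt0 ?gt_eqF//.
pose B := solve2 a1 b1.
exists (B (1, 0)), (B (0, 1)).
apply: (@sdiff_weak _ _ _ _ _ _ ((`|B (1, 0)| + `|B (0, 1)|) * (2 * K))) => e e0.
have [s s0 hs] := sq _ e0.
have := oN; rewrite openE => /(_ y Ny) /nbhs_normE[s' s'0 hs'].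
exists (Num.min s' (s / (2 * K))); first by rewrite lt_min s'0 divr_gt0// mulr_gt0.
move=> u v; rewrite !lt_min => /andP[us' us] /andP[vs' vs].
have Nu : N u by exact: hs'.
have Nv : N v by exact: hs'.
have [OGu FGu] := GP _ Nu; have [OGv FGv] := GP _ Nv.
have GL w z : N w -> N z -> `|G w - G z| <= 2 * K * `|w - z|.
  move=> /GP[Ow {2}<-] /GP[Oz {2}<-]; apply: lip; exact: Or.
have cl w : N w -> `|w - y| < s / (2 * K) -> `|G w - q| < s.
  move=> Nw; rewrite ltr_pdivlMr ?mulr_gt0// mulrC; apply: le_lt_trans; exact: GL.
have h := hs _ _ (cl _ Nu us) (cl _ Nv vs); rewrite FGu FGv in h.
have -> : G u - G v - ((u - v).1 *: B (1, 0) + (u - v).2 *: B (0, 1)) =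
    B ((G u - G v).1 *: a1 + (G u - G v).2 *: b1 - (u - v)).
  by rewrite -solve2E -{1}(solve2L (G u - G v) dq) /B solve2B.
rewrite (le_trans (solve2_norm _ _ _))// -!mulrA ler_wpM2l ?addr_ge0//.
rewrite distrC (le_trans h)// [leRHS](_ : _ = e * (2 * K * `|u - v|)); last by ring.
by rewrite ler_pM2l//; exact: GL.
Qed.

End InverseFunction.

(** * Plane Lebesgue measure: linear changes of variables and the disc *)

(** Lebesgue measure is characterized by its values on intervals or rectangles,
    so a linear change of variables is handled by a rescaled push-forward that
    takes these values. *)
Lemma scaled_pushforward d d' (T1 : measurableType d) (T2 : measurableType d')
    (R : realType) (m : {measure set T1 -> \bar R}) (f : T1 -> T2) (r : {nonneg R})
    (mf : measurable_fun setT f) :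
  exists m' : {measure set T2 -> \bar R}, forall A, m' A = (r%:num%:E * m (f @^-1` A))%E.
Proof.
pose pf := measure_function_pushforward__canonical__measure_function_Measure m mf.
by exists (mscale r pf).
Qed.

Section Plane.
Context {R : realType}.
Local Notation P := (R * R)%type.
Local Notation Pm := (measurableTypeR R * measurableTypeR R)%type.
Local Notation leb := (@lebesgue_measure R).
Local Notation L2 := (leb \x leb)%E.

Lemma measurable_scale_inv (a : R) :
  measurable_fun [set: measurableTypeR R] (fun x : R => x / a : measurableTypeR R).
Proof. by apply: measurable_funM. Qed.

Lemma lebesgue_scale (a : R) (A : set (measurableTypeR R)) : 0 < a -> measurable A ->
  leb [set x | A (x / a)] = (a%:E * leb A)%E.
Proof.
move=> a0 mA; have ai : 0 <= a^-1 by rewrite invr_ge0 ltW.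
have [m mE] := scaled_pushforward leb (NngNum ai) (measurable_scale_inv a).
have -> : leb A = m A.
  apply: lebesgue_measure_unique => // _ [[b c]] _ <-; rewrite mE /=.
  have -> : (fun x : R => x / a) @^-1` `]b, c] = `]a * b, a * c]%classic.
    apply/seteqP; split=> x /=; rewrite !in_itv/= ltr_pdivlMr// ler_pdivrMr// ![_ * a]mulrC//.
  rewrite !lebesgue_measure_itv/= !lte_fin ltr_pM2l//; case: ifP => _; last by rewrite mule0.
  by rewrite -!EFinD -EFinM -mulrBr mulKf// gt_eqF.
by rewrite mE /= muleA -EFinM divff ?gt_eqF// mul1e.
Qed.

Lemma measurable_scale2 (a b : R) :
  measurable_fun [set: Pm] (fun z : P => (z.1 / a, z.2 / b) : Pm).
Proof.
apply/measurable_fun_pairP; split; rewrite /comp/=.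
- by apply: measurable_funM.
- by apply: measurable_funM.
Qed.

Lemma L2_rect (A B : set (measurableTypeR R)) : measurable A -> measurable B ->
  L2 (A `*` B) = (leb A * leb B)%E.
Proof. exact: product_measure1E. Qed.

Lemma L2_scale (a b : R) (A : set Pm) : 0 < a -> 0 < b -> measurable A ->
  L2 [set z | A (z.1 / a, z.2 / b)] = ((a * b)%:E * L2 A)%E.
Proof.
move=> a0 b0 mA; have abi : 0 <= (a * b)^-1 by rewrite invr_ge0 mulr_ge0// ltW.
pose f := fun z : P => (z.1 / a, z.2 / b) : Pm.
have mf : measurable_fun [set: Pm] f := measurable_scale2 a b.
have [m mE] := scaled_pushforward L2 (NngNum abi) mf.
have -> : L2 A = m A.
  apply: product_measure_unique => // B C mB mC; rewrite mE /=.
  have -> : f @^-1` (B `*` C) = [set x | B (x / a)] `*` [set y | C (y / b)] by [].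
  have mB' : measurable [set x : measurableTypeR R | B (x / a)].
    by rewrite -[X in measurable X]setTI; exact: measurable_scale_inv.
  have mC' : measurable [set x : measurableTypeR R | C (x / b)].
    by rewrite -[X in measurable X]setTI; exact: measurable_scale_inv.
  rewrite L2_rect// !lebesgue_scale// muleACA.
  move: (leb B * leb C)%E => x.
  rewrite -[(a%:E * b%:E)%E]/((a * b)%:E) muleA -EFinM.
  by rewrite mulVf ?mul1e// mulf_neq0// gt_eqF.
by rewrite mE /= muleA -EFinM divff ?mul1e// mulf_neq0// gt_eqF.
Qed.

Lemma L2_swap (A : set Pm) : measurable A -> L2 [set z | A (z.2, z.1)] = L2 A.
Proof.
move=> mA; pose f := fun z : P => (z.2, z.1) : Pm.
have mf : measurable_fun [set: Pm] f by apply/measurable_fun_pairP; split; [exact: measurable_snd|exact: measurable_fst].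
have [m mE] := scaled_pushforward L2 (NngNum ler01) mf.
rewrite (_ : L2 [set z | _] = m A); last by rewrite mE mul1e.
symmetry; apply: product_measure_unique => // B C mB mC; rewrite mE mul1e.
have -> : f @^-1` (B `*` C) = C `*` B.
  by apply/seteqP; split=> z [].
exact: etrans (L2_rect mC mB) (muleC _ _).
Qed.

Lemma sqr_le_itv (y s : R) : 0 <= s -> (y ^+ 2 <= s ^+ 2) = (- s <= y <= s).
Proof.
move=> s0; apply/idP/andP => [h|[h1 h2]]; last by nra.
by split; rewrite leNgt; apply/negP => ?; nra.
Qed.

Lemma sqr_lt_itv (y s : R) : 0 <= s -> (y ^+ 2 < s ^+ 2) = (- s < y < s).
Proof.
move=> s0; apply/idP/andP => [h|[h1 h2]]; last by nra.
by split; rewrite ltNge; apply/negP => ?; nra.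
Qed.

Lemma disc_xsection (x : R) :
  leb [set y : R | x ^+ 2 + y ^+ 2 <= 1] = (2 * Num.sqrt (1 - x ^+ 2))%:E /\
  leb [set y : R | x ^+ 2 + y ^+ 2 < 1] = (2 * Num.sqrt (1 - x ^+ 2))%:E.
Proof.
set s := Num.sqrt _.
have s0 : 0 <= s by exact: sqrtr_ge0.
have [x1|x1] := leP (1 - x ^+ 2) 0.
  have sE : s = 0 by rewrite /s ler0_sqrtr.
  rewrite sE mulr0; split.
    apply/eqP; rewrite eq_le measure_ge0 andbT -[leRHS](lebesgue_measure_set1 (0 : R)).
    rewrite le_measure ?inE//=.
      have -> : [set y : R | x ^+ 2 + y ^+ 2 <= 1] = (fun y => x ^+ 2 + y ^+ 2) @^-1` `]-oo, 1].
        by apply/seteqP; split => y /=; rewrite in_itv.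
      rewrite -[X in measurable X]setTI.
      by apply: measurable_funD => //; exact: measurable_funX.
    move=> y /= h; apply/eqP; rewrite -sqrf_eq0 eq_le sqr_ge0 andbT; lra.
  have -> : [set y : R | x ^+ 2 + y ^+ 2 < 1] = set0; last by rewrite measure0.
  by apply/seteqP; split=> // y /=; have := sqr_ge0 y; lra.
have sE : s ^+ 2 = 1 - x ^+ 2 by rewrite sqr_sqrtr// ltW.
have s0' : 0 < s by rewrite sqrtr_gt0.
split.
  rewrite (_ : [set y | _ <= _] = `[- s, s]%classic).
  rewrite lebesgue_measure_itv/= lte_fin gtrN// -EFinB; congr EFin; rewrite mulr_natl opprK mulr2n //.
  by apply/seteqP; split=> y /=; rewrite in_itv/= -sqr_le_itv// sE; lra.
rewrite (_ : [set y | _ < _] = `]- s, s[%classic).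
rewrite lebesgue_measure_itv/= lte_fin gtrN// -EFinB; congr EFin; rewrite mulr_natl opprK mulr2n //.
by apply/seteqP; split=> y /=; rewrite in_itv/= -sqr_lt_itv// sE; lra.
Qed.

End Plane.

Section Disc.
Context {R : realType}.
Local Notation Pm := (measurableTypeR R * measurableTypeR R)%type.
Local Notation leb := (@lebesgue_measure R).
Local Notation L2 := (leb \x leb)%E.

(** Substitute x = sin t: the integrand becomes 2 (cos t)^2, which has the
    primitive t + sin t cos t. *)
Lemma integral_half_disc :
  (\int[leb]_(x in `[(-1)%R, 1%R]) (2 * Num.sqrt (1 - x ^+ 2))%:E)%E = (pi : R)%:E.
Proof.
pose a : R := pi / 2.
have a0 : 0 < a by rewrite divr_gt0// pi_gt0.
have aa : - a < a by rewrite gtrN.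
have sa : sin a = 1 :> R := sin_pihalf R.
have sNa : sin (- a) = -1 :> R by rewrite sinN sa.
have dsin : (@sin R)^`()%classic = @cos R.
  by apply/funext => x; rewrite derive1E derive_val.
have contG : {within `[sin (- a), sin a], continuous (fun x : R => 2 * Num.sqrt (1 - x ^+ 2))}.
  apply: continuous_subspaceT => x; apply: cvgM; first exact: cvg_cst.
  apply: (@continuous_comp _ _ _ (fun y : R => 1 - y ^+ 2) Num.sqrt); last exact: sqrt_continuous.
  by apply: cvgB; [exact: cvg_cst|exact: exprn_continuous].
rewrite -[X in `[X, _]]sNa -[X in `[_, X]]sa.
rewrite (@integration_by_substitution_increasing _ sin (fun x => 2 * Num.sqrt (1 - x ^+ 2)) (- a) a) ?(ltW aa)//; last 5 first.
- by move=> x y hx hy; rewrite ltr_sin.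
- rewrite dsin => x _; exact: continuous_cos.
- rewrite dsin; apply/cvg_ex; exists (cos (- a)).
  by apply: cvg_at_right_filter; exact: continuous_cos.
- rewrite dsin; apply/cvg_ex; exists (cos a).
  by apply: cvg_at_left_filter; exact: continuous_cos.
- split=> //.
  + by apply: cvg_at_right_filter; exact: continuous_sin.
  + by apply: cvg_at_left_filter; exact: continuous_sin.
transitivity (\int[leb]_(x in `[(- a)%R, a]) (2 * cos x ^+ 2)%:E)%E.
  apply: eq_integral => x; rewrite inE/= in_itv/= => /andP[h1 h2]; congr EFin.
  rewrite dsin !fctE /= -cos2sin2 sqrtr_sqr ger0_norm; last by apply: cos_ge0_pihalf; rewrite h1.
  by rewrite expr2 mulrA.
pose F (x : R) := x + sin x * cos x.
have dF (x : R) : is_derive x 1 F (2 * cos x ^+ 2).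
  rewrite /F; apply: is_derive_eq.
  rewrite /GRing.scale/= mulrN -!expr2.
  by have := cos2Dsin2 x; lra.
have cF : continuous F by move=> x; apply/differentiable_continuous/derivable1_diffP; have [] := dF x.
rewrite (@continuous_FTC2 _ _ F)//.
- rewrite /F sa sNa cosN cos_pihalf !mulr0 !addr0 -EFinB; congr EFin.
  by rewrite /a; lra.
- move=> x; apply: continuous_subspaceT => {}x; apply: cvgM; first exact: cvg_cst.
  by apply: (@continuous_comp _ _ _ cos (fun y : R => y ^+ 2)); [exact: continuous_cos|exact: exprn_continuous].
- split=> //.
  + by apply: cvg_at_right_filter; exact: cF.
  + by apply: cvg_at_left_filter; exact: cF.
- by move=> x _; rewrite derive1E; have [_ ->] := dF x.
Qed.

Lemma integral_disc : (\int[leb]_x (2 * Num.sqrt (1 - x ^+ 2))%:E)%E = (pi : R)%:E.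
Proof.
rewrite -integral_half_disc [RHS]integral_mkcond; apply: eq_integral => x _.
rewrite patchE; case: ifPn => //; rewrite notin_setE /= in_itv/= => /negP h.
rewrite ler0_sqrtr ?mulr0//.
move: h; rewrite negb_and -!ltNge => /orP[] h; nra.
Qed.

(** The boolean selects the closed or the open disc. *)
Lemma measurable_norm2 (r : R) (b : bool) :
  measurable [set z : Pm | (if b then z.1 ^+ 2 + z.2 ^+ 2 <= r else z.1 ^+ 2 + z.2 ^+ 2 < r)%R].
Proof.
have mf : measurable_fun [set: Pm] (fun z : Pm => z.1 ^+ 2 + z.2 ^+ 2 : R).
  apply: measurable_funD; apply: measurable_funX.
    exact: measurable_fst.
  exact: measurable_snd.
case: b.
  rewrite (_ : [set z | _] = (fun z : Pm => z.1 ^+ 2 + z.2 ^+ 2 : R) @^-1` `]-oo, r]).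
    by rewrite -[X in measurable X]setTI; exact: mf.
  by apply/seteqP; split => z /=; rewrite in_itv.
rewrite (_ : [set z | _] = (fun z : Pm => z.1 ^+ 2 + z.2 ^+ 2 : R) @^-1` `]-oo, r[).
  by rewrite -[X in measurable X]setTI; exact: mf.
by apply/seteqP; split => z /=; rewrite in_itv.
Qed.

Lemma L2_disc1 : L2 [set z : Pm | (z.1 ^+ 2 + z.2 ^+ 2 <= 1)%R] = (pi : R)%:E /\
  L2 [set z : Pm | (z.1 ^+ 2 + z.2 ^+ 2 < 1)%R] = (pi : R)%:E.
Proof.
split; rewrite -integral_disc; apply: eq_integral => x _ /=; have [h1 h2] := disc_xsection x.
  rewrite -h1 /xsection; congr (leb _).
  by apply/seteqP; split=> y /=; rewrite inE.
rewrite -h2 /xsection; congr (leb _).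
by apply/seteqP; split=> y /=; rewrite inE.
Qed.

Lemma L2_disc (r : R) : 0 < r ->
  L2 [set z : Pm | (z.1 ^+ 2 + z.2 ^+ 2 <= r ^+ 2)%R] = (pi * r ^+ 2)%:E /\
  L2 [set z : Pm | (z.1 ^+ 2 + z.2 ^+ 2 < r ^+ 2)%R] = (pi * r ^+ 2)%:E.
Proof.
move=> r0; have [h1 h2] := L2_disc1.
have r2 : 0 < r ^+ 2 by rewrite exprn_gt0.
have E z : (z.1 / r) ^+ 2 + (z.2 / r) ^+ 2 = (z.1 ^+ 2 + z.2 ^+ 2) / r ^+ 2.
  by rewrite !expr_div_n mulrDl.
split.
  have := L2_scale r0 r0 (measurable_norm2 1 true); rewrite h1 -EFinM mulrC -expr2 => <-.
  congr (product_measure1 _ _ _); apply/seteqP; split=> z /=;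
  by rewrite E ler_pdivrMr// mul1r.
have := L2_scale r0 r0 (measurable_norm2 1 false); rewrite h2 -EFinM mulrC -expr2 => <-.
congr (product_measure1 _ _ _); apply/seteqP; split=> z /=;
by rewrite E ltr_pdivrMr// mul1r.
Qed.

End Disc.

(** * Grids, regularity and comparison of outer measures *)

Section Grid.
Context {R : realType}.
Local Notation P := (R * R)%type.
Local Notation Pm := (measurableTypeR R * measurableTypeR R)%type.
Local Notation leb := (@lebesgue_measure R).
Local Notation L2 := (leb \x leb)%E.

(** Continuity from above, in the form used for outer approximation. *)
Lemma decreasing_measure_le d (T : measurableType d) (mu : {measure set T -> \bar R})
    (F : (set T)^nat) (e : R) : 0 < e ->
  (mu (F 0%N) < +oo)%E -> (forall n, measurable (F n)) ->
  {homo F : n m / (n <= m)%N >-> m `<=` n} ->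
  exists n, (mu (F n) <= mu (\bigcap_n F n) + e%:E)%E.
Proof.
move=> e0 F0 mF dF.
have mI : measurable (\bigcap_n F n) by exact: bigcapT_measurable.
have fin : mu (\bigcap_n F n) \is a fin_num.
  rewrite ge0_fin_numE//; apply: le_lt_trans F0; apply: le_measure; rewrite ?inE//.
  exact: bigcap_inf.
have dF' : {homo F : n m / (n <= m)%N >-> (m <= n)%O}.
  by move=> n m nm; apply/subsetPset; exact: dF.
have := nonincreasing_cvg_mu F0 mF mI dF'; rewrite -[X in _ --> X](fineK fin).
move=> /fine_cvgP[[k _ kfin] /cvgrPdist_le /(_ e e0)[n _ hn]].
pose N := maxn k n; exists N.
have hN := hn N (leq_maxr _ _); have kN := kfin N (leq_maxl _ _).
move: hN kN; rewrite /= => hN kN.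
rewrite -(fineK kN) -(fineK fin) -EFinD lee_fin.
by move: hN; rewrite ler_norml => /andP[]; lra.
Qed.

Definition sq (x y l : R) : set P := [set z | (x <= z.1 < x + l) && (y <= z.2 < y + l)].

Lemma sqE x y l : sq x y l = `[x, x + l[%classic `*` `[y, y + l[%classic.
Proof. by apply/seteqP; split=> z /=; rewrite /sq /= !in_itv/= => /andP. Qed.

Lemma measurable_sq x y l : measurable (sq x y l : set Pm).
Proof. by rewrite sqE; apply: measurableX; exact: measurable_itv. Qed.

Lemma L2_sq x y l : 0 <= l -> L2 (sq x y l) = (l ^+ 2)%:E.
Proof.
move=> l0; rewrite sqE L2_rect//.
have E (t : R) : leb `[t, t + l[%classic = l%:E.
  rewrite lebesgue_measure_itv/= lte_fin ltrDl; case: ltP => l0'.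
    by rewrite -EFinD addrC addKr.
  by congr EFin; apply/esym/le_anti; rewrite l0 l0'.
by rewrite !E -EFinM expr2.
Qed.

Definition mesh (n : nat) : R := n.+1%:R^-1.

Lemma mesh_gt0 n : 0 < mesh n. Proof. by rewrite invr_gt0. Qed.

Lemma mesh_lt (e : R) : 0 < e -> exists n, mesh n < e.
Proof.
move=> e0; have [n _ hn] := near_infty_natSinv_lt (PosNum e0).
by exists n; apply: hn => /=.
Qed.

(** The half-open squares of side [mesh n] with corners on the grid, numbered by
    natural numbers as countable subadditivity requires. *)
Definition cell (n k : nat) : set P :=
  if @pickle_inv (int * int)%type k is Some ij then
    sq (ij.1%:~R * mesh n) (ij.2%:~R * mesh n) (mesh n) else set0.

Lemma measurable_cell n k : measurable (cell n k : set Pm).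
Proof. by rewrite /cell; case: pickle_inv => // ij; exact: measurable_sq. Qed.

Lemma floor_mesh n (x : R) (i : int) :
  (i%:~R * mesh n <= x < i%:~R * mesh n + mesh n) = (i == Num.floor (x * n.+1%:R)).
Proof.
have n0 : 0 < n.+1%:R :> R by rewrite ltr0n.
have -> : (i%:~R * mesh n <= x < i%:~R * mesh n + mesh n) =
    (i%:~R <= x * n.+1%:R < i%:~R + 1).
  congr andb; first by rewrite /mesh ler_pdivrMr.
  by rewrite -[X in _ + X]mul1r -mulrDl /mesh ltr_pdivlMr.
apply/idP/idP => [h|/eqP ->]; first by apply/eqP/esym/floor_def; rewrite intrD.
by have := floor_itv (x * n.+1%:R); rewrite intrD.
Qed.

Lemma cellP n k z : cell n k z <->
  @pickle_inv (int * int)%type k = Some (Num.floor (z.1 * n.+1%:R), Num.floor (z.2 * n.+1%:R)).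
Proof.
rewrite /cell; case: pickle_inv => [[i j]|]; last by split.
rewrite /sq /= !floor_mesh; split; first by move=> /andP[/eqP-> /eqP->].
by case=> -> ->; rewrite !eqxx.
Qed.

Lemma cell_cover n z : exists k, cell n k z.
Proof.
pose ij : (int * int)%type := (Num.floor (z.1 * n.+1%:R), Num.floor (z.2 * n.+1%:R)).
have E : pickle_inv (@pickle (int * int)%type ij) = Some ij by exact: pickleK_inv.
by exists (pickle ij); exact: (cellP _ _ _).2 E.
Qed.

Lemma cell_disjoint n k l z : cell n k z -> cell n l z -> k = l.
Proof.
move=> /cellP h /cellP h'.
have := @pickle_invK (int * int)%type k; have := @pickle_invK (int * int)%type l.
by rewrite h h' /= => -> ->.
Qed.

Lemma cell_near n k z w : cell n k z -> cell n k w -> `|z - w| < mesh n.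
Proof.
rewrite /cell; case: pickle_inv => // -[i j]; rewrite /sq /= prod_norm_lt.
move=> /andP[/andP[a b] /andP[c d]] /andP[/andP[a' b'] /andP[c' d']].
by rewrite !ltr_norml /=; apply/andP; split; apply/andP; split; lra.
Qed.

(** An open set is the union of the grid cells that it contains. *)
Lemma open_measurable2 (U : set P) : open U -> measurable (U : set Pm).
Proof.
move=> oU.
have -> : U = \bigcup_n \bigcup_k (if `[< cell n k `<=` U >] then cell n k else set0).
  apply/seteqP; split=> [z Uz|z [n _ [k _]]]; last by case: asboolP => // h /h.
  have := oU; rewrite openE => /(_ z Uz)/nbhs_normE[r r0 hr].
  have [n nr] := mesh_lt r0; have [k zk] := cell_cover n z.
  exists n => //; exists k => //; rewrite asboolT// => w wk; apply: hr.
  by apply: lt_trans nr; exact: cell_near wk zk.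
apply: bigcup_measurable => n _; apply: bigcup_measurable => k _.
by case: ifP => _; [exact: measurable_cell|exact: measurable0].
Qed.

Lemma closed_measurable2 (A : set P) : closed A -> measurable (A : set Pm).
Proof.
by move=> cA; rewrite -[A]setCK; apply: measurableC; apply: open_measurable2; rewrite openC.
Qed.

Lemma closed_nearE (A : set P) z : closed A ->
  (forall n, exists2 a, A a & `|z - a| < mesh n) -> A z.
Proof.
move=> cA h; apply: cA => B /nbhs_normE[r r0 hr].
have [n nr] := mesh_lt r0; have [a Aa za] := h n.
by exists a; split => //; apply: hr; rewrite distrC; exact: lt_trans nr.
Qed.

Lemma L2_bounded (A : set Pm) (M : R) : measurable A -> (forall z : P, A z -> `|z| <= M) ->
  (L2 A < +oo)%E.
Proof.
move=> mA h; have [M0|M0] := ltP M 0.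
  have -> : A = set0; last by rewrite measure0 ltry.
  by apply/seteqP; split=> // z /h; have := normr_ge0 z; lra.
apply: (@le_lt_trans _ _ (L2 (sq (- M) (- M) (2 * M + 1)))).
  apply: le_measure; rewrite ?inE//; first exact: measurable_sq.
  move=> z /h; rewrite prod_norm_le !ler_norml /sq /=.
  by move=> /andP[/andP[a b] /andP[c d]]; apply/andP; split; apply/andP; split; lra.
by rewrite L2_sq ?ltry//; lra.
Qed.

Lemma compact_bound (A : set P) : compact A -> exists M, forall z, A z -> `|z| <= M.
Proof.
move=> /compact_bounded[M [_ h]]; exists (M + 1) => z Az.
by apply: (h (M + 1)) => //; rewrite ltrDl.
Qed.

(** The neighbourhoods of radius [mesh n] of a compact set decrease to it and
    have finite area, so their areas converge to that of the set. *)
Lemma compact_outer (A : set P) (e : R) : compact A -> 0 < e ->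
  exists n, exists2 U : set P, measurable (U : set Pm) &
    (L2 U <= L2 A + e%:E)%E /\ forall z a, A a -> `|z - a| < mesh n -> U z.
Proof.
move=> cA e0.
have clA : closed A by apply: compact_closed => //; exact: norm_hausdorff.
pose U n := \bigcup_(a in A) [set z : P | `|z - a| < mesh n].
have oU n : open (U n).
  apply: bigcup_open => a _; rewrite openE => z /= za.
  apply: (nbhs_normE _ _).2; exists (mesh n - `|z - a|); first by rewrite subr_gt0.
  move=> w wz; rewrite /= -(subrK z w) -addrA (le_lt_trans (ler_normD _ _))//.
  by rewrite -ltrBrDr.
have mU n : measurable (U n : set Pm) by exact: open_measurable2.
have AU : A = \bigcap_n U n.
  apply/seteqP; split=> [a Aa n _|z h].
    by exists a => //=; rewrite subrr normr0 mesh_gt0.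
  by apply: closed_nearE => // n; have [a Aa za] := h n I; exists a.
have [M hM] := compact_bound cA.
have U0 : (L2 (U 0%N) < +oo)%E.
  apply: (@L2_bounded _ (M + 1)) => // z [a Aa /= za].
  rewrite -(subrK a z) (le_trans (ler_normD _ _))// addrC lerD ?hM//.
  by rewrite (le_trans (ltW za))// /mesh invr1.
have dU : {homo U : n m / (n <= m)%N >-> m `<=` n}.
  move=> n m nm z [a Aa /= za]; exists a => //=; apply: lt_le_trans za _.
  by rewrite lef_pV2 ?posrE// ler_nat.
have [n hn] := decreasing_measure_le e0 U0 mU dU.
exists n; exists (U n) => //; split; first by rewrite [in leRHS]AU.
by move=> z a Aa za; exists a.
Qed.

(** A fine grid has disjoint cells, and those that meet A stay in a
    neighbourhood of A whose area is almost that of A. *)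
Lemma outer_measure_le_squares (H : {outer_measure set P -> \bar R}) (c l0 : R) :
  0 <= c -> 0 < l0 ->
  (forall x y l, 0 < l < l0 -> (H (sq x y l) <= (c * l ^+ 2)%:E)%E) ->
  forall A, compact A -> (H A <= c%:E * L2 A)%E.
Proof.
move=> c0 l00 h A cA.
apply/lee_addgt0Pr => e e0.
have c1 : 0 < c + 1 by rewrite ltr_wpDl.
have ec : 0 < e / (c + 1) by rewrite divr_gt0.
have [n [U mU [UA hU]]] := compact_outer cA ec.
have [m ml0] := mesh_lt l00.
pose N := maxn n m.
have Nn : mesh N <= mesh n by rewrite lef_pV2 ?posrE// ler_nat ltnS leq_maxl.
have Nm : mesh N < l0.
  by apply: le_lt_trans ml0; rewrite lef_pV2 ?posrE// ler_nat ltnS leq_maxr.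
pose B k := if `[< cell N k `&` A !=set0 >] then cell N k else set0.
have mB k : measurable (B k : set Pm).
  by rewrite /B; case: ifP => _; [exact: measurable_cell|exact: measurable0].
have AB : A `<=` \bigcup_k B k.
  move=> z Az; have [k zk] := cell_cover N z; exists k => //.
  by rewrite /B asboolT//; exists z.
have BU : \bigcup_k B k `<=` U.
  move=> z [k _]; rewrite /B; case: asboolP => // -[a [ka Aa]] kz.
  by apply: hU Aa _; apply: lt_le_trans Nn; exact: cell_near kz ka.
have HB k : (H (B k) <= c%:E * L2 (B k))%E.
  rewrite /B; case: ifP => _; last by rewrite outer_measure0 measure0 mule0.
  rewrite /cell; case: pickle_inv => [ij|]; last by rewrite outer_measure0 measure0 mule0.
  rewrite L2_sq ?(ltW (mesh_gt0 N))//; apply: h; by rewrite mesh_gt0.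
have tB : trivIset setT B.
  move=> i j _ _ [z []]; rewrite /B; case: ifP => // _ zi; case: ifP => // _ zj.
  exact: cell_disjoint zi zj.
apply: (@le_trans _ _ (H (\bigcup_k B k))); first exact: le_outer_measure.
apply: (@le_trans _ _ (\sum_(0 <= k <oo) H (B k))%E).
  exact: outer_measure_sigma_subadditive.
apply: (@le_trans _ _ (\sum_(0 <= k <oo) (c%:E * L2 (B k)))%E).
  by apply: lee_nneseries => // k _ _; exact: outer_measure_ge0.
rewrite nneseriesZl//.
have -> : (\sum_(0 <= k <oo) L2 (B k) = L2 (\bigcup_k B k))%E.
  by rewrite measure_semi_bigcup//; exact: bigcupT_measurable.
apply: (@le_trans _ _ (c%:E * (L2 A + (e / (c + 1))%:E))%E).
  apply: lee_wpmul2l; first by rewrite lee_fin.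
  by apply: le_trans UA; apply: le_measure; rewrite ?inE//; exact: bigcupT_measurable.
rewrite ge0_muleDr//; last by rewrite lee_fin ltW.
rewrite leeD2l// -EFinM lee_fin mulrCA ger_pMr// ler_pdivrMr// mul1r.
by rewrite lerDl.
Qed.
End Grid.

(** * The isodiametric inequality in the plane *)

Section Isodiametric.
Context {R : realType}.
Local Notation P := (R * R)%type.
Local Notation Pm := (measurableTypeR R * measurableTypeR R)%type.
Local Notation leb := (@lebesgue_measure R).
Local Notation L2 := (leb \x leb)%E.

Definition diam2_le (K : set P) (D : R) := forall z w, K z -> K w ->
  (z.1 - w.1) ^+ 2 + (z.2 - w.2) ^+ 2 <= D ^+ 2.

(** Steiner symmetrization: each vertical section is replaced by the centred
    open interval of the same length. *)
Definition steiner (K : set P) : set P :=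
  [set z | ((2 * `|z.2|)%:E < leb (xsection K z.1))%E].

Lemma measurable_steiner (K : set P) : measurable (K : set Pm) ->
  measurable (steiner K : set Pm).
Proof.
move=> mK; rewrite /steiner -[X in measurable X]setTI.
apply: measurable_lte => //.
  apply/measurable_EFinP; apply: measurable_funM => //.
  by apply: measurableT_comp => //; exact: measurable_snd.
apply: (@measurableT_comp _ _ _ _ _ _ (leb \o xsection K) _ fst).
  exact: measurable_fun_xsection.
exact: measurable_fst.
Qed.

Lemma L2_steiner (K : set P) : measurable (K : set Pm) ->
  L2 (steiner K) = L2 K.
Proof.
move=> mK; rewrite /product_measure1; apply: eq_integral => x _ /=.
have [[m mE]|Ey] : (exists m, leb (xsection K x) = m%:E) \/ leb (xsection K x) = +oo%E.
  have [->|hy] := eqVneq (leb (xsection K x)) +oo%E; first by right.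
  left; exists (fine (leb (xsection K x))).
  by rewrite fineK// ge0_fin_numE// ltey.
- have m0 : 0 <= m by rewrite -lee_fin -mE.
  rewrite mE (_ : xsection _ x = `]- (m / 2), m / 2[%classic).
    rewrite lebesgue_measure_itv/= lte_fin; case: ltP => h; last by congr EFin; lra.
    by rewrite -EFinD; congr EFin; lra.
  have E (y : R) : (2 * `|y| < m) = (- (m / 2) < y < m / 2).
    by rewrite -ltr_norml ltr_pdivlMr// mulrC.
  by apply/seteqP; split=> y; rewrite /xsection /= inE /steiner /= mE lte_fin in_itv/= E.
- rewrite Ey (_ : xsection _ x = setT); last first.
    by apply/seteqP; split=> // y _; rewrite /xsection /= inE /steiner /= Ey ltry.
  by rewrite -set_itvNyy lebesgue_measure_itv.
Qed.

(** A lies in [sup B - c, inf B + c] and B in [inf B, sup B]; these intervals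
    have total length 2 c. *)
Lemma leb_dist_le (A B : set R) (c : R) : A !=set0 -> B !=set0 ->
  measurable (A : set (measurableTypeR R)) -> measurable (B : set (measurableTypeR R)) ->
  (forall a b, A a -> B b -> `|a - b| <= c) -> (leb A + leb B <= (2 * c)%:E)%E.
Proof.
move=> [a0 Aa0] [b0 Bb0] mA mB h.
have supB : has_sup B.
  split; first by exists b0.
  by exists (a0 + c) => b Bb; have := h _ _ Aa0 Bb; rewrite ler_norml => /andP[]; lra.
have infB : has_inf B.
  split; first by exists b0.
  by exists (a0 - c) => b Bb; have := h _ _ Aa0 Bb; rewrite ler_norml => /andP[]; lra.
set M := sup B; set m := inf B.
have leM b : B b -> b <= M by move=> Bb; apply: ub_le_sup => //; case: supB.
have lem b : B b -> m <= b by move=> Bb; apply: ge_inf => //; case: infB.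
have Ale a : A a -> M - c <= a <= m + c.
  move=> Aa; apply/andP; split.
    have : M <= a + c.
      apply: ge_sup; first by exists b0.
      by move=> b Bb; have := h _ _ Aa Bb; rewrite ler_norml => /andP[]; lra.
    lra.
  have : a - c <= m.
    apply: lb_le_inf; first by exists b0.
    by move=> b Bb; have := h _ _ Aa Bb; rewrite ler_norml => /andP[]; lra.
  lra.
have E (s t : R) (C : set (measurableTypeR R)) : measurable C -> C !=set0 ->
    (forall x : R, C x -> s <= x <= t) -> (leb C <= (t - s)%:E)%E.
  move=> mC [x Cx] hC; apply: (@le_trans _ _ (leb `[s, t]%classic)).
    by apply: le_measure; rewrite ?inE// => y /hC; rewrite /= in_itv.
  rewrite lebesgue_measure_itv/= lte_fin; case: ltP => // _.
  by rewrite lee_fin subr_ge0; have /andP[] := hC _ Cx; lra.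
have hA := E _ _ _ mA (ex_intro _ a0 Aa0) Ale.
have hB : (leb B <= (M - m)%:E)%E.
  apply: E => //; first by exists b0.
  by move=> x Bx; rewrite leM// lem.
apply: le_trans (leeD hA hB) _.
by rewrite -EFinD lee_fin; lra.
Qed.

(** Two points of the symmetrized set differ in height by at most half the
    total length of their sections, which [leb_dist_le] compares with the largest
    difference of heights in K over the same two abscissas. *)
Lemma diam2_steiner (K : set P) D : measurable (K : set Pm) -> diam2_le K D ->
  diam2_le (steiner K) D.
Proof.
move=> mK h z w; rewrite /steiner /= => hz hw.
have ne x t : (t%:E < leb (xsection K x))%E -> 0 <= t -> xsection K x !=set0.
  move=> ht t0; apply/set0P/negP => /eqP E; move: ht; rewrite E measure0 lte_fin; lra.
have nez : xsection K z.1 !=set0 by apply: ne hz _; rewrite mulr_ge0.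
have new : xsection K w.1 !=set0 by apply: ne hw _; rewrite mulr_ge0.
pose c := Num.sqrt (D ^+ 2 - (z.1 - w.1) ^+ 2).
have hab a b : xsection K z.1 a -> xsection K w.1 b -> `|a - b| <= c.
  rewrite /xsection /= !inE => Ka Kb; have := h _ _ Ka Kb => /= hh.
  by rewrite -sqrtr_sqr ler_sqrt; have := sqr_ge0 (a - b); lra.
have D0 : 0 <= D ^+ 2 - (z.1 - w.1) ^+ 2.
  have [[a Ka] [b Kb]] := (nez, new); move: Ka Kb; rewrite /xsection /= !inE => Ka Kb.
  by have := h _ _ Ka Kb => /=; have := sqr_ge0 (a - b); lra.
have := leb_dist_le nez new (measurable_xsection _ mK) (measurable_xsection _ mK) hab.
move=> hc; have := lt_le_trans (lteD hz hw) hc; rewrite -EFinD lte_fin => hlt.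
have c2 : c ^+ 2 = D ^+ 2 - (z.1 - w.1) ^+ 2 by rewrite sqr_sqrtr.
have : (z.2 - w.2) ^+ 2 <= c ^+ 2.
  have := ler_normB z.2 w.2 => hn.
  rewrite -[X in X <= _]real_normK ?num_real// ler_sqr ?nnegrE ?sqrtr_ge0//; lra.
lra.
Qed.

(** Symmetrizing in both directions preserves the area, does not increase the
    diameter, and makes the set centrally symmetric; two opposite points are then
    at distance at most D, so the set lies in the disc of diameter D. *)
Lemma isodiametric_real (K : set P) (D : R) : 0 < D -> measurable (K : set Pm) -> diam2_le K D ->
  (L2 K <= (pi * (D / 2) ^+ 2)%:E)%E.
Proof.
move=> D0 mK hK.
pose K1 := steiner K.
pose K2 : set P := [set z | K1 (z.2, z.1)].
pose K3 := steiner K2.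
have mK1 : measurable (K1 : set Pm) by exact: measurable_steiner.
have mK2 : measurable (K2 : set Pm).
  have mf : measurable_fun [set: Pm] (fun z : Pm => (z.2, z.1) : Pm).
    by apply/measurable_fun_pairP; split; [exact: measurable_snd|exact: measurable_fst].
  by rewrite -[K2]setTI; exact: mf.
have hK1 : diam2_le K1 D by exact: diam2_steiner.
have hK2 : diam2_le K2 D by move=> z w Kz Kw; have := hK1 _ _ Kz Kw; rewrite addrC.
have hK3 : diam2_le K3 D by exact: diam2_steiner.
have mK3 : measurable (K3 : set Pm) by exact: measurable_steiner.
rewrite -L2_steiner// -/K1 -(L2_swap mK1) -/K2 -(L2_steiner mK2) -/K3.
(* The second symmetrization keeps the symmetry created by the first one. *)
have secN x : xsection K2 (- x) = xsection K2 x.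
  by apply/seteqP; split=> y; rewrite /xsection /= !inE /K2 /K1 /steiner /= normrN.
have symK3 z : K3 z -> K3 (- z).
  by rewrite /K3 /steiner /= normrN secN.
have D20 : 0 < D / 2 by rewrite divr_gt0.
have [<- _] := L2_disc D20.
apply: le_measure; rewrite ?inE//; first exact: (measurable_norm2 ((D / 2) ^+ 2) true).
move=> z K3z; have := hK3 _ _ K3z (symK3 _ K3z); rewrite /= !opprK => h.
by move: h; rewrite -!mulr2n -[z.1 *+ 2]mulr_natr -[z.2 *+ 2]mulr_natr; nra.
Qed.

Lemma isodiametric (K : set P) (D : R) : 0 <= D -> measurable (K : set Pm) -> diam2_le K D ->
  (L2 K <= (pi * (D / 2) ^+ 2)%:E)%E.
Proof.
rewrite le_eqVlt => /predU1P[<- mK hK|]; last exact: isodiametric_real.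
rewrite mul0r expr0n/= mulr0.
have [->|/set0P[z Kz]] := eqVneq K set0; first by rewrite measure0.
apply: (@le_trans _ _ (L2 ([set z.1] `*` [set z.2]))).
  apply: le_measure; rewrite ?inE//; first by apply: measurableX.
  move=> w Kw; have := hK _ _ Kw Kz; rewrite expr0n/= => h.
  have := sqr_ge0 (w.1 - z.1); have := sqr_ge0 (w.2 - z.2) => h2 h1.
  by split=> /=; apply/eqP; rewrite -subr_eq0 -sqrf_eq0 eq_le sqr_ge0 andbT; lra.
by rewrite L2_rect// lebesgue_measure_set1 mul0e.
Qed.

End Isodiametric.

(** * Hausdorff measure of an isometrically embedded plane *)

Section Hausdorff.
Context {R : realType}.
Local Notation P := (R * R)%type.
Local Notation E := 'rV[R]_4.
Local Notation Pm := (measurableTypeR R * measurableTypeR R)%type.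
Local Notation leb := (@lebesgue_measure R).
Local Notation L2 := (leb \x leb)%E.

Lemma lebesgue_shift (a : R) (A : set (measurableTypeR R)) : measurable A ->
  leb [set x | A (x - a)] = leb A.
Proof.
move=> mA.
have mf : measurable_fun [set: measurableTypeR R] (fun x : R => x - a : measurableTypeR R).
  exact: measurable_funB.
have [m mE] := scaled_pushforward leb (NngNum ler01) mf.
have -> : leb A = m A.
  apply: lebesgue_measure_unique => // _ [[b c]] _ <-; rewrite mE mul1e /=.
  have -> : (fun x : R => x - a) @^-1` `]b, c] = `]b + a, c + a]%classic.
    by apply/seteqP; split=> x /=; rewrite !in_itv/= ltrBrDr lerBlDr.
  by rewrite !lebesgue_measure_itv/= !lte_fin ltrD2r -!EFinD opprD addrACA subrr addr0.
by rewrite mE mul1e.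
Qed.

Lemma measurable_shift2 (a : P) :
  measurable_fun [set: Pm] (fun z : P => (z.1 - a.1, z.2 - a.2) : Pm).
Proof.
have mg (b : R) : measurable_fun [set: measurableTypeR R] (fun x : R => x - b : measurableTypeR R).
  exact: measurable_funB.
apply/measurable_fun_pairP; split.
  by apply: (measurableT_comp (mg a.1)); exact: measurable_fst.
by apply: (measurableT_comp (mg a.2)); exact: measurable_snd.
Qed.

Lemma L2_shift (a : P) (A : set Pm) : measurable A ->
  L2 [set z | A (z.1 - a.1, z.2 - a.2)] = L2 A.
Proof.
move=> mA; pose f := fun z : P => (z.1 - a.1, z.2 - a.2) : Pm.
have mg (b : R) : measurable_fun [set: measurableTypeR R] (fun x : R => x - b : measurableTypeR R).
  exact: measurable_funB.
have mf : measurable_fun [set: Pm] f := measurable_shift2 a.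
have [m mE] := scaled_pushforward L2 (NngNum ler01) mf.
have -> : L2 A = m A.
  apply: product_measure_unique => // B C mB mC; rewrite mE mul1e /=.
  have -> : f @^-1` (B `*` C) = [set x | B (x - a.1)] `*` [set y | C (y - a.2)] by [].
  have mB' : measurable [set x : measurableTypeR R | B (x - a.1)].
    by rewrite -[X in measurable X]setTI; exact: mg.
  have mC' : measurable [set x : measurableTypeR R | C (x - a.2)].
    by rewrite -[X in measurable X]setTI; exact: mg.
  by rewrite L2_rect// !lebesgue_shift.
by rewrite mE mul1e.
Qed.

Variables (rho : E -> E -> R) (I : P -> E).
Hypothesis rho_ge0 : forall x y, 0 <= rho x y.
Hypothesis rhoI : forall z w,
  rho (I z) (I w) = Num.sqrt ((z.1 - w.1) ^+ 2 + (z.2 - w.2) ^+ 2).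

Lemma rhoI_le z w (D : R) : 0 <= D ->
  (rho (I z) (I w) <= D) = ((z.1 - w.1) ^+ 2 + (z.2 - w.2) ^+ 2 <= D ^+ 2).
Proof.
move=> D0; rewrite rhoI -[in RHS](@sqr_sqrtr _ ((z.1 - w.1) ^+ 2 + (z.2 - w.2) ^+ 2)).
  by rewrite ler_sqr ?nnegrE ?sqrtr_ge0.
by rewrite addr_ge0 ?sqr_ge0.
Qed.

Lemma diam_le (F : set E) (D : R) : (forall x y, F x -> F y -> rho x y <= D) ->
  (diam rho F <= D%:E)%E.
Proof. by move=> h; apply: ge_ereal_sup => _ [x [y [Fx Fy ->]]]; rewrite lee_fin h. Qed.

Lemma le_diam (F : set E) x y : F x -> F y -> ((rho x y)%:E <= diam rho F)%E.
Proof. by move=> Fx Fy; apply: ereal_sup_ubound; exists x, y. Qed.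

Lemma fine_diam_ge0 (F : set E) : 0 <= fine (diam rho F).
Proof.
have [->|/set0P[x Fx]] := eqVneq F set0.
  rewrite /diam (_ : [set t | _] = set0) ?ereal_sup0//.
  by apply/seteqP; split=> // t [x [y []]].
apply: fine_ge0; apply: le_trans (le_diam Fx Fx); by rewrite lee_fin.
Qed.

Lemma fine_diam_le (F : set E) (D : R) : 0 <= D -> (diam rho F <= D%:E)%E ->
  fine (diam rho F) <= D.
Proof.
move=> D0; case: (diam rho F) => //= r; by rewrite ?lee_fin.
Qed.

Lemma ball_volume2 : unit_ball_volume 2 = pi :> R.
Proof. by rewrite /=; field. Qed.

Lemma continuous_dist2 (w : P) :
  continuous (fun z : P => (z.1 - w.1) ^+ 2 + (z.2 - w.2) ^+ 2).
Proof.
move=> z; apply: cvgD.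
  apply: (@continuous_comp _ _ _ (fun z : P => z.1 - w.1) (fun t : R => t ^+ 2)); last exact: exprn_continuous.
  by apply: cvgB; [exact: cvg_fst|exact: cvg_cst].
apply: (@continuous_comp _ _ _ (fun z : P => z.2 - w.2) (fun t : R => t ^+ 2)); last exact: exprn_continuous.
by apply: cvgB; [exact: cvg_snd|exact: cvg_cst].
Qed.

(** Each covering set leaves a trace on the plane; its closure is measurable
    with the same diameter, and the isodiametric inequality bounds its area by
    the corresponding summand. *)
Lemma hausdorff_pre_ge (A : set P) (d : R) : 0 < d -> measurable (A : set Pm) ->
  (L2 A <= hausdorff_pre rho 2 d (I @` A))%E.
Proof.
move=> d0 mA; apply: le_ereal_inf_tmp => _ [F [cov dF ->]].
pose G n := closure [set z : P | F n (I z)].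
have mG n : measurable (G n : set Pm) by apply: closed_measurable2; exact: closed_closure.
have AG : A `<=` \bigcup_n G n.
  move=> z Az; have [n _ Fn] := cov _ (imageP I Az).
  by exists n => //; apply: subset_closure.
have hG n : diam2_le (G n) (fine (diam rho (F n))).
  set D := fine _; have D0 : 0 <= D := fine_diam_ge0 _.
  have hF z w : F n (I z) -> F n (I w) -> (z.1 - w.1) ^+ 2 + (z.2 - w.2) ^+ 2 <= D ^+ 2.
    move=> Fz Fw; rewrite -rhoI_le// -lee_fin /D fineK; first exact: le_diam.
    rewrite fin_numE; apply/andP; split.
      by apply/eqP => Ey; have := le_diam Fz Fw; rewrite Ey.
    by apply/eqP => Ey; have := dF n; rewrite Ey.
  have cl (w : P) : closed [set z : P | (z.1 - w.1) ^+ 2 + (z.2 - w.2) ^+ 2 <= D ^+ 2].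
    have cf := @continuous_dist2 w.
    by have /continuous_closedP/(_ _ (@closed_le _ (D ^+ 2))) := cf.
  have h1 z w : G n z -> F n (I w) -> (z.1 - w.1) ^+ 2 + (z.2 - w.2) ^+ 2 <= D ^+ 2.
    move=> Gz Fw; have := cl w; rewrite closure_id => clw.
    suff : closure [set z : P | (z.1 - w.1) ^+ 2 + (z.2 - w.2) ^+ 2 <= D ^+ 2] z by rewrite -clw.
    by move: Gz; apply: closure_subset => x /= Fx; exact: hF.
  move=> z w Gz Gw; have := cl z; rewrite closure_id => clz.
  suff : closure [set w : P | (w.1 - z.1) ^+ 2 + (w.2 - z.2) ^+ 2 <= D ^+ 2] w.
    by rewrite -clz /= -sqrrN opprB -[X in _ + X]sqrrN opprB.
  move: Gw; apply: closure_subset => x /= Fx; have := h1 _ _ Gz Fx.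
  by rewrite -sqrrN opprB -[X in _ + X]sqrrN opprB.
apply: (@le_trans _ _ (\sum_(0 <= n <oo) L2 (G n))%E).
  exact: measure_sigma_subadditive.
apply: lee_nneseries => // n _.
have := isodiametric (fine_diam_ge0 (F n)) (mG n) (hG n).
by rewrite ball_volume2.
Qed.

Section upper.
Variable d : R.
Hypothesis d0 : 0 < d.

Local Notation discrete := (g_sigma_algebraType [set: set P]).

(** The summand of the Hausdorff premeasure, infinite on sets of diameter more
    than d. All sets are declared measurable, so that [mu_ext content] minimizes
    over arbitrary coverings. *)
Definition content (F : set discrete) : \bar R :=
  if (diam rho (I @` F) <= d%:E)%E then (pi * (fine (diam rho (I @` F)) / 2) ^+ 2)%:E
  else +oo%E.

Lemma content_ge0 F : (0 <= content F)%E.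
Proof.
by rewrite /content; case: ifP => // _; rewrite lee_fin mulr_ge0 ?pi_ge0 ?sqr_ge0.
Qed.

Lemma content0 : content set0 = 0%E.
Proof.
rewrite /content image_set0 (_ : diam rho set0 = -oo%E) ?leNye/= ?mul0r ?expr0n/= ?mulr0//.
rewrite /diam (_ : [set t | _] = set0) ?ereal_sup0//.
by apply/seteqP; split=> // t [x [y []]].
Qed.

Definition Hd : set P -> \bar R := mu_ext content.

HB.instance Definition _ := isOuterMeasure.Build R P Hd
  (mu_ext0 content0 content_ge0)
  (mu_ext_ge0 content_ge0)
  (le_mu_ext content)
  (mu_ext_sigma_subadditive content_ge0).

Lemma measurable_discrete (F : set P) : measurable (F : set discrete).
Proof. exact: sub_sigma_algebra. Qed.

Lemma Hd_le F (D : R) : 0 <= D <= d -> (forall z w, F z -> F w -> rho (I z) (I w) <= D) ->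
  (Hd F <= (pi * (D / 2) ^+ 2)%:E)%E.
Proof.
move=> /andP[D0 Dd] h.
have dF : (diam rho (I @` F) <= D%:E)%E.
  by apply: diam_le => _ _ [z Fz <-] [w Fw <-]; exact: h.
apply: (@le_trans _ _ (content F)); last first.
  rewrite /content ifT; last by apply: le_trans dF _; rewrite lee_fin.
  have := fine_diam_le D0 dF; have := fine_diam_ge0 (I @` F) => f0 fD.
  by rewrite lee_fin ler_pM2l ?pi_gt0// ler_sqr ?nnegrE ?divr_ge0// ler_pM2r.
apply: ereal_inf_lbound; exists (fun n => if n is 0%N then F else set0).
  split; first by move=> n; exact: measurable_discrete.
  by move=> z Fz; exists 0%N.
rewrite nneseries_recl//=; last by move=> k _; exact: content_ge0.
by rewrite eseries0 ?adde0// => -[|k]// _ _ /=; exact: content0.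
Qed.

(** A covering that uses a set of large diameter costs [+oo], so the infimum
    that defines the outer measure is over coverings by small sets. *)
Lemma hausdorff_pre_le (A : set P) : (hausdorff_pre rho 2 d (I @` A) <= Hd A)%E.
Proof.
apply: le_ereal_inf_tmp => _ [B [mB AB] <-].
have [hB|/existsNP[n hn]] := pselect (forall n, (diam rho (I @` B n) <= d%:E)%E); last first.
  rewrite (eseries_pinfty _ _ (_ : content (B n) = +oo%E)) ?leey//.
    by move=> k _; apply/eqP => h; have := content_ge0 (B k); rewrite h.
  by rewrite /content ifF//; apply/negP.
apply: ereal_inf_lbound; exists (fun n => I @` B n); split => //.
  by move=> _ [z /AB[n _ Bz] <-]; exists n => //; exists z.
by apply: eq_eseriesr => n _; rewrite /content hB ball_volume2.
Qed.

Definition valid_const (c : R) := 0 <= c /\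
  forall x y l, 0 < l < d / 2 -> (Hd (sq x y l) <= (c * l ^+ 2)%:E)%E.

Lemma rhoI_norm z w : rho (I z) (I w) <= 2 * `|z - w|.
Proof.
rewrite rhoI_le ?mulr_ge0//.
have h1 := norm_fst_le (z - w); have h2 := norm_snd_le (z - w); rewrite /= in h1 h2.
have E (a b : R) : `|a| <= b -> a ^+ 2 <= b ^+ 2.
  by move=> h; rewrite -[X in X <= _]real_normK ?num_real// ler_sqr ?nnegrE// (le_trans _ h).
have := E _ _ h1; have := E _ _ h2; rewrite exprMn; have := sqr_ge0 `|z - w|; lra.
Qed.

Lemma valid_pi : valid_const pi.
Proof.
split; first exact: pi_ge0.
move=> x y l /andP[l0 ld].
have -> : pi * l ^+ 2 = pi * ((2 * l) / 2) ^+ 2 by rewrite [2 * l]mulrC mulfK.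
apply: Hd_le; first by apply/andP; split; lra.
move=> z w /andP[/andP[a b] /andP[c e]] /andP[/andP[a' b'] /andP[c' e']].
rewrite (le_trans (rhoI_norm _ _))// ler_pM2l// prod_norm_le /= !ler_norml.
by apply/andP; split; apply/andP; split; lra.
Qed.

(** A square is the union of its inscribed open disc, of premeasure at most its
    area since its diameter is the side, and of a compact rest, to which the
    constant c applies by [outer_measure_le_squares]. *)
Lemma valid_step c : valid_const c -> valid_const (pi / 4 + c * (1 - pi / 4)).
Proof.
move=> [c0 hc].
have pi4 : (pi : R) / 4 < 1 by have := @pihalf_lt2 R; lra.
split; first by rewrite addr_ge0 ?divr_ge0 ?pi_ge0// mulr_ge0//; lra.
move=> x y l /andP[l0 ld].
pose a : P := (x + l / 2, y + l / 2).
pose D : set P := [set z | (z.1 - a.1) ^+ 2 + (z.2 - a.2) ^+ 2 < (l / 2) ^+ 2].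
pose Q : set P := `[x, x + l]%classic `*` `[y, y + l]%classic.
have l20 : 0 < l / 2 by rewrite divr_gt0.
have mD : measurable (D : set Pm).
  have := measurable_norm2 ((l / 2) ^+ 2) false => mD0.
  by have := measurable_shift2 a measurableT mD0; rewrite setTI.
have LD : L2 D = (pi * (l / 2) ^+ 2)%:E.
  have [_ <-] := L2_disc l20.
  by rewrite -(L2_shift a (measurable_norm2 ((l / 2) ^+ 2) false)).
have cf := @continuous_dist2 a.
have cQ : compact Q by apply: compact_setX; exact: segment_compact.
have mQ : measurable (Q : set Pm).
  by apply: closed_measurable2; apply: compact_closed => //; exact: norm_hausdorff.
have LQ : L2 Q = (l ^+ 2)%:E.
  rewrite /Q L2_rect// !lebesgue_measure_itv/= !lte_fin !ltrDl l0 -!EFinD -EFinM.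
  by congr EFin; ring.
have DQ : D `<=` Q.
  move=> z; rewrite /D /Q /a /= !in_itv/= => h.
  have h1 := sqr_ge0 (z.1 - (x + l / 2)); have h2 := sqr_ge0 (z.2 - (y + l / 2)).
  have : (z.1 - (x + l / 2)) ^+ 2 <= (l / 2) ^+ 2 by lra.
  have : (z.2 - (y + l / 2)) ^+ 2 <= (l / 2) ^+ 2 by lra.
  rewrite !sqr_le_itv ?(ltW l20)// => /andP[e1 e2] /andP[e3 e4].
  by split; apply/andP; split; lra.
pose K := Q `\` D.
have cK : compact K.
  apply: (@subclosed_compact _ _ Q) => //; last by move=> z [].
  have -> : K = Q `&` [set z : P | (l / 2) ^+ 2 <= (z.1 - a.1) ^+ 2 + (z.2 - a.2) ^+ 2].
    by apply/seteqP; split=> z [Qz]; rewrite /D /= => h; split=> //=; rewrite ?leNgt; apply/negP => //;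
      rewrite -leNgt.
  apply: closedI; first by apply: compact_closed => //; exact: norm_hausdorff.
  by have /continuous_closedP/(_ _ (@closed_ge _ ((l / 2) ^+ 2))) := cf.
have LK : L2 K = (l ^+ 2 - pi * (l / 2) ^+ 2)%:E.
  have Qfin : (L2 Q < +oo)%E by rewrite LQ ltry.
  have -> : L2 K = (L2 Q - L2 (Q `&` D))%E by exact: measureD.
  by rewrite (setIidr DQ) LQ LD.
have HK : (Hd K <= (c * (l ^+ 2 - pi * (l / 2) ^+ 2))%:E)%E.
  have d20 : 0 < d / 2 by rewrite divr_gt0.
  by have := @outer_measure_le_squares _ Hd c (d / 2) c0 d20 hc K cK; rewrite LK -EFinM.
have HD : (Hd D <= (pi * (l / 2) ^+ 2)%:E)%E.
  apply: Hd_le; first by apply/andP; split; lra.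
  move=> z w hz hw; rewrite rhoI_le ?(ltW l0)//.
  have {}hz : (z.1 - a.1) ^+ 2 + (z.2 - a.2) ^+ 2 < (l / 2) ^+ 2 := hz.
  have {}hw : (w.1 - a.1) ^+ 2 + (w.2 - a.2) ^+ 2 < (l / 2) ^+ 2 := hw.
  have h1 := sqr_ge0 (z.1 - a.1 + (w.1 - a.1)).
  have h2 := sqr_ge0 (z.2 - a.2 + (w.2 - a.2)).
  have -> : l ^+ 2 = 2 * (l / 2) ^+ 2 + 2 * (l / 2) ^+ 2 by field.
  rewrite [leLHS](_ : _ = 2 * ((z.1 - a.1) ^+ 2 + (z.2 - a.2) ^+ 2) +
    2 * ((w.1 - a.1) ^+ 2 + (w.2 - a.2) ^+ 2) - (z.1 - a.1 + (w.1 - a.1)) ^+ 2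
    - (z.2 - a.2 + (w.2 - a.2)) ^+ 2); last by ring.
  by lra.
have sQ : sq x y l `<=` D `|` K.
  move=> z hz; have [Dz|nDz] := pselect (D z); [by left|right; split => //].
  move: hz; rewrite /sq /Q /= !in_itv/= => /andP[/andP[e1 e2] /andP[e3 e4]].
  by split; apply/andP; split=> //; exact: ltW.
apply: (@le_trans _ _ (Hd (D `|` K))); first exact: le_outer_measure.
apply: (@le_trans _ _ (Hd D + Hd K)%E); first exact: outer_measureU2.
apply: le_trans (leeD HD HK) _.
by rewrite -EFinD lee_fin; lra.
Qed.

(** By [valid_step] the infimum m of the valid constants satisfies
    m <= pi / 4 + m (1 - pi / 4), that is m <= 1. *)
Lemma valid_one (e : R) : 0 < e -> exists2 c, valid_const c & c <= 1 + e.
Proof.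
move=> e0.
have pi4 : (pi : R) / 4 < 1 by have := @pihalf_lt2 R; lra.
have pi40 : 0 < (pi : R) / 4 by rewrite divr_gt0// pi_gt0.
have hi : has_inf valid_const.
  by split; [exists pi; exact: valid_pi|exists 0 => c [] ].
pose m := inf valid_const.
have mle c : valid_const c -> m <= c by move=> vc; apply: ge_inf => //; case: hi.
have m1 : m <= 1.
  have h c : valid_const c -> m <= pi / 4 + c * (1 - pi / 4) by move=> /valid_step; exact: mle.
  have : (m - pi / 4) / (1 - pi / 4) <= m.
    apply: lb_le_inf; first by exists pi; exact: valid_pi.
    by move=> c /h hc; rewrite ler_pdivrMr ?subr_gt0//; lra.
  rewrite ler_pdivrMr ?subr_gt0//; nra.
have [c vc cm] := inf_adherent e0 hi.
by exists c => //; rewrite -/m in cm; lra.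
Qed.

Lemma Hd_compact (A : set P) : compact A -> (Hd A <= L2 A)%E.
Proof.
move=> cA.
have [M hM] := compact_bound cA.
have mA : measurable (A : set Pm).
  by apply: closed_measurable2; apply: compact_closed => //; exact: norm_hausdorff.
have fin : L2 A \is a fin_num.
  by rewrite ge0_fin_numE//; exact: L2_bounded hM.
apply/lee_addgt0Pr => e e0.
set L := fine (L2 A); have L0 : 0 <= L by exact: fine_ge0.
have e1 : 0 < e / (L + 1) by rewrite divr_gt0// ltr_wpDl.
have [c [c0 hc] ce] := valid_one e1.
have d20 : 0 < d / 2 by rewrite divr_gt0.
have := @outer_measure_le_squares _ Hd c (d / 2) c0 d20 hc A cA.
move/le_trans; apply; rewrite -(fineK fin) -/L -EFinM -EFinD lee_fin.
rewrite (le_trans (ler_wpM2r L0 ce))// mulrDl mul1r lerD2l mulrAC ler_pdivrMr ?ltr_wpDl//.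
by rewrite ler_pM2l// lerDl.
Qed.

End upper.

Theorem hausdorff_plane (A : set P) : compact A -> hausdorff rho 2 (I @` A) = L2 A.
Proof.
move=> cA.
have mA : measurable (A : set Pm).
  by apply: closed_measurable2; apply: compact_closed => //; exact: norm_hausdorff.
apply/eqP; rewrite eq_le; apply/andP; split.
  apply: ge_ereal_sup => _ [d /= d0 <-].
  by apply: le_trans (hausdorff_pre_le _ _) _; exact: Hd_compact.
apply: le_trans (hausdorff_pre_ge ltr01 mA) _.
by apply: ereal_sup_ubound; exists 1 => //=.
Qed.

End Hausdorff.

(** * The Engel group in coordinates *)

Notation "x .:[ k ]" := (fun_of_matrix x (0 : 'I_1) (inord k : 'I_4)) (at level 1, left associativity, format "x .:[ k ]").

Section EngelCoordinates.
Context {R : realType}.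
Local Notation E := 'rV[R]_4.
Implicit Types x y v w p : E.

Lemma ord4P (Q : 'I_4 -> Prop) : Q (inord 0) -> Q (inord 1) -> Q (inord 2) -> Q (inord 3) ->
  forall i, Q i.
Proof.
move=> h0 h1 h2 h3 [[|[|[|[|//]]]] hi].
- by rewrite (_ : Ordinal hi = inord 0)//; apply: val_inj; rewrite /= inordK.
- by rewrite (_ : Ordinal hi = inord 1)//; apply: val_inj; rewrite /= inordK.
- by rewrite (_ : Ordinal hi = inord 2)//; apply: val_inj; rewrite /= inordK.
- by rewrite (_ : Ordinal hi = inord 3)//; apply: val_inj; rewrite /= inordK.
Qed.

Lemma row4P x y : x.:[0] = y.:[0] -> x.:[1] = y.:[1] -> x.:[2] = y.:[2] -> x.:[3] = y.:[3] -> x = y.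
Proof. by move=> *; apply/rowP; apply: ord4P. Qed.

Definition row4 (a b c d : R) : E := \row_i nth 0 [:: a; b; c; d] i.

Lemma row4E a b c d : ((row4 a b c d).:[0] = a) * ((row4 a b c d).:[1] = b) *
  ((row4 a b c d).:[2] = c) * ((row4 a b c d).:[3] = d).
Proof. by rewrite /row4 !mxE !inordK. Qed.

Lemma coordD x y k : (x + y).:[k] = x.:[k] + y.:[k]. Proof. by rewrite mxE. Qed.
Lemma coordN x k : (- x).:[k] = - x.:[k]. Proof. by rewrite mxE. Qed.
Lemma coordZ (a : R) x k : (a *: x).:[k] = a * x.:[k]. Proof. by rewrite mxE. Qed.
Lemma coord0 k : (0 : E).:[k] = 0. Proof. by rewrite mxE. Qed.
Definition coordE := (coordD, coordN, coordZ, coord0, row4E).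

Lemma inord_eq (i j : nat) : (i < 4)%N -> (j < 4)%N -> ((inord i : 'I_4) == inord j) = (i == j).
Proof. by move=> hi hj; rewrite -val_eqE /= !inordK. Qed.

(** The coefficient of X_3 in [x, y]. *)
Definition area x y : R := x.:[0] * y.:[1] - x.:[1] * y.:[0].

Lemma bracketE x y : bracket x y = row4 0 0 (area x y) (x.:[0] * y.:[2] - x.:[2] * y.:[0]).
Proof.
by apply: row4P; rewrite !row4E /bracket !mxE !eqxx /= !inord_eq//= ?mulr0 ?mulr1 ?addr0 ?add0r.
Qed.

Lemma mulE x y : engel_mul x y = row4 (x.:[0] + y.:[0]) (x.:[1] + y.:[1])
  (x.:[2] + y.:[2] + 2^-1 * area x y)
  (x.:[3] + y.:[3] + 2^-1 * (x.:[0] * y.:[2] - x.:[2] * y.:[0])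
   + 12^-1 * (x.:[0] * area x y + y.:[0] * area y x)).
Proof.
by apply: row4P; rewrite /engel_mul !bracketE ?coordE /area ?coordE; ring.
Qed.

Lemma engel_mulVK p x : engel_mul p (engel_mul (- p) x) = x.
Proof. by apply: row4P; rewrite !mulE ?coordE /area ?coordE; field. Qed.

Lemma engel_mulKV p x : engel_mul (- p) (engel_mul p x) = x.
Proof. by have := engel_mulVK (- p) x; rewrite opprK. Qed.

Lemma engel_mulVx p : engel_mul (- p) p = 0.
Proof. by apply: row4P; rewrite mulE ?coordE /area ?coordE; ring. Qed.

Lemma engel_mulx0 p : engel_mul p 0 = p.
Proof. by apply: row4P; rewrite mulE ?coordE /area ?coordE; ring. Qed.

Lemma engel_mulxx x : x.:[2] = 0 -> x.:[3] = 0 -> engel_mul x x = x + x.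
Proof. by move=> h2 h3; apply: row4P; rewrite mulE ?coordE /area ?coordE ?h2 ?h3; ring. Qed.

Lemma dilationE r x : dilation r x = row4 (r * x.:[0]) (r * x.:[1]) (r ^+ 2 * x.:[2]) (r ^+ 3 * x.:[3]).
Proof.
by apply: row4P; rewrite !row4E mxE /deg !inordK //= ?expr1.
Qed.

Lemma dilation_comp r s x : dilation r (dilation s x) = dilation (r * s) x.
Proof. by apply: row4P; rewrite !dilationE !row4E; ring. Qed.

Lemma dilation1 x : dilation 1 x = x.
Proof. by apply: row4P; rewrite !dilationE !row4E; ring. Qed.

Lemma dilation0 (r : R) : dilation r (0 : E) = 0.
Proof. by apply: row4P; rewrite !dilationE ?coordE mulr0. Qed.

Lemma dilationK r x : r != 0 -> dilation r^-1 (dilation r x) = x.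
Proof. by move=> r0; rewrite dilation_comp mulVf// dilation1. Qed.

Lemma dilationVK r x : r != 0 -> dilation r (dilation r^-1 x) = x.
Proof. by move=> r0; rewrite dilation_comp mulfV// dilation1. Qed.

(** The derivative at x, in the direction v, of the left translation by w. *)
Definition dleft w x v : E := row4 v.:[0] v.:[1] (v.:[2] + 2^-1 * area w v)
  (v.:[3] + 2^-1 * (w.:[0] * v.:[2] - w.:[2] * v.:[0])
   + 12^-1 * (w.:[0] * area w v + v.:[0] * area x w + x.:[0] * area v w)).

(** The coordinates in the left invariant frame of a tangent vector v at x. *)
Definition triv x v : E := row4 v.:[0] v.:[1] (v.:[2] - 2^-1 * area x v)
  (v.:[3] - 2^-1 * (x.:[0] * v.:[2] - x.:[2] * v.:[0]) + 6^-1 * (x.:[0] * area x v)).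

(** Left translations map the left invariant frame to itself. *)
Lemma triv_dleft w x v : triv (engel_mul w x) (dleft w x v) = triv x v.
Proof.
by apply: row4P; rewrite /triv /dleft !mulE ?coordE /area ?coordE; field.
Qed.

Lemma left_field_coord v x : left_field v x = row4 v.:[0] v.:[1] (v.:[2] + 2^-1 * area x v)
  (v.:[3] + 2^-1 * (x.:[0] * v.:[2] - x.:[2] * v.:[0]) + 12^-1 * (x.:[0] * area x v)).
Proof.
by apply: row4P; rewrite left_fieldE !bracketE ?coordE /area ?coordE; ring.
Qed.

Lemma triv_left_field v x : triv x (left_field v x) = v.
Proof. by apply: row4P; rewrite /triv left_field_coord ?coordE /area ?coordE; field. Qed.

Lemma dleftP w x (k : R) u v : dleft w x (k *: u + v) = k *: dleft w x u + dleft w x v.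
Proof. by apply: row4P; rewrite /dleft /area ?coordE; ring. Qed.

Lemma trivP x (k : R) u v : triv x (k *: u + v) = k *: triv x u + triv x v.
Proof. by apply: row4P; rewrite /triv /area ?coordE; ring. Qed.

Lemma left_fieldP x (k : R) u v :
  left_field (k *: u + v) x = k *: left_field u x + left_field v x.
Proof. by apply: row4P; rewrite !left_field_coord /area ?coordE; ring. Qed.

End EngelCoordinates.

(** * Writing the surface as a graph *)

Section Charts.
Context {R : realType}.
Local Notation P := (R * R)%type.
Local Notation E := 'rV[R]_4.

(** Linear maps from E to the plane, given by matrices acting on rows. *)
Definition prj (A : 'M[R]_(4, 2)) (x : E) : P := ((x *m A) 0 0, (x *m A) 0 1).

Lemma prjP A (k : R) u v : prj A (k *: u + v) = k *: prj A u + prj A v.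
Proof. by rewrite /prj mulmxDl -scalemxAl !mxE. Qed.

Lemma prj0 A : prj A 0 = 0.
Proof. by rewrite /prj mul0mx !mxE. Qed.

Lemma sum4E (x : E) (A : 'M[R]_(4, 2)) j : (x *m A) 0 j =
  A (inord 0) j *: x 0 (inord 0) + (A (inord 1) j *: x 0 (inord 1) +
  (A (inord 2) j *: x 0 (inord 2) + A (inord 3) j *: x 0 (inord 3))).
Proof.
rewrite mxE !big_ord_recl big_ord0 addr0 /GRing.scale/=.
have E0 : ord0 = inord 0 :> 'I_4 by apply: val_inj; rewrite /= inordK.
have E1 : lift ord0 ord0 = inord 1 :> 'I_4 by apply: val_inj; rewrite /= inordK.
have E2 : lift ord0 (lift ord0 ord0) = inord 2 :> 'I_4 by apply: val_inj; rewrite /= inordK.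
have E3 : lift ord0 (lift ord0 (lift ord0 ord0)) = inord 3 :> 'I_4.
  by apply: val_inj; rewrite /= inordK.
by rewrite E3 E2 E1 E0 ![x _ _ * _]mulrC.
Qed.

Lemma sdiff_prj A (f : P -> E) q a b : sdiff f q a b ->
  sdiff (prj A \o f) q (prj A a) (prj A b).
Proof.
move=> h.
have lin j : sdiff (fun x => (f x *m A) 0 j) q ((a *m A) 0 j) ((b *m A) 0 j).
  have hs i : sdiff (fun x => A i j *: (f x 0 i)) q (A i j *: a 0 i) (A i j *: b 0 i).
    by apply: sdiffZ; exact: sdiff_coord.
  have -> : (fun x => (f x *m A) 0 j) = (fun x => A (inord 0) j *: f x 0 (inord 0) +
      (A (inord 1) j *: f x 0 (inord 1) + (A (inord 2) j *: f x 0 (inord 2) + A (inord 3) j *: f x 0 (inord 3)))).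
    by apply/funext => x; rewrite sum4E.
  by rewrite !sum4E; do 3 (apply: sdiffD; first exact: hs); exact: hs.
by apply: sdiff_pair; exact: lin.
Qed.

Lemma sdiff_engel_mul w (f : P -> E) q a b : sdiff f q a b ->
  sdiff (fun x => engel_mul w (f x)) q (dleft w (f q) a) (dleft w (f q) b).
Proof.
move=> h.
have c k := sdiff_coord (inord k) h.
have cst (t : R) := @sdiff_cst R R q t.
have neq (f1 f2 : P -> R) a1 b1 a2 b2 : sdiff f1 q a1 b1 -> f1 = f2 -> a1 = a2 -> b1 = b2 ->
    sdiff f2 q a2 b2 by move=> h1 <- <- <-.
apply: sdiff_rV; apply: ord4P.
- apply: neq (sdiffD (cst w.:[0]) (c 0%N)) _ _ _; last 2 first.
  + by rewrite /dleft row4E add0r.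
  + by rewrite /dleft row4E add0r.
  by apply/funext => x; rewrite mulE row4E.
- apply: neq (sdiffD (cst w.:[1]) (c 1%N)) _ _ _; last 2 first.
  + by rewrite /dleft row4E add0r.
  + by rewrite /dleft row4E add0r.
  by apply/funext => x; rewrite mulE row4E.
- apply: neq (sdiffD (cst w.:[2]) (sdiffD (c 2%N) (sdiffZ (2^-1) (sdiffD
     (sdiffZ w.:[0] (c 1%N)) (sdiffZ (- w.:[1]) (c 0%N)))))) _ _ _; last 2 first.
  + by rewrite /dleft row4E /area /GRing.scale/=; ring.
  + by rewrite /dleft row4E /area /GRing.scale/=; ring.
  by apply/funext => x; rewrite mulE row4E /area /GRing.scale/=; ring.
- apply: neq (sdiffD (cst w.:[3]) (sdiffD (c 3%N) (sdiffD (sdiffZ (2^-1) (sdiffD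
     (sdiffZ w.:[0] (c 2%N)) (sdiffZ (- w.:[2]) (c 0%N))))
     (sdiffZ (12^-1) (sdiffD (sdiffZ w.:[0] (sdiffD
     (sdiffZ w.:[0] (c 1%N)) (sdiffZ (- w.:[1]) (c 0%N))))
     (sdiffM (c 0%N) (sdiffD (sdiffZ w.:[1] (c 0%N)) (sdiffZ (- w.:[0]) (c 1%N))))))))) _ _ _; last 2 first.
  + by rewrite /dleft row4E /area /GRing.scale/=; ring.
  + by rewrite /dleft row4E /area /GRing.scale/=; ring.
  by apply/funext => x; rewrite mulE row4E /area /GRing.scale/=; ring.
Qed.

(** Linear coordinates after the left translation of p to the origin; the
    surface is written as a graph over these two coordinates. *)
Definition gcoord A p (x : E) : P := prj A (engel_mul (- p) x).

Lemma sdiff_gcoord A p (f : P -> E) q a b : sdiff f q a b ->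
  sdiff (gcoord A p \o f) q (prj A (dleft (- p) (f q) a)) (prj A (dleft (- p) (f q) b)).
Proof. by move=> h; apply: sdiff_prj; exact: sdiff_engel_mul. Qed.

Lemma gcoord0 A p : gcoord A p p = 0.
Proof. by rewrite /gcoord engel_mulVx prj0. Qed.

Lemma sdiff_uniq (f : P -> P) q (a b a' b' : P) : sdiff f q a b -> sdiff f q a' b' ->
  a = a' /\ b = b'.
Proof.
by move=> h h'; rewrite -(sdiff_d1 h) -(sdiff_d1 h') -(sdiff_d2 h) -(sdiff_d2 h').
Qed.

Lemma sdiff_near (V : normedModType R) (f g : P -> V) q a b (W : set P) : open W -> W q ->
  (forall x, W x -> f x = g x) -> sdiff f q a b -> sdiff g q a b.
Proof.
move=> oW Wq fg h e e0; have [r r0 hr] := h e e0.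
have := oW; rewrite openE => /(_ q Wq)/nbhs_normE[s s0 hs].
exists (Num.min r s); first by rewrite lt_min r0.
move=> x y; rewrite !lt_min => /andP[xr xs] /andP[yr ys].
by rewrite -!fg; [exact: hr|exact: hs|exact: hs].
Qed.

Lemma sdiff_id q : sdiff (id : P -> P) q (1, 0) (0, 1).
Proof.
move=> e e0; exists 1 => // x y _ _.
have -> : (x - y).1 *: ((1, 0) : P) + (x - y).2 *: ((0, 1) : P) = x - y.
  by rewrite [RHS]surjective_pairing; congr pair; rewrite /= /GRing.scale/= ?mulr1 ?mulr0 ?addr0 ?add0r.
by rewrite subrr normr0 mulr_ge0// ltW.
Qed.

Lemma chart_sdiff S (W : set P) phi q : chart S W phi -> W q ->
  sdiff phi q (d1 phi q) (d2 phi q).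
Proof. by move=> [oW C1 _ _ _] Wq; exact: C1_sdiff oW C1 Wq. Qed.

Lemma chart_sub S (W : set P) phi q : chart S W phi -> W q -> S (phi q).
Proof.
move=> ch Wq; have [U _ hU] := chart_homeo ch (chart_open ch) (@subset_refl _ W).
suff : (S `&` U) (phi q) by case.
by rewrite -hU; exists q.
Qed.

Definition graph_chart S (W : set P) (Phi : P -> E) A p :=
  chart S W Phi /\ forall z, W z -> gcoord A p (Phi z) = z.

Lemma graph_chart_deriv S W Phi A p z : graph_chart S W Phi A p -> W z ->
  prj A (dleft (- p) (Phi z) (d1 Phi z)) = (1, 0) /\
  prj A (dleft (- p) (Phi z) (d2 Phi z)) = (0, 1).
Proof.
move=> [ch gz] Wz; have s1 := sdiff_gcoord A p (chart_sdiff ch Wz).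
have := sdiff_near (chart_open ch) Wz gz s1 => h.
exact: sdiff_uniq h (sdiff_id z).
Qed.

Lemma mul_col_mx2 (v : 'rV[R]_(1 + 1)) (a b : E) :
  v *m col_mx a b = (v 0 0) *: a + (v 0 1) *: b.
Proof.
rewrite -[in LHS](hsubmxK v) mul_row_col; congr (_ + _).
  by rewrite [lsubmx _]mx11_scalar mul_scalar_mx mxE; congr (v _ _ *: _); apply: val_inj.
by rewrite [rsubmx _]mx11_scalar mul_scalar_mx mxE; congr (v _ _ *: _); apply: val_inj.
Qed.

Lemma row_free2 (a b : E) : (forall s t : R, s *: a + t *: b = 0 -> s = 0 /\ t = 0) ->
  row_free (col_mx a b).
Proof.
move=> h; apply: inj_row_free => v hv.
rewrite mul_col_mx2 in hv; have [v0 v1] := h _ _ hv.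
apply/rowP => -[[|[|//]] i]; rewrite mxE.
  by rewrite -[RHS]v0; congr (v _ _); apply: val_inj.
by rewrite -[RHS]v1; congr (v _ _); apply: val_inj.
Qed.

Lemma row_free_dual (a b : E) : row_free (col_mx a b) -> exists2 B : 'M[R]_(4, 1 + 1),
  a *m B = row 0 1%:M & b *m B = row 1 1%:M.
Proof.
move=> /row_freeP[B hB]; exists B.
  have -> : 0 = lshift 1 0 :> 'I_(1 + 1) by apply: val_inj.
  rewrite -hB mul_col_mx; transitivity (row 0 (a *m B)); first by rewrite row_id.
  exact/esym/rowKu.
have -> : 1 = rshift 1 0 :> 'I_(1 + 1) by apply: val_inj.
rewrite -hB mul_col_mx; transitivity (row 0 (b *m B)); first by rewrite row_id.
exact/esym/rowKd.
Qed.

(** The coordinates restricted to the surface are locally invertible, and the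
    inverse turns the given chart into a graph. *)
Theorem graph_chart_exists S (W : set P) phi q0 A p : chart S W phi -> W q0 -> phi q0 = p ->
  det2 (prj A (dleft (- p) p (d1 phi q0))) (prj A (dleft (- p) p (d2 phi q0))) != 0 ->
  exists W' Phi, [/\ graph_chart S W' Phi A p, W' 0 & Phi 0 = p].
Proof.
move=> ch Wq0 pE d0.
pose F := gcoord A p \o phi.
have sF q : W q -> sdiff F q (prj A (dleft (- p) (phi q) (d1 phi q)))
    (prj A (dleft (- p) (phi q) (d2 phi q))).
  by move=> Wq; apply: sdiff_gcoord; exact: chart_sdiff ch Wq.
have {}d0 : det2 (prj A (dleft (- p) (phi q0) (d1 phi q0)))
    (prj A (dleft (- p) (phi q0) (d2 phi q0))) != 0 by rewrite pE.
have [ O [N [G [oO Oq0 OW oN [FN GN sG]]]]] := inverse_function (chart_open ch) Wq0 sF d0.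
have F0 : F q0 = 0 by rewrite /F /= pE gcoord0.
exists N, (phi \o G).
have gz z : N z -> gcoord A p ((phi \o G) z) = z by move=> /GN[_].
have N0 : N 0 by rewrite -F0; have [] := FN _ Oq0.
have G0 : G 0 = q0 by rewrite -F0; have [] := FN _ Oq0.
suff ch' : chart S N (phi \o G) by split; [split| |rewrite /= G0].
have sPhi z : N z -> exists ab : E * E, sdiff (phi \o G) z ab.1 ab.2.
  move=> Nz; have [a' [b' s']] := sG z Nz; have [OG _] := GN _ Nz.
  have := sdiff_comp (chart_sdiff ch (OW _ OG)) s'.
  set a := (X in sdiff _ _ X _); set b := (X in sdiff _ _ _ X) => h.
  by exists (a, b).
have [ab sab] : exists ab : P -> E * E, forall z, N z -> sdiff (phi \o G) z (ab z).1 (ab z).2.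
  have : forall z, exists ab : E * E, N z -> sdiff (phi \o G) z ab.1 ab.2.
    move=> z; have [/sPhi[ab h]|nN] := pselect (N z); first by exists ab.
    by exists (0, 0) => /nN.
  by move=> /choice[ab h]; exists ab.
split.
- exact: oN.
- exact: (sdiff_C1 oN sab).
- move=> z Nz; rewrite /d1 /d2 (sdiff_d1 (sab _ Nz)) (sdiff_d2 (sab _ Nz)).
  have := sdiff_near oN Nz gz (sdiff_gcoord A p (sab _ Nz)) => h.
  have [ha hb] := sdiff_uniq h (sdiff_id z).
  apply: row_free2 => s t st0.
  have : prj A (dleft (- p) ((phi \o G) z) (s *: (ab z).1 + (t *: (ab z).2 + 0))) = (s, t).
    rewrite dleftP dleftP !prjP ha hb.
    have -> : dleft (- p) ((phi \o G) z) 0 = 0.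
      by apply: row4P; rewrite /dleft /area ?coordE; ring.
    rewrite prj0 [RHS]surjective_pairing; congr pair;
    by rewrite /= /GRing.scale/= ?mulr1 ?mulr0 ?addr0 ?add0r.
  rewrite addr0 st0.
  have -> : dleft (- p) ((phi \o G) z) 0 = 0.
    by apply: row4P; rewrite /dleft /area ?coordE; ring.
  by rewrite prj0 => -[<- <-].
- by move=> x y; rewrite !inE => Nx Ny xy; rewrite -(gz x Nx) -(gz y Ny) xy.
- move=> U oU UN.
  have [|//|V oV VE] := chart_homeo ch (O := O `&` F @^-1` U).
  + rewrite openE => x [Ox Ux].
    have h1 : nbhs x O by exact: open_nbhs_nbhs.
    have h2 : nbhs x (F @^-1` U).
      by have := sdiff_cont (sF x (OW _ Ox)); apply; exact: open_nbhs_nbhs.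
    by apply: filterS2 h1 h2 => z.
  + by move=> x [/OW].
  exists V => //; rewrite -VE; apply/seteqP; split=> x [z].
    move=> Uz <-; exists (G z) => //; have [OG FG] := GN _ (UN _ Uz).
    by split => //=; rewrite /= FG.
  move=> [Oz Uz] <-; exists (F z) => //=.
  by have [_ ->] := FN _ Oz.
Qed.

(** Another chart factors through this one: it is Phi composed with its own
    graph coordinates. Hence all charts span the same tangent space. *)
Lemma graph_chart_tangent S W Phi A p z : graph_chart S W Phi A p -> W z ->
  tangent S (Phi z) = [set v | (v <= col_mx (d1 Phi z) (d2 Phi z))%MS].
Proof.
move=> gc Wz; have [ch gz] := gc; have sP := chart_sdiff ch Wz.
apply/seteqP; split=> v.
- move=> [W2 [psi [q [ch2 W2q psiq [u ->]]]]].
  have s2 := chart_sdiff ch2 W2q.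
  have sF := sdiff_gcoord A p s2.
  have [U oU UE] := chart_homeo ch (chart_open ch) (@subset_refl _ W).
  have Uq : U (psi q).
    suff : (S `&` U) (psi q) by case.
    by rewrite -UE psiq; exists z.
  pose V := W2 `&` psi @^-1` U.
  have oV : open V.
    rewrite openE => x [W2x Ux].
    have h1 : nbhs x W2 by apply: open_nbhs_nbhs; split => //; exact: chart_open ch2.
    have h2 : nbhs x (psi @^-1` U).
      by have := sdiff_cont (chart_sdiff ch2 W2x); apply; exact: open_nbhs_nbhs.
    by apply: filterS2 h1 h2 => y.
  have Vq : V q by [].
  have VE x : V x -> (Phi \o (gcoord A p \o psi)) x = psi x.
    move=> [W2x Ux]; have : (S `&` U) (psi x) by split => //; exact: chart_sub ch2 W2x.
    by rewrite -UE => -[y Wy yE]; rewrite /= -yE gz.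
  have Fq : (gcoord A p \o psi) q = z by rewrite /= psiq gz.
  rewrite -Fq in sP.
  have := sdiff_near oV Vq VE (sdiff_comp sP sF) => /sdiff_derive ->.
  rewrite Fq; set a := d1 Phi z; set b := d2 Phi z.
  have sa : (a <= col_mx a b)%MS by have := submx_refl (col_mx a b); rewrite col_mx_sub => /andP[].
  have sb : (b <= col_mx a b)%MS by have := submx_refl (col_mx a b); rewrite col_mx_sub => /andP[].
  by apply: addmx_sub; apply: scalemx_sub; apply: addmx_sub; apply: scalemx_sub.
- move=> /submxP[D ->]; exists W, Phi, z; split => //; exists (D 0 0, D 0 1).
  by rewrite (sdiff_derive _ sP) mul_col_mx2.
Qed.

End Charts.

(** * Two-vectors in the left invariant frame *)

Section Grading.
Context {R : realType}.
Local Notation E := 'rV[R]_4.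
Local Notation M4 := 'M[R]_4.
Implicit Types (Y F c w m G : M4) (x a b v : E).

Lemma left_fieldE_mx v x : left_field v x = v *m frame 1%:M x.
Proof.
have lin n (f : 'I_n -> R) (u : 'I_n -> E) : left_field (\sum_i f i *: u i) x =
    \sum_i f i *: left_field (u i) x.
  elim: n f u => [|n IH] f u.
    by rewrite !big_ord0; apply: row4P; rewrite left_field_coord /area ?coordE; ring.
  by rewrite !big_ord_recl left_fieldP IH.
rewrite {1}[v]row_sum_delta lin mulmx_sum_row; apply: eq_bigr => i _.
by rewrite /frame rowK row1.
Qed.

(** The rows are the vectors X_i(x). *)
Definition lmx x : M4 := frame 1%:M x.

Lemma frameE Y x : frame Y x = Y *m lmx x.
Proof.
apply/row_matrixP => i; rewrite row_mul /lmx -left_fieldE_mx.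
by rewrite /frame rowK.
Qed.

(** The matrix of [triv x], inverse to [lmx x]. *)
Definition tmx x : M4 := \matrix_i triv x (row i 1%:M).

Lemma trivE v x : triv x v = v *m tmx x.
Proof.
have lin n (f : 'I_n -> R) (u : 'I_n -> E) : triv x (\sum_i f i *: u i) =
    \sum_i f i *: triv x (u i).
  elim: n f u => [|n IH] f u.
    by rewrite !big_ord0; apply: row4P; rewrite /triv /area ?coordE; ring.
  by rewrite !big_ord_recl trivP IH.
rewrite {1}[v]row_sum_delta lin mulmx_sum_row; apply: eq_bigr => i _.
by rewrite /tmx rowK row1.
Qed.

Lemma lmxK x : lmx x *m tmx x = 1%:M.
Proof.
apply/row_matrixP => i; rewrite !rowE mulmxA /lmx -left_fieldE_mx -trivE triv_left_field.
by rewrite mulmx1.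
Qed.

Lemma lmx_unit x : lmx x \in unitmx.
Proof. by have [] := mulmx1_unit (lmxK x). Qed.

Lemma invmx_lmx x : invmx (lmx x) = tmx x.
Proof.
by rewrite -[LHS]mulmx1 -(lmxK x) mulmxA mulVmx ?lmx_unit// mul1mx.
Qed.

Lemma lmx0 : lmx 0 = 1%:M.
Proof.
apply/row_matrixP => i; rewrite /lmx rowE -left_fieldE_mx rowE mulmx1.
by apply: row4P; rewrite left_field_coord /area ?coordE; ring.
Qed.

Lemma wedge_mulmx a b m : wedge (a *m m) (b *m m) = m^T *m wedge a b *m m.
Proof. by rewrite /wedge !trmx_mul mulmxBr mulmxBl !mulmxA. Qed.

Lemma wedge_skew a b : (wedge a b)^T = - wedge a b.
Proof. by rewrite /wedge linearB /= !trmx_mul !trmxK opprB. Qed.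

Lemma wedgeE a b i j : wedge a b i j = a 0 i * b 0 j - b 0 i * a 0 j.
Proof. by rewrite /wedge !mxE !big_ord1 !mxE. Qed.

(** The coefficients with respect to Y come from those with respect to the X_i by
    a change of basis that does not depend on the point. *)
Lemma coef2E Y x t1 t2 (k : R) : Y \in unitmx ->
  coef2 Y x (k *: wedge t1 t2) = k *: ((invmx Y)^T *m wedge (triv x t1) (triv x t2) *m invmx Y).
Proof.
move=> Yu; rewrite /coef2 frameE.
have -> : invmx (Y *m lmx x) = tmx x *m invmx Y.
  have U : Y *m lmx x \in unitmx by rewrite unitmx_mul Yu lmx_unit.
  rewrite -[RHS]mul1mx -(mulVmx U) -!mulmxA -[LHS]mulmx1; congr (_ *m _).
  by rewrite (mulmxA (lmx x)) lmxK mul1mx mulmxV.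
rewrite trmx_mul !trivE wedge_mulmx -!scalemxAr -!scalemxAl; congr (_ *: _).
by rewrite !mulmxA.
Qed.

(** The part of degree N of a 2-vector with coefficients c in a graded basis. *)
Definition mask (N : nat) c : M4 := \matrix_(i, j) if (deg i + deg j == N)%N then c i j else 0.

Lemma maskZ N (k : R) c : mask N (k *: c) = k *: mask N c.
Proof. by apply/matrixP => i j; rewrite !mxE; case: ifP; rewrite ?mulr0. Qed.

Lemma mask_skew N c : c^T = - c -> (mask N c)^T = - mask N c.
Proof.
move=> h; apply/matrixP => i j; rewrite !mxE addnC; case: ifP; rewrite ?oppr0// => _.
by have /matrixP/(_ i j) := h; rewrite !mxE.
Qed.

Lemma skew_sum F c : c^T = - c ->
  F^T *m c *m F = \sum_(i < 4) \sum_(j < 4 | (i < j)%N) c i j *: wedge (row i F) (row j F).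
Proof.
move=> h.
have c_skew i j : c j i = - c i j by have /matrixP/(_ i j) := h; rewrite !mxE.
have c_diag i : c i i = 0.
  by have /eqP := c_skew i i; rewrite -addr_eq0 -mulr2n mulrn_eq0 /= => /eqP.
apply/matrixP => k l; rewrite mxE summxE.
under eq_bigr do rewrite mxE mulr_suml.
rewrite exchange_big /=.
under [RHS]eq_bigr do rewrite summxE.
transitivity (\sum_(i < 4) (\sum_(j < 4 | (i < j)%N) c i j * (F i k * F j l)
   + \sum_(j < 4 | (j < i)%N) c i j * (F i k * F j l))).
  apply: eq_bigr => i _; rewrite (bigD1 i) //= c_diag mulr0 mul0r add0r.
  rewrite (bigID (fun j : 'I_4 => (i < j)%N)) /=; congr +%R.
    apply: eq_big => [j|j _]; last by rewrite !mxE; ring.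
    by rewrite andbC; case: ltngtP => //= ij; rewrite -val_eqE/= gtn_eqF.
  apply: eq_big => [j|j _]; last by rewrite !mxE; ring.
  by rewrite -val_eqE /=; case: ltngtP.
rewrite big_split /= [X in _ + X](exchange_big_dep xpredT) //= -big_split /=.
apply: eq_bigr => i _; rewrite -big_split /=; apply: eq_bigr => j _.
by rewrite mxE wedgeE !mxE (c_skew i j); ring.
Qed.

Lemma graded_part_mask F c N : c^T = - c -> graded_part F c N = F^T *m mask N c *m F.
Proof.
move=> h; rewrite skew_sum; last exact: mask_skew.
rewrite /graded_part; apply: eq_bigr => i _; rewrite big_mkcondr /=.
by apply: eq_bigr => j _; rewrite mxE; case: ifP; rewrite ?scale0r.
Qed.

(** Change of basis that preserves the layers. *)
Definition graded_mx Y := forall i j, deg i != deg j -> Y i j = 0.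

Lemma graded_basis_mx Y : graded_basis Y -> graded_mx Y.
Proof. by move=> [_ h] i j ij; have := h i j; rewrite mxE eq_sym; exact. Qed.

(** Preserving the layers amounts to commuting with the diagonal matrix of the
    degrees, a condition that passes to inverses. *)
Lemma graded_mx_comm Y : graded_mx Y <->
  Y *m diag_mx (\row_i (deg i)%:R) = diag_mx (\row_i (deg i)%:R) *m Y.
Proof.
split=> [h|h i j ij].
  apply/matrixP => i j; rewrite mul_mx_diag mul_diag_mx !mxE.
  by have [->|ij] := eqVneq (deg i) (deg j); [exact: mulrC|rewrite h// mul0r mulr0].
have /matrixP/(_ i j) := h; rewrite mul_mx_diag mul_diag_mx !mxE => /eqP.
rewrite mulrC -subr_eq0 -mulrBl mulf_eq0 subr_eq0 eqr_nat eq_sym (negbTE ij) /=.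
by move/eqP.
Qed.

Lemma graded_mx_inv Y : Y \in unitmx -> graded_mx Y -> graded_mx (invmx Y).
Proof.
move=> Yu /graded_mx_comm h; apply/graded_mx_comm.
set D := diag_mx _ in h *.
by rewrite -[LHS]mulmx1 -(mulmxV Yu) !mulmxA -[_ *m D *m Y]mulmxA -h !mulmxA mulVmx// mul1mx.
Qed.

(** A graded change of basis mixes only coefficients of the same degree. *)
Lemma mask_conj N Y c : graded_mx Y -> mask N (Y^T *m c *m Y) = Y^T *m mask N c *m Y.
Proof.
move=> h; apply/matrixP => i j.
have sumE m : (Y^T *m m *m Y) i j = \sum_l \sum_k Y k i * m k l * Y l j.
  rewrite mxE; apply: eq_bigr => l _; rewrite mxE mulr_suml.
  by apply: eq_bigr => k _; rewrite mxE.
rewrite mxE !sumE.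
have zero k l : (deg k + deg l == N)%N != (deg i + deg j == N)%N -> Y k i * Y l j = 0.
  have [li|li] := eqVneq (deg l) (deg j); last by rewrite (h l j li) mulr0.
  have [ki|ki] := eqVneq (deg k) (deg i); last by rewrite (h k i ki) mul0r.
  by rewrite ki li eqxx.
have termE k l : Y k i * mask N c k l * Y l j =
    if (deg i + deg j == N)%N then Y k i * c k l * Y l j else 0.
  rewrite mxE; have [->|ne] := eqVneq (deg k + deg l == N)%N (deg i + deg j == N)%N.
    by case: ifP => _; rewrite ?mulr0 ?mul0r.
  rewrite mulrAC zero// mul0r; case: ifP => // _.
  by rewrite mulrAC zero// mul0r.
case: ifP => hN; last first.
  by rewrite big1 // => l _; rewrite big1 // => k _; rewrite termE hN.
by apply: eq_bigr => l _; apply: eq_bigr => k _; rewrite termE hN.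
Qed.

End Grading.

(** * The degree of a surface and its homogeneous tangent plane *)

Section SurfaceDegree.
Context {R : realType}.
Local Notation P := (R * R)%type.
Local Notation E := 'rV[R]_4.
Local Notation M4 := 'M[R]_4.
Implicit Types (Y F c w m G : M4) (x a b v : E).

Lemma wedge_comb (k1 k2 l1 l2 : R) a b :
  wedge (k1 *: a + k2 *: b) (l1 *: a + l2 *: b) = (k1 * l2 - k2 * l1) *: wedge a b.
Proof. by apply/matrixP => i j; rewrite [RHS]mxE !wedgeE !mxE; ring. Qed.

Lemma wedge_neq0 a b : row_free (col_mx a b) -> wedge a b != 0.
Proof.
move=> /row_free_dual[B fa fb].
apply/eqP => w0.
have : (B^T *m wedge a b *m B) 0 1 = 0 by rewrite w0 mulmx0 mul0mx mxE.
have -> : B^T *m wedge a b *m B = (a *m B)^T *m (b *m B) - (b *m B)^T *m (a *m B).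
  by rewrite /wedge !trmx_mul mulmxBr mulmxBl !mulmxA.
rewrite fa fb mxE mxE big_ord1 !mxE big_ord1 !mxE /= mulr1 mulr0 subr0.
by move/eqP; rewrite oner_eq0.
Qed.

(** Whichever basis of the tangent space is chosen, its wedge product is a
    nonzero multiple of that of the partial derivatives. *)
Lemma tangent2E S W Phi A p z : @graph_chart R S W Phi A p -> W z ->
  exists2 k : R, k != 0 & tangent2 S (Phi z) = k *: wedge (d1 Phi z) (d2 Phi z).
Proof.
move=> gc Wz; have tE := graph_chart_tangent gc Wz.
have fr := chart_immersion gc.1 Wz.
set a := d1 Phi z in tE fr *; set b := d2 Phi z in tE fr *.
rewrite /tangent2; case: xgetP => [w wE [t1 [t2 [[fr2 T] tw]]]|/(_ (wedge a b))]; last first.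
  by case; exists a, b; split => //; split.
have inT v : tangent S (Phi z) v -> exists k1 k2 : R, v = k1 *: a + k2 *: b.
  by rewrite tE => /submxP[D ->]; exists (D 0 0), (D 0 1); rewrite mul_col_mx2.
have sa : (t1 <= col_mx t1 t2)%MS by have := submx_refl (col_mx t1 t2); rewrite col_mx_sub => /andP[].
have sb : (t2 <= col_mx t1 t2)%MS by have := submx_refl (col_mx t1 t2); rewrite col_mx_sub => /andP[].
have [|k1 [k2 E1]] := inT t1; first by rewrite T.
have [|l1 [l2 E2]] := inT t2; first by rewrite T.
have wk : w = (k1 * l2 - k2 * l1) *: wedge a b by rewrite tw E1 E2 wedge_comb.
exists (k1 * l2 - k2 * l1) => //.
apply/eqP => k0; have := wedge_neq0 fr2; rewrite -tw wk k0 scale0r eqxx //.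
Qed.

Lemma pdegree_le5 Y S p : (pdegree Y S p <= 5)%N.
Proof.
apply/bigmax_leqP => -[i j] /andP[/= ij _]; move: ij.
by rewrite /deg; case: i => -[|[|[|[|//]]]] hi; case: j => -[|[|[|[|//]]]] hj.
Qed.

Lemma pdegree_le_degree Y S p : S p -> (pdegree Y S p <= degree Y S)%N.
Proof.
move=> Sp; rewrite /degree.
have h : (pdegree Y S p < 6)%N by rewrite ltnS pdegree_le5.
rewrite (bigD1 (Ordinal h)) /=; first by rewrite leq_max leqnn.
by apply/asboolP; exists p.
Qed.

Lemma mask_conj_eq0 N Y w : graded_basis Y ->
  (mask N ((invmx Y)^T *m w *m invmx Y) == 0) = (mask N w == 0).
Proof.
move=> hY; have Yu := hY.1; have gY := graded_basis_mx hY.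
rewrite mask_conj; last exact: graded_mx_inv.
apply/eqP/eqP => [h|->]; last by rewrite mulmx0 mul0mx.
have -> : mask N w = Y^T *m ((invmx Y)^T *m mask N w *m invmx Y) *m Y.
  by rewrite !mulmxA -trmx_mul mulVmx// trmx1 mul1mx -mulmxA mulVmx// mulmx1.
by rewrite h mulmx0 mul0mx.
Qed.

Section chart.
Variables (S : set E) (W : set P) (Phi : P -> E) (A : 'M[R]_(4, 2)) (p : E).
Hypothesis gc : graph_chart S W Phi A p.
Variable Y : M4.
Hypothesis hY : graded_basis Y.
Variable z : P.
Hypothesis Wz : W z.

(** The tangent 2-vector of the chart in the frame X_1, ..., X_4. Its degrees are
    those of the surface, since they do not depend on the graded basis. *)
Definition om (Phi : P -> E) (z : P) : M4 :=
  wedge (triv (Phi z) (d1 Phi z)) (triv (Phi z) (d2 Phi z)).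

Let coefE : exists2 k : R, k != 0 & coef2 Y (Phi z) (tangent2 S (Phi z)) =
  k *: ((invmx Y)^T *m om Phi z *m invmx Y).
Proof.
have [k k0 ->] := tangent2E gc Wz; exists k => //.
by rewrite coef2E//; exact: hY.1.
Qed.

Let skew_conj k : (k *: ((invmx Y)^T *m om Phi z *m invmx Y))^T =
  - (k *: ((invmx Y)^T *m om Phi z *m invmx Y)).
Proof.
rewrite linearZ /= !trmx_mul trmxK wedge_skew mulNmx mulmxN mulmxA.
by rewrite scalerN.
Qed.

Lemma om_degree5 : (pdegree Y S (Phi z) <= 4)%N -> mask 5 (om Phi z) = 0.
Proof.
move=> hd; have [k k0 cE] := coefE; apply/eqP; rewrite -(mask_conj_eq0 _ _ hY).
have -> : (mask 5 ((invmx Y)^T *m om Phi z *m invmx Y) == 0) =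
   (mask 5 (coef2 Y (Phi z) (tangent2 S (Phi z))) == 0).
  by rewrite cE maskZ scaler_eq0 (negbTE k0).
set c := coef2 _ _ _ in cE *.
have csk : c^T = - c by rewrite cE skew_conj.
have le (i j : 'I_4) : (i < j)%N -> (deg i + deg j == 5)%N -> c i j = 0.
  move=> ij d5; apply/eqP/negPn/negP => cn.
  have := @leq_bigmax_cond _ (fun ij : 'I_4 * 'I_4 => (ij.1 < ij.2)%N && (c ij.1 ij.2 != 0))
     (fun ij => deg ij.1 + deg ij.2)%N (i, j).
  by rewrite /= ij cn => /(_ isT); rewrite (eqP d5) => /leq_trans /(_ hd).
clearbody c; apply/eqP/matrixP => i j; rewrite !mxE; case: ifP => // d5.
have [ij|ji|/val_inj ij] := ltngtP i j; first exact: le.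
  have /matrixP/(_ j i) := csk; rewrite !mxE (le j i ji) ?oppr0 1?addnC//.
by move: d5; rewrite ij addnn => /eqP h; have := odd_double (deg j); rewrite h.
Qed.

(** The maximum that defines the degree is attained. *)
Lemma om_degree4 : pdegree Y S (Phi z) = 4%N -> mask 4 (om Phi z) != 0.
Proof.
move=> hd; have [k k0 cE] := coefE; rewrite -(mask_conj_eq0 _ _ hY).
have -> : (mask 4 ((invmx Y)^T *m om Phi z *m invmx Y) == 0) =
   (mask 4 (coef2 Y (Phi z) (tangent2 S (Phi z))) == 0).
  by rewrite cE maskZ scaler_eq0 (negbTE k0).
apply/eqP => m0; suff : (pdegree Y S (Phi z) <= 0)%N || (pdegree Y S (Phi z) != 4%N).
  by rewrite hd.
apply/orP; right; apply/negP => /eqP h4.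
have : exists ij : 'I_4 * 'I_4, [&& (ij.1 < ij.2)%N, coef2 Y (Phi z) (tangent2 S (Phi z)) ij.1 ij.2 != 0
    & (deg ij.1 + deg ij.2 == 4)%N].
  pose Q := [pred ij : 'I_4 * 'I_4 | (ij.1 < ij.2)%N &&
    (coef2 Y (Phi z) (tangent2 S (Phi z)) ij.1 ij.2 != 0)].
  move: h4; rewrite /pdegree.
  have [ij0 Qij0|Q0] := pickP Q; last by rewrite big_pred0.
  have Q1 : (0 < #|Q|)%N by apply/card_gt0P; exists ij0.
  have [ij Qij E] := @eq_bigmax_cond _ Q (fun ij : 'I_4 * 'I_4 => deg ij.1 + deg ij.2)%N Q1.
  move=> h4; exists ij; move: Qij; rewrite inE => /andP[-> ->] /=.
  by rewrite -E; apply/eqP; exact: h4.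
move=> [[i j] /= /and3P[_ cn d4]].
have /matrixP/(_ i j) := m0; rewrite mxE d4 => h.
by move: cn; rewrite h mxE eqxx.
Qed.

Lemma xi_partE N : exists2 k : R, k != 0 & xi_part Y S (Phi z) N = k *: mask N (om Phi z).
Proof.
have [k k0 cE] := coefE; exists k => //.
rewrite /xi_part cE graded_part_mask// maskZ -scalemxAr -scalemxAl; congr (_ *: _).
rewrite mask_conj; last by apply: graded_mx_inv; [exact: hY.1|exact: graded_basis_mx].
have Yu := hY.1.
by rewrite !mulmxA -trmx_mul mulVmx// trmx1 mul1mx -mulmxA mulVmx// mulmx1.
Qed.

(** The pairs of degree four are (X_1, X_4) and (X_2, X_4): this is the
    horizontal vector h for which the part of degree four is h /\ X_4. *)
Definition hvec (Phi : P -> E) (z : P) : E :=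
  row4 (om Phi z (inord 0) (inord 3)) (om Phi z (inord 1) (inord 3)) 0 0.

Definition e4 : E := row4 0 0 0 1.

Lemma mask4_wedge c : c^T = - c ->
  mask 4 c = wedge (row4 (c (inord 0) (inord 3)) (c (inord 1) (inord 3)) 0 0) e4.
Proof.
move=> csk; have cs i j : c j i = - c i j by have /matrixP/(_ i j) := csk; rewrite !mxE.
have c22 : c (inord 2) (inord 2) = 0.
  by have /eqP := cs (inord 2) (inord 2); rewrite -addr_eq0 -mulr2n mulrn_eq0 /= => /eqP.
have c30 := cs (inord 0) (inord 3); have c31 := cs (inord 1) (inord 3).
by apply/matrixP; apply: ord4P; apply: ord4P; rewrite wedgeE mxE /deg !inordK//= /e4 ?row4E;
 rewrite ?c30 ?c31 ?c22; ring.
Qed.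

(** For independent h and X_4, the equation v /\ h /\ X_4 = 0 says that v is a
    combination of them; the degree being four, h does not vanish. *)
Lemma homogeneous_tangentE : pdegree Y S (Phi z) = 4%N ->
  homogeneous_tangent Y S (Phi z) = [set s *: hvec Phi z + t *: e4 | s in setT & t in setT].
Proof.
move=> hd; rewrite /homogeneous_tangent hd.
have [k k0 ->] := xi_partE 4; have h0 := om_degree4 hd.
rewrite mask4_wedge ?wedge_skew// -/(hvec Phi z) in h0 *.
set h := hvec Phi z in h0 *.
have h2 : h.:[2] = 0 by rewrite row4E.
have h3 : h.:[3] = 0 by rewrite row4E.
clearbody h.
have hn : h.:[0] != 0 \/ h.:[1] != 0.
  have [e0|] := eqVneq h.:[0] 0; last by left.
  have [e1|] := eqVneq h.:[1] 0; last by right.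
  move: h0; have -> : h = 0 by apply: row4P; rewrite ?e0 ?e1 ?h2 ?h3 coord0.
  by rewrite /wedge trmx0 mul0mx mulmx0 subrr eqxx.
have sE (i j : 'I_4) : (k *: wedge h e4) i j = k * wedge h e4 i j by rewrite mxE.
apply/seteqP; split => v.
- move=> /= hv.
  have c (i j l : 'I_4) : v 0 i * wedge h e4 j l - v 0 j * wedge h e4 i l + v 0 l * wedge h e4 i j = 0.
    have := hv i j l; rewrite /wedge12 !sE.
    rewrite ![v _ _ * (_ * _)]mulrCA -mulrBr -mulrDr => /eqP.
    by rewrite mulf_eq0 (negbTE k0) => /eqP.
  have c1 := c (inord 0) (inord 1) (inord 3).
  have c2 := c (inord 0) (inord 2) (inord 3).
  have c3 := c (inord 1) (inord 2) (inord 3).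
  rewrite !wedgeE /e4 !row4E h2 h3 in c1 c2 c3.
  have v2 : v.:[2] = 0.
    case: hn => hn.
      have : v.:[2] * h.:[0] = 0 by lra.
      by move/eqP; rewrite mulf_eq0 (negbTE hn) orbF => /eqP.
    have : v.:[2] * h.:[1] = 0 by lra.
    by move/eqP; rewrite mulf_eq0 (negbTE hn) orbF => /eqP.
  have v01 : v.:[0] * h.:[1] = v.:[1] * h.:[0] by lra.
  case: hn => hn.
    exists (v.:[0] / h.:[0]) => //; exists v.:[3] => //.
    apply: row4P; rewrite /e4 ?coordE ?h2 ?h3 ?v2; rewrite ?(mulr0, mulr1, add0r, addr0)//.
      by rewrite divfK.
    by rewrite mulrAC v01 mulfK.
  exists (v.:[1] / h.:[1]) => //; exists v.:[3] => //.
  apply: row4P; rewrite /e4 ?coordE ?h2 ?h3 ?v2; rewrite ?(mulr0, mulr1, add0r, addr0)//.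
    by rewrite mulrAC -v01 mulfK.
  by rewrite divfK.
- move=> [s _ [t _ <-]] i j l; rewrite /wedge12 !sE !wedgeE.
  have vE n : (s *: h + t *: e4) 0 n = s * h 0 n + t * e4 0 n by rewrite !mxE.
  by rewrite !vE; ring.
Qed.

End chart.

Lemma inner2Z G (k : R) w : inner2 G (k *: w) (k *: w) = k ^+ 2 * inner2 G w w.
Proof.
by rewrite /inner2 linearZ /= -!scalemxAl -!scalemxAr -!scalemxAl scalerA mxtraceZ; ring.
Qed.

Lemma norm2Z G (k : R) w : norm2 G (k *: w) = `|k| * norm2 G w.
Proof. by rewrite /norm2 inner2Z sqrtrM ?sqr_ge0// sqrtr_sqr. Qed.

Lemma inner2_conj G m w : inner2 G (m^T *m w *m m) (m^T *m w *m m) =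
  inner2 (m *m G *m m^T) w w.
Proof.
rewrite /inner2; congr (_ * _); rewrite !trmx_mul trmxK -!mulmxA mxtrace_mulC.
by rewrite -!mulmxA.
Qed.

Lemma innerC G (u v : E) : G^T = G -> inner G u v = inner G v u.
Proof.
move=> Gs; rewrite /inner -[in LHS](trmxK (u *m G *m v^T)) mxE.
by rewrite !trmx_mul trmxK Gs mulmxA.
Qed.

Lemma innerDl G (u v w : E) : inner G (u + v) w = inner G u w + inner G v w.
Proof. by rewrite /inner !mulmxDl mxE. Qed.

Lemma innerZl G (k : R) (u w : E) : inner G (k *: u) w = k * inner G u w.
Proof. by rewrite /inner -!scalemxAl mxE. Qed.

Lemma innerDr G (u v w : E) : inner G w (u + v) = inner G w u + inner G w v.
Proof. by rewrite /inner linearD /= mulmxDr mxE. Qed.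

Lemma innerZr G (k : R) (u w : E) : inner G w (k *: u) = k * inner G w u.
Proof. by rewrite /inner linearZ /= -!scalemxAr mxE. Qed.

(** With v = <a, a> b - <a, b> a, the squared norm of v is <a, a> times the Gram
    determinant. *)
Lemma gram_gt0 G a b : G^T = G -> (forall v, v != 0 -> 0 < inner G v v) ->
  row_free (col_mx a b) -> 0 < inner2 G (wedge a b) (wedge a b).
Proof.
move=> Gs Gp fr; rewrite inner2_wedge//.
have lin (s t : R) : s *: a + t *: b = 0 -> s = 0 /\ t = 0.
  move=> st0; have inj := @row_free_inj _ 1 _ _ _ fr.
  have : row_mx s%:M t%:M *m col_mx a b = 0 *m col_mx a b.
    by rewrite mul_row_col !mul_scalar_mx st0 mul0mx.
  move/inj => /rowP h; split.
    by have := h (lshift 1 0); rewrite row_mxEl !mxE eqxx mulr1n.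
  by have := h (rshift 1 0); rewrite row_mxEr !mxE eqxx mulr1n.
have a0 : a != 0.
  apply/eqP => a0; have [] := lin 1 0; first by rewrite a0 scaler0 scale0r addr0.
  by move/eqP; rewrite oner_eq0.
have aa := Gp a a0.
pose v := inner G a a *: b + (- inner G a b) *: a.
have v0 : v != 0.
  apply/eqP => v0; have [] := lin (- inner G a b) (inner G a a); first by rewrite addrC.
  by move=> _ h; move: aa; rewrite h ltxx.
have := Gp v v0; rewrite /v !(innerDl, innerDr, innerZl, innerZr) (innerC b a Gs) => h.
rewrite -(pmulr_rgt0 _ aa); move: h; congr (0 < _); ring.
Qed.

Lemma gram_entry (M N : M4) i j : inner N (row i M) (row j M) = (M *m N *m M^T) i j.
Proof.
by rewrite /inner -row_mul mxE [RHS]mxE; apply: eq_bigr => k _; rewrite !mxE.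
Qed.

Section metric.
Variable g : E -> M4.
Hypothesis hg' : graded_metric g.

(** The Gram matrix in the left invariant frame is constant, as one sees on the
    orthonormal graded basis. *)
Lemma metric_lmx x : lmx x *m g x *m (lmx x)^T = g 0.
Proof.
have [_ [Y hY ortho]] := hg'.
have Yu := hY.1.
have h q : Y *m (lmx q *m g q *m (lmx q)^T) *m Y^T = 1%:M.
  have -> : Y *m (lmx q *m g q *m (lmx q)^T) *m Y^T = (Y *m lmx q) *m g q *m (Y *m lmx q)^T.
    by rewrite trmx_mul !mulmxA.
  apply/matrixP => i j; rewrite -gram_entry [RHS]mxE -(ortho q i j).
  by rewrite !left_fieldE_mx -/(lmx q) !row_mul.
have inj (m m' : M4) : Y *m m *m Y^T = Y *m m' *m Y^T -> m = m'.
  move=> e; have := congr1 (fun x : M4 => x *m invmx Y^T) e; rewrite !mulmxK ?unitmx_tr// => {}e.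
  by have := congr1 (fun x : M4 => invmx Y *m x) e; rewrite !mulKmx.
apply: inj; rewrite h; have := h 0; rewrite lmx0 mul1mx trmx1 mulmx1 => ->//.
Qed.

(** An orthonormal graded basis makes the layers mutually orthogonal. *)
Lemma metric0_graded : graded_mx (g 0).
Proof.
have [_ [Y hY ortho]] := hg'.
have Yu := hY.1; have gY := graded_basis_mx hY; have gI := graded_mx_inv Yu gY.
have h : Y *m g 0 *m Y^T = 1%:M.
  apply/matrixP => i j; rewrite -gram_entry [RHS]mxE -(ortho 0 i j).
  by rewrite !left_fieldE_mx -/(lmx 0) lmx0 !mulmx1.
have -> : g 0 = invmx Y *m (invmx Y)^T.
  have -> : g 0 = invmx Y *m (Y *m g 0 *m Y^T) *m (invmx Y)^T.
    by rewrite !mulmxA mulVmx// mul1mx -mulmxA -trmx_mul mulVmx// trmx1 mulmx1.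
  by rewrite h mulmx1.
move=> i j ij; rewrite mxE big1// => k _; rewrite mxE.
have [ki|ki] := eqVneq (deg i) (deg k); last by rewrite gI// mul0r.
by rewrite [X in _ * X]gI ?mulr0// eq_sym -ki.
Qed.

End metric.
End SurfaceDegree.

(** * Second order contact with the homogeneous tangent plane *)

Section Asymptotics.
Context {R : realType}.
Local Notation P := (R * R)%type.
Local Notation E := 'rV[R]_4.

Lemma sdiff_partial_cont (V : normedModType R) (W : set P) (f a b : P -> V) (e : R) q :
  open W -> W q -> (forall z, W z -> sdiff f z (a z) (b z)) -> 0 < e ->
  exists2 r, 0 < r & forall z, `|z - q| < r -> [/\ W z, `|a z - a q| <= e & `|b z - b q| <= e].
Proof.
move=> oW Wq sf e0.
have [_ C1] := sdiff_C1 oW sf.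
have [_ [c1 _]] := C1 (1, 0); have [_ [c2 _]] := C1 (0, 1).
have h1 : nbhs q W by exact: open_nbhs_nbhs.
have /cvgrPdist_le/(_ _ e0) h2 := c1 q Wq.
have /cvgrPdist_le/(_ _ e0) h3 := c2 q Wq.
have : nbhs q [set z : P | [/\ W z, `|a z - a q| <= e & `|b z - b q| <= e]].
  apply: filterS3 h1 h2 h3 => z Wz.
  rewrite (sdiff_d1 (sf _ Wz)) (sdiff_d1 (sf _ Wq)) (sdiff_d2 (sf _ Wz)) (sdiff_d2 (sf _ Wq)).
  by move=> ? ?; split; rewrite // distrC.
by move=> /nbhs_normE.
Qed.

Lemma mvt0 (g dg : R -> R) (s : R) : (forall c : R, `|c| <= `|s| -> is_derive c 1 g (dg c)) ->
  exists2 c, `|c| <= `|s| & g s - g 0 = dg c * s.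
Proof.
move=> h.
have [s0|s0] := leP 0 s.
  have inb c : c \in `[0, s] -> `|c| <= `|s|.
    by rewrite in_itv/= => /andP[c0 cs]; rewrite !ger0_norm.
  have [||c cts] := @MVT_segment R g dg 0 s s0.
  - move=> c /subset_itv_oo_cc; rewrite inE/= => hc; exact/h/inb.
  - by apply: derivable_within_continuous => c /inb/h[].
  - by rewrite subr0 => ->; exists c => //; exact: inb.
have inb c : c \in `[s, 0] -> `|c| <= `|s|.
  by rewrite in_itv/= => /andP[c0 cs]; rewrite !ler0_norm ?(ltW s0)// lerN2.
have [||c cts E] := @MVT_segment R g dg s 0 (ltW s0).
- move=> c /subset_itv_oo_cc; rewrite inE/= => hc; exact/h/inb.
- by apply: derivable_within_continuous => c /inb/h[].
- by exists c; [exact: inb|rewrite -opprB E sub0r mulrN opprK].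
Qed.

Lemma sdiff_axis1 (f : P -> R) (a b : P -> R) (K s t : R) :
  (forall c, `|c| <= `|s| -> sdiff f (c, t) (a (c, t)) (b (c, t))) ->
  (forall c, `|c| <= `|s| -> `|a (c, t)| <= K) -> `|f (s, t) - f (0, t)| <= K * `|s|.
Proof.
move=> sf hK.
have [c cs ->] : exists2 c, `|c| <= `|s| & f (s, t) - f (0, t) = a (c, t) * s.
  apply: (@mvt0 (fun c => f (c, t)) (fun c => a (c, t))) => c cs.
  have E k : k *: ((1, 0) : P) + (0, t) = (k, t).
    by congr pair; rewrite /= /GRing.scale/= ?mulr1 ?mulr0 ?addr0 ?add0r.
  have := @is_derive_line _ _ f (0, t) (1, 0) c (a (c, t)).
  rewrite E; under eq_fun do rewrite E.
  apply; have := sdiff_is_derive (1, 0) (sf c cs).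
  by rewrite /= scale1r scale0r addr0.
by rewrite normrM ler_wpM2r// hK.
Qed.

Lemma sdiff_axis2 (f : P -> R) (a b : P -> R) (K s t : R) :
  (forall c, `|c| <= `|t| -> sdiff f (s, c) (a (s, c)) (b (s, c))) ->
  (forall c, `|c| <= `|t| -> `|b (s, c)| <= K) -> `|f (s, t) - f (s, 0)| <= K * `|t|.
Proof.
move=> sf hK.
have [c cs ->] : exists2 c, `|c| <= `|t| & f (s, t) - f (s, 0) = b (s, c) * t.
  apply: (@mvt0 (fun c => f (s, c)) (fun c => b (s, c))) => c cs.
  have E k : k *: ((0, 1) : P) + (s, 0) = (s, k).
    by congr pair; rewrite /= /GRing.scale/= ?mulr1 ?mulr0 ?addr0 ?add0r.
  have := @is_derive_line _ _ f (s, 0) (0, 1) c (b (s, c)).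
  rewrite E; under eq_fun do rewrite E.
  apply; have := sdiff_is_derive (0, 1) (sf c cs).
  by rewrite /= scale1r scale0r add0r.
by rewrite normrM ler_wpM2r// hK.
Qed.

Lemma normM_le (x y X Y : R) : `|x| <= X -> `|y| <= Y -> `|x * y| <= X * Y.
Proof. by move=> hx hy; rewrite normrM ler_pM. Qed.

Lemma normD_le (x y X Y : R) : `|x| <= X -> `|y| <= Y -> `|x + y| <= X + Y.
Proof. by move=> hx hy; rewrite (le_trans (ler_normD _ _))// lerD. Qed.

Lemma normB_le (x y X Y : R) : `|x| <= X -> `|y| <= Y -> `|x - y| <= X + Y.
Proof. by move=> hx hy; rewrite (le_trans (ler_normB _ _))// lerD. Qed.

(** At a point x = s v + O(e s) of a curve with velocity u = v + O(e), the
    horizontal parts of x and u are nearly parallel and span an area O(e s).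
    Hence the X_3-coefficient of u in the left invariant frame is its third
    coordinate up to O(e s), and its X_4-coefficient is O(s) times the third
    coordinate plus O(e s). In the contact equation the first is multiplied by a
    quantity bounded away from 0 and the second by a bounded one, so for small s
    the third coordinate of u is O(e s). *)
Lemma contact_estimate (v x u w : E) (V B c e s : R) : 0 < c -> 0 <= e <= 1 -> 0 <= V ->
  0 <= B -> (forall i, `|v 0 i| <= V) -> v.:[2] = 0 ->
  (forall i, `|x 0 i - s * v 0 i| <= e * `|s|) -> (forall i, `|u 0 i - v 0 i| <= e) ->
  (forall i, `|w 0 i| <= B) -> c <= `|w.:[3]| -> u.:[3] = 0 ->
  (triv x u).:[2] * (triv x w).:[3] = (triv x u).:[3] * (triv x w).:[2] ->
  let V1 := V + 1 in `|s| <= 1 -> (V1 + V1 ^+ 2) * B * `|s| <= c / 4 ->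
  c * `|u.:[2]| <= 4 * ((V1 + V1 ^+ 2) * B * (1 + V1) + c * V1) * (e * `|s|).
Proof.
move=> c0 /andP[e0 e1] V0 B0 hv v2 hx hu hw hc u3 + V1 s1 sc.
have V10 : 0 <= V1 by rewrite addr_ge0.
have es0 : 0 <= e * `|s| by rewrite mulr_ge0.
have ess : e * `|s| <= `|s| by rewrite ler_piMl.
have hx1 i : `|x 0 i| <= V1 * `|s|.
  rewrite -(subrK (s * v 0 i) (x 0 i)).
  have h1 : `|s * v 0 i| <= V * `|s| by rewrite normrM mulrC ler_wpM2r.
  by have := normD_le (hx i) h1; rewrite /V1; lra.
have hu1 i : `|u 0 i| <= V1.
  by rewrite -(subrK (v 0 i) (u 0 i)); have := normD_le (hu i) (hv i); rewrite /V1; lra.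
have x2 : `|x.:[2]| <= e * `|s| by have := hx (inord 2); rewrite v2 mulr0 subr0.
have ss : `|s| * `|s| <= `|s| by rewrite ler_piMl.
have hom : `|area x u| <= 4 * V1 * (e * `|s|).
  have -> : area x u = s * (v.:[0] * (u.:[1] - v.:[1]) - v.:[1] * (u.:[0] - v.:[0]))
    + (x.:[0] - s * v.:[0]) * u.:[1] - (x.:[1] - s * v.:[1]) * u.:[0].
    by rewrite /area; ring.
  have h1 : `|s * (v.:[0] * (u.:[1] - v.:[1]) - v.:[1] * (u.:[0] - v.:[0]))| <=
      `|s| * (V * e + V * e).
    by apply: normM_le => //; apply: normB_le; apply: normM_le.
  have h2 := normM_le (hx (inord 0)) (hu1 (inord 1)).
  have h3 := normM_le (hx (inord 1)) (hu1 (inord 0)).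
  have := normB_le (normD_le h1 h2) h3; rewrite /V1; nra.
have homw : `|area x w| <= 2 * V1 * B * `|s|.
  have := normB_le (normM_le (hx1 (inord 0)) (hw (inord 1))) (normM_le (hx1 (inord 1)) (hw (inord 0))).
  by rewrite /area; lra.
rewrite /triv !row4E u3 sub0r.
set A2 := u.:[2] - _; set B3 := w.:[3] - _ + _; set A3 := _ + _ * (_ * area x u); set B2 := w.:[2] - _.
move=> eqAB.
have hA3 : `|A3| <= V1 * `|s| * `|u.:[2]| + (V1 + V1 ^+ 2) * (e * `|s|).
  have h1 : `|- (2^-1 * (x.:[0] * u.:[2] - x.:[2] * u.:[0]))| <=
      2^-1 * (V1 * `|s| * `|u.:[2]| + e * `|s| * V1).
    by rewrite normrN normrM ger0_norm// ler_wpM2l//; apply: normB_le; apply: normM_le.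
  have h2 : `|6^-1 * (x.:[0] * area x u)| <= 6^-1 * (V1 * `|s| * (4 * V1 * (e * `|s|))).
    by rewrite normrM ger0_norm// ler_wpM2l//; apply: normM_le.
  have := normD_le h1 h2.
  have h3 : V1 * `|s| * (4 * V1 * (e * `|s|)) <= 4 * V1 ^+ 2 * (e * `|s|).
    have -> : V1 * `|s| * (4 * V1 * (e * `|s|)) = `|s| * (4 * V1 ^+ 2 * (e * `|s|)) by ring.
    by rewrite ler_piMl// !mulr_ge0// ?sqr_ge0.
  have h4 : 0 <= V1 * `|s| * `|u.:[2]| by rewrite !mulr_ge0.
  have h5 : 0 <= V1 ^+ 2 * (e * `|s|) by rewrite mulr_ge0// sqr_ge0.
  have h6 : 0 <= V1 * (e * `|s|) by rewrite mulr_ge0.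
  by lra.
have hB2 : `|B2| <= B * (1 + V1).
  have h1 : `|2^-1 * area x w| <= 2^-1 * (2 * V1 * B * `|s|).
    by rewrite normrM ger0_norm// ler_wpM2l.
  have h2 : V1 * B * `|s| <= V1 * B by rewrite ler_piMr// mulr_ge0.
  by have := normB_le (hw (inord 2)) h1; lra.
have hB3 : c / 2 <= `|B3|.
  have h1 : `|2^-1 * (x.:[0] * w.:[2] - x.:[2] * w.:[0])| <= 2^-1 * (2 * V1 * B * `|s|).
    rewrite normrM ger0_norm// ler_wpM2l//.
    have := normB_le (normM_le (hx1 (inord 0)) (hw (inord 2))) (normM_le (hx1 (inord 2)) (hw (inord 0))).
    by lra.
  have h2 : `|6^-1 * (x.:[0] * area x w)| <= 6^-1 * (V1 * `|s| * (2 * V1 * B * `|s|)).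
    by rewrite normrM ger0_norm// ler_wpM2l//; apply: normM_le.
  have h3 : V1 * `|s| * (2 * V1 * B * `|s|) <= 2 * V1 ^+ 2 * B * `|s|.
    have -> : V1 * `|s| * (2 * V1 * B * `|s|) = `|s| * (2 * V1 ^+ 2 * B * `|s|) by ring.
    by rewrite ler_piMl// !mulr_ge0// ?sqr_ge0.
  have h4 : 0 <= V1 ^+ 2 * B * `|s| by rewrite !mulr_ge0// sqr_ge0.
  have := normB_le h1 h2.
  have := ler_normD B3 (2^-1 * (x.:[0] * w.:[2] - x.:[2] * w.:[0]) - 6^-1 * (x.:[0] * area x w)).
  have -> : B3 + (2^-1 * (x.:[0] * w.:[2] - x.:[2] * w.:[0]) - 6^-1 * (x.:[0] * area x w)) = w.:[3].
    by rewrite /B3; ring.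
  by lra.
have hA2 : `|u.:[2]| <= `|A2| + 2 * V1 * (e * `|s|).
  have h1 : `|2^-1 * area x u| <= 2^-1 * (4 * V1 * (e * `|s|)).
    by rewrite normrM ger0_norm// ler_wpM2l.
  have -> : u.:[2] = A2 + 2^-1 * area x u by rewrite /A2 subrK.
  by have := normD_le (lexx `|A2|) h1; lra.
have h1 : `|A2| * (c / 2) <= (V1 * `|s| * `|u.:[2]| + (V1 + V1 ^+ 2) * (e * `|s|)) * (B * (1 + V1)).
  apply: (@le_trans _ _ (`|A2| * `|B3|)); first by rewrite ler_wpM2l.
  by rewrite -normrM eqAB; exact: normM_le.
have h2 : V1 * `|s| * `|u.:[2]| * (B * (1 + V1)) <= c / 4 * `|u.:[2]|.
  have -> : V1 * `|s| * `|u.:[2]| * (B * (1 + V1)) = (V1 + V1 ^+ 2) * B * `|s| * `|u.:[2]| by ring.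
  by rewrite ler_wpM2r.
have h3 : c / 2 * `|u.:[2]| <= c / 2 * (`|A2| + 2 * V1 * (e * `|s|)) by rewrite ler_wpM2l// ltW// divr_gt0.
by nra.
Qed.

Section contact.
Variables (W : set P) (f a b : P -> E) (v : E).
Hypothesis oW : open W.
Hypothesis W0 : W 0.
Hypothesis sf : forall z, W z -> sdiff f z (a z) (b z).
Hypothesis f0 : f 0 = 0.
Hypothesis a0 : a 0 = v.
Hypothesis v2 : v.:[2] = 0.
Hypothesis a3 : forall z, W z -> (a z).:[3] = 0.
Hypothesis b03 : (b 0).:[3] != 0.
(* The coefficient on X_3 /\ X_4 of the tangent 2-vector vanishes. *)
Hypothesis contact : forall z, W z ->
  (triv (f z) (a z)).:[2] * (triv (f z) (b z)).:[3] =
  (triv (f z) (a z)).:[3] * (triv (f z) (b z)).:[2].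

Let rho i z := f z 0 i - z.1 * v 0 i.

Let srho i z : W z -> sdiff (rho i) z (a z 0 i - v 0 i) (b z 0 i).
Proof.
move=> Wz; rewrite /rho.
have := sdiffD (sdiff_coord i (sf Wz)) (sdiffZ (- v 0 i) (sdiff_fst z)).
rewrite /GRing.scale/= mulr0 addr0 mulr1; congr (sdiff _ _ _ _).
by apply/funext => x; rewrite mulNr mulrC.
Qed.

Let rho0 i : rho i 0 = 0.
Proof. by rewrite /rho f0 mxE mul0r subrr. Qed.

Lemma first_order : exists2 C, 0 <= C & forall e, 0 < e -> exists2 r, 0 < r &
  forall z, `|z| < r -> [/\ W z, `|a z - v| <= e, `|b z| <= C &
    forall i, `|rho i z| <= e * `|z.1| + C * `|z.2| /\ `|rho i (z.1, 0)| <= e * `|z.1|].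
Proof.
exists (`|b 0| + 1) => [|e e0]; first by rewrite addr_ge0.
pose e' := Num.min e 1.
have e'0 : 0 < e' by rewrite lt_min e0 ltr01.
have [r r0 hr] := sdiff_partial_cont oW W0 sf e'0.
have hr' z : `|z| < r -> [/\ W z, `|a z - v| <= e & `|b z| <= `|b 0| + 1].
  move=> zr; have [|Wz az bz] := hr z; first by rewrite subr0.
  move: az bz; rewrite !le_min => /andP[az _] /andP[_ bz]; split => //.
    by rewrite -a0.
  by rewrite -(subrK (b 0) (b z)) addrC (le_trans (ler_normD _ _))// lerD2l.
exists r => // z zr; have [Wz az bz] := hr' z zr; split => //.
move=> i; have /andP[z1 z2] : (`|z.1| < r) && (`|z.2| < r) by rewrite -prod_norm_lt.
have r10 : `|rho i (z.1, 0)| <= e * `|z.1|.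
  suff : `|rho i (z.1, 0) - rho i (0, 0)| <= e * `|z.1|.
    by rewrite (rho0 i : rho i (0, 0) = 0) subr0.
  have inr c : `|c| <= `|z.1| -> `|((c, 0) : P)| < r.
    by move=> cz; rewrite prod_norm_lt /= normr0 r0 (le_lt_trans cz).
  apply: (@sdiff_axis1 (rho i) (fun z => a z 0 i - v 0 i) (fun z => b z 0 i)) => c cz.
    by have [Wc _ _] := hr' _ (inr c cz); exact: srho.
  have [_ h _] := hr' _ (inr c cz); apply: le_trans h.
  by have := rV_norm_ge (a (c, 0) - v) i; rewrite !mxE.
split => //; rewrite [z in rho i z]surjective_pairing -(subrK (rho i (z.1, 0)) (rho i (z.1, z.2))).
rewrite (le_trans (ler_normD _ _))// addrC lerD//.
have inr c : `|c| <= `|z.2| -> `|((z.1, c) : P)| < r.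
  by move=> cz; rewrite prod_norm_lt /= z1 (le_lt_trans cz).
apply: (@sdiff_axis2 (rho i) (fun z => a z 0 i - v 0 i) (fun z => b z 0 i)) => c cz.
  by have [Wc _ _] := hr' _ (inr c cz); exact: srho.
have [_ _ h] := hr' _ (inr c cz); apply: le_trans h.
exact: rV_norm_ge.
Qed.

(** Along the first axis [contact_estimate] makes the derivative of the third
    coordinate o(s), so that this coordinate is o(s^2); leaving the axis costs a
    multiple of [`|z.2|]. Plain differentiability would give o(s) only. *)
Lemma second_order : exists2 C, 0 <= C & forall e, 0 < e -> exists2 r, 0 < r &
  forall z, `|z| < r -> [/\ W z, forall i, `|f z 0 i - z.1 * v 0 i| <= e * `|z.1| + C * `|z.2| &
     `|(f z).:[2]| <= e * z.1 ^+ 2 + C * `|z.2| ].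
Proof.
have [C C0 hC] := first_order.
exists C => // e e0.
set c := `|(b 0).:[3]| / 2.
have c0 : 0 < c by rewrite divr_gt0// normr_gt0.
have [r1 r10 h1] := sdiff_partial_cont oW W0 sf c0.
pose V1 := `|v| + 1.
pose K := 4 * ((V1 + V1 ^+ 2) * C * (1 + V1) + c * V1) / c.
have Kc : c * K = 4 * ((V1 + V1 ^+ 2) * C * (1 + V1) + c * V1).
  by rewrite /K mulrC divfK// gt_eqF.
have V10 : 0 <= V1 by rewrite addr_ge0.
have K0 : 0 <= K.
  by rewrite divr_ge0 ?(ltW c0)// mulr_ge0// addr_ge0// !mulr_ge0// ?addr_ge0 ?sqr_ge0// ltW.
pose d := Num.min e (Num.min 1 (e / (K + 1))).
have K10 : 0 < K + 1 by rewrite ltr_wpDl.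
have d0 : 0 < d by rewrite !lt_min e0 ltr01 divr_gt0.
have de : d <= e by rewrite ge_min lexx.
have d1 : d <= 1 by rewrite !ge_min lexx orbT.
have dK : K * d <= e.
  have : d <= e / (K + 1) by rewrite !ge_min lexx !orbT.
  by rewrite ler_pdivlMr// => h; apply: le_trans h; rewrite mulrC ler_wpM2l ?ltW// ltrDl.
have [r2 r20 h2] := hC d d0.
pose r3 := c / 4 / ((V1 + V1 ^+ 2) * C + 1).
have L0 : 0 <= (V1 + V1 ^+ 2) * C by rewrite mulr_ge0// addr_ge0// sqr_ge0.
have L10 : 0 < (V1 + V1 ^+ 2) * C + 1 by rewrite ltr_wpDl.
have r30 : 0 < r3 by apply: divr_gt0 => //; exact: divr_gt0.
exists (Num.min (Num.min r1 r2) (Num.min 1 r3)); first by rewrite !lt_min r10 r20 ltr01 r30.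
move=> z; rewrite !lt_min => /andP[/andP[zr1 zr2] /andP[z1 zr3]].
have [Wz _ bz hz] := h2 z zr2; split => //.
  by move=> i; have [h _] := hz i; apply: le_trans h _; rewrite lerD2r ler_wpM2r.
pose q c := ((c, 0) : P).
have hq t : `|t| <= `|z.1| -> [/\ `|q t| < r1, `|q t| < r2, `|t| < 1 & `|t| < r3].
  move=> tz; have zn := norm_fst_le z.
  have qn : `|q t| <= `|z| by rewrite prod_norm_le /= normr0 normr_ge0 andbT (le_trans tz).
  by split; apply: le_lt_trans; first [exact: qn|exact: le_trans tz zn|idtac].
have u2 t : `|t| <= `|z.1| -> `|(a (q t)).:[2]| <= K * d * `|t|.
  move=> tz; have [q1 q2 t1 t3] := hq t tz.
  have [Wq aq bq hr] := h2 _ q2.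
  have [|_ _ bq'] := h1 (q t); first by rewrite subr0.
  have cE : c * `|(a (q t)).:[2]| <=
      4 * ((V1 + V1 ^+ 2) * C * (1 + V1) + c * V1) * (d * `|t|).
    apply: (@contact_estimate v (f (q t)) (a (q t)) (b (q t)) `|v| C c d t) => //.
    - by rewrite (ltW d0) d1.
    - exact: rV_norm_ge.
    - by move=> i; have [_] := hr i.
    - by move=> i; apply: le_trans aq; have := rV_norm_ge (a (q t) - v) i; rewrite !mxE.
    - by move=> i; apply: le_trans bq; exact: rV_norm_ge.
    - have := rV_norm_ge (b (q t) - b 0) (inord 3); rewrite !mxE => hb.
      have := ler_normB (b (q t)).:[3] ((b (q t)).:[3] - (b 0).:[3]).
      by rewrite opprB addrC subrK /c; rewrite /c in bq'; lra.
    - exact: a3.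
    - exact: contact.
    - exact: ltW.
    - rewrite -/V1; move: (ltW t3); rewrite /r3 ler_pdivlMr// => h.
      by apply: le_trans h; rewrite mulrC ler_wpM2l// lerDl.
  by rewrite -(ler_pM2l c0) (le_trans cE)// -[K * d * _]mulrA (mulrA c) Kc.
have h10 : `|(f (q z.1)).:[2]| <= K * d * `|z.1| * `|z.1|.
  suff : `|rho (inord 2) (z.1, 0) - rho (inord 2) (0, 0)| <= K * d * `|z.1| * `|z.1|.
    by rewrite (rho0 _ : rho _ (0, 0) = 0) subr0 /rho v2 mulr0 subr0.
  apply: (@sdiff_axis1 (rho (inord 2)) (fun z => a z 0 (inord 2) - v.:[2]) (fun z => b z 0 (inord 2))) => t tz.
    by have [_ q2 _ _] := hq t tz; have [Wq _ _ _] := h2 _ q2; exact: srho.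
  by rewrite v2 subr0 (le_trans (u2 t tz))// ler_wpM2l// mulr_ge0// ltW.
have -> : (f z).:[2] = (f (q z.1)).:[2] + (rho (inord 2) (z.1, z.2) - rho (inord 2) (z.1, 0)).
  by rewrite /rho v2 !mulr0 !subr0 -surjective_pairing addrC subrK.
apply: normD_le.
  rewrite (le_trans h10)// -mulrA -expr2 real_normK ?num_real// ler_wpM2r ?sqr_ge0//.
apply: (@sdiff_axis2 (rho (inord 2)) (fun z => a z 0 (inord 2) - v.:[2]) (fun z => b z 0 (inord 2))) => t tz;
  have [|Wq _ bq _] := h2 (z.1, t).
- by apply: le_lt_trans zr2; rewrite prod_norm_le /= norm_fst_le (le_trans tz) ?norm_snd_le.
- exact: srho.
- by apply: le_lt_trans zr2; rewrite prod_norm_le /= norm_fst_le (le_trans tz) ?norm_snd_le.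
- by apply: le_trans bq; exact: rV_norm_ge.
Qed.

End contact.
End Asymptotics.

(** * The chart adapted to a point of maximum degree *)

Section Density.
Context {R : realType}.
Local Notation P := (R * R)%type.
Local Notation E := 'rV[R]_4.
Local Notation M4 := 'M[R]_4.
Variables (S : set E) (Y : M4) (g gt : E -> M4).
Hypothesis hY : graded_basis Y.
Hypothesis hg : riemannian_metric g.
Hypothesis hg' : graded_metric g.
Hypothesis hgt : riemannian_metric gt.

Let G := g 0.

Lemma area_density_gt0 W Phi A p z : graph_chart S W Phi A p -> W z ->
  0 < norm2 (gt (Phi z)) (wedge (d1 Phi z) (d2 Phi z)).
Proof.
move=> gc Wz; rewrite sqrtr_gt0; apply: gram_gt0.
- exact: Defs.metric_sym hgt _.
- by move=> v; exact: Defs.metric_pos hgt _ _.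
- by have fr := chart_immersion gc.1 Wz; exact: fr.
Qed.

Lemma inner4E (H : M4) (u v : E) : inner H u v =
  \sum_(j < 4) \sum_(i < 4) u 0 i * H i j * v 0 j.
Proof. by rewrite /inner mxE; apply: eq_bigr => j _; rewrite !mxE mulr_suml. Qed.

Lemma sum4 (F : 'I_4 -> R) : \sum_i F i =
  F (inord 0) + (F (inord 1) + (F (inord 2) + F (inord 3))).
Proof.
rewrite !big_ord_recl big_ord0 addr0; congr (F _ + (F _ + (F _ + F _)));
by apply: val_inj; rewrite /= inordK.
Qed.

Lemma innerGE (u v : E) : inner G u v =
  (u.:[0] * G (inord 0) (inord 0) + u.:[1] * G (inord 1) (inord 0)) * v.:[0] +
  (u.:[0] * G (inord 0) (inord 1) + u.:[1] * G (inord 1) (inord 1)) * v.:[1] +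
  u.:[2] * G (inord 2) (inord 2) * v.:[2] + u.:[3] * G (inord 3) (inord 3) * v.:[3].
Proof.
have gG := metric0_graded hg'.
have z i j : deg (inord i) != deg (inord j) -> G (inord i) (inord j) = 0 by exact: gG.
rewrite inner4E !sum4.
have d k l : (k < 4)%N -> (l < 4)%N -> nth 0%N [:: 1; 1; 2; 3]%N k != nth 0%N [:: 1; 1; 2; 3]%N l ->
    G (inord k) (inord l) = 0 by move=> hk hl h; apply: z; rewrite /deg !inordK.
rewrite (d 0%N 2%N)// (d 0%N 3%N)// (d 1%N 2%N)// (d 1%N 3%N)// (d 2%N 0%N)// (d 2%N 1%N)//.
rewrite (d 2%N 3%N)// (d 3%N 0%N)// (d 3%N 1%N)// (d 3%N 2%N)//.
by ring.
Qed.

Lemma G_pos (v : E) : v != 0 -> 0 < inner G v v.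
Proof. exact: Defs.metric_pos hg _ _. Qed.

Lemma G_sym : G^T = G.
Proof. exact: Defs.metric_sym hg _. Qed.

Definition kap : R := vnorm G (@e4 R).

Lemma e4_neq0 : @e4 R != 0.
Proof.
by apply/eqP => /rowP/(_ (inord 3)); rewrite row4E mxE => /eqP; rewrite oner_eq0.
Qed.

Lemma kap_gt0 : 0 < kap.
Proof. by rewrite sqrtr_gt0; exact/G_pos/e4_neq0. Qed.

Lemma kapE : kap ^+ 2 = G (inord 3) (inord 3).
Proof.
rewrite sqr_sqrtr; last by apply/ltW/G_pos/e4_neq0.
by rewrite innerGE /e4 !row4E; ring.
Qed.

(** The unit vector of the third layer. *)
Definition ev : E := kap^-1 *: @e4 R.

Lemma inner_ev (u : E) : inner G u ev = kap * u.:[3].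
Proof.
rewrite /ev innerZr innerGE /e4 !row4E -kapE; field.
by rewrite gt_eqF// kap_gt0.
Qed.

Lemma ev_coord : (ev.:[0] = 0) * (ev.:[1] = 0) * (ev.:[2] = 0) * (ev.:[3] = kap^-1).
Proof. by rewrite /ev /e4 !coordE !mulr0 mulr1. Qed.

Lemma inner_evev : inner G ev ev = 1.
Proof. by rewrite inner_ev ev_coord mulfV// gt_eqF// kap_gt0. Qed.

Lemma inner_ge0 (u : E) : 0 <= inner G u u.
Proof.
have [->|u0] := eqVneq u 0; last exact/ltW/G_pos.
by rewrite innerGE !coord0; lra.
Qed.

Definition tau_density (Phi : P -> E) z := norm2 (g (Phi z)) (tau_part gt Y S 4 (Phi z)).
Definition jac (Phi : P -> E) z := norm2 (gt (Phi z)) (wedge (d1 Phi z) (d2 Phi z)).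

(** The normalization of the tangent 2-vector by gt cancels the area density of
    gt. What remains is the g-norm of the part h /\ X_4 of degree four, a product
    because h and X_4 are orthogonal. *)
Lemma tau_density_jac W Phi A p z : graph_chart S W Phi A p -> W z ->
  tau_density Phi z * jac Phi z = vnorm G (hvec Phi z) * kap.
Proof.
move=> gc Wz; have J0 := area_density_gt0 gc Wz; rewrite -/(jac Phi z) in J0.
have [k k0 tE] := tangent2E gc Wz.
have Yu := hY.1.
rewrite /tau_density /tau_part /unit_tangent2 tE norm2Z -/(jac Phi z) scalerA coef2E//.
rewrite -/(om Phi z).
set c := _^-1 * k.
have sk : (c *: ((invmx Y)^T *m om Phi z *m invmx Y))^T =
  - (c *: ((invmx Y)^T *m om Phi z *m invmx Y)).
  rewrite linearZ /= !trmx_mul trmxK wedge_skew mulNmx mulmxN mulmxA.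
  by rewrite scalerN.
rewrite graded_part_mask// maskZ mask_conj; last first.
  by apply: graded_mx_inv => //; exact: graded_basis_mx.
have -> : (frame Y (Phi z))^T *m (c *: ((invmx Y)^T *m mask 4 (om Phi z) *m invmx Y)) *m frame Y (Phi z)
  = c *: ((lmx (Phi z))^T *m mask 4 (om Phi z) *m lmx (Phi z)).
  rewrite frameE -scalemxAr -scalemxAl; congr (_ *: _).
  rewrite trmx_mul !mulmxA -[_ *m Y^T *m (invmx Y)^T]mulmxA -trmx_mul mulVmx// trmx1 mulmx1.
  by rewrite -[_ *m invmx Y *m Y]mulmxA mulVmx// mulmx1.
have cE : `|c| * jac Phi z = 1.
  rewrite /c normrM normfV normrM normr_id (ger0_norm (ltW J0)); field.
  by rewrite normr_eq0 k0 gt_eqF.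
rewrite norm2Z mulrAC cE mul1r /norm2 inner2_conj (metric_lmx hg') -/G.
rewrite mask4_wedge; last exact: wedge_skew.
rewrite inner2_wedge; last exact: G_sym.
have -> : inner G (hvec Phi z) (@e4 R) = 0 by rewrite innerGE /hvec /e4 !row4E; ring.
by rewrite mul0r subr0 sqrtrM// inner_ge0.
Qed.

End Density.

Section Adapted.
Context {R : realType}.
Local Notation E := 'rV[R]_4.
Local Notation M4 := 'M[R]_4.
Variables (S : set E) (Y : M4) (g : E -> M4).
Hypothesis hS : C1_surface S.
Hypothesis hY : graded_basis Y.
Hypothesis hg : riemannian_metric g.
Hypothesis hg' : graded_metric g.
Variable p : E.
Hypothesis Sp : S p.
Hypothesis hp : pdegree Y S p = 4%N.

Let G := g 0.
Let kap : R := kap g.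
Let evg := ev g.

Lemma dleftV (v : E) : dleft (- p) p v = triv p v.
Proof.
have := triv_dleft (- p) p v; rewrite engel_mulVx => <-.
by apply: row4P; rewrite /triv /area ?coordE; ring.
Qed.

Lemma tmxK x : tmx x *m lmx x = 1%:M :> M4.
Proof. by rewrite -invmx_lmx mulVmx// lmx_unit. Qed.

Lemma first_chart : exists A W Phi, [/\ graph_chart S W Phi A p, W 0 & Phi 0 = p].
Proof.
have [W [phi [ch [q Wq pq]]]] := hS Sp.
have [B fa fb] := row_free_dual (chart_immersion ch Wq).
pose A := lmx p *m B.
have prjA v : prj A (dleft (- p) p v) = ((v *m B) 0 0, (v *m B) 0 1).
  by rewrite dleftV /prj trivE /A -mulmxA (mulmxA (tmx p)) tmxK mul1mx.
have gen (u w : E) : u *m B = row 0 (1%:M : 'M[R]_(1 + 1)) -> w *m B = row 1 (1%:M : 'M[R]_(1 + 1)) ->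
    det2 (prj A (dleft (- p) p u)) (prj A (dleft (- p) p w)) != 0.
  by move=> hu hw; rewrite !prjA hu hw /det2 !mxE /= mulr1 mulr0 subr0 oner_eq0.
exists A; apply: (graph_chart_exists ch Wq pq); exact: gen fa fb.
Qed.

Definition acoord (v : E) : 'M[R]_(4, 2) :=
  \matrix_(i, j) (if j == 0 then (G *m v^T) i 0 else (G *m evg^T) i 0).

Lemma prj_acoord v x : prj (acoord v) x = (inner G x v, inner G x evg).
Proof.
have e w : inner G x w = \sum_j x 0 j * (G *m w^T) j 0 by rewrite /inner -mulmxA mxE.
rewrite /prj !e; congr pair; rewrite mxE; apply: eq_bigr => i _; congr (_ * _).
  by rewrite /acoord mxE eqxx.
by rewrite /acoord mxE.
Qed.

(** Any graph chart determines the direction v of the horizontal vector h. The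
    coordinates along v and X_4 then give a second graph chart; its own horizontal
    vector spans with X_4 the same homogeneous tangent plane, so it is a multiple
    of v, and the normalization of the coordinates fixes the factor. *)
Theorem adapted_chart : exists v W Phi,
  [/\ graph_chart S W Phi (acoord v) p, W 0, Phi 0 = p &
   [/\ v.:[2] = 0, v.:[3] = 0, inner G v v = 1,
     homogeneous_tangent Y S p = [set s *: v + t *: evg | s in setT & t in setT] &
     triv p (d1 Phi 0) = v /\ hvec Phi 0 = kap^-1 *: v]].
Proof.
have k0 : 0 < kap := kap_gt0 hg.
have kn0 : kap != 0 by rewrite gt_eqF.
have [A [W1 [Phi1 [gc1 W10 Phi10]]]] := first_chart.
have pd1 : pdegree Y S (Phi1 0) = 4%N by rewrite Phi10.
have T1 := homogeneous_tangentE gc1 hY W10 pd1; rewrite Phi10 in T1.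
set h := hvec Phi1 0 in T1.
have h2 : h.:[2] = 0 by rewrite row4E.
have h3 : h.:[3] = 0 by rewrite row4E.
have h0 : h != 0.
  apply/eqP => h0; have := om_degree4 gc1 hY W10 pd1.
  rewrite mask4_wedge; last exact: wedge_skew.
  by rewrite -/(hvec Phi1 0) -/h h0 /wedge trmx0 mul0mx mulmx0 subrr eqxx.
pose nh := vnorm G h.
have nh0 : 0 < nh by rewrite sqrtr_gt0; exact: G_pos.
pose v := nh^-1 *: h.
have v2 : v.:[2] = 0 by rewrite coordZ h2 mulr0.
have v3 : v.:[3] = 0 by rewrite coordZ h3 mulr0.
have hv : h = nh *: v by rewrite /v scalerA mulfV ?scale1r// gt_eqF.
have nh2 : nh ^+ 2 = inner G h h by rewrite sqr_sqrtr//; apply/ltW; exact: G_pos.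
have vv : inner G v v = 1.
  by rewrite /v innerZl innerZr -nh2; field; rewrite gt_eqF.
clearbody v.
have horiz (u w : E) : w.:[2] = 0 -> w.:[3] = 0 -> inner G u w = inner G (row4 u.:[0] u.:[1] 0 0) w.
  by move=> w2 w3; rewrite !(innerGE hg') !row4E w2 w3; ring.
have gen (u w : E) :
    row4 (wedge (triv p u) (triv p w) (inord 0) (inord 3))
         (wedge (triv p u) (triv p w) (inord 1) (inord 3)) 0 0 = h ->
    det2 (prj (acoord v) (dleft (- p) p u)) (prj (acoord v) (dleft (- p) p w)) != 0.
  rewrite !dleftV; move: (triv p u) (triv p w) => a b hab.
  rewrite !prj_acoord /det2 /= !(inner_ev hg hg').
  have -> : inner G a v * (kap * b.:[3]) - kap * a.:[3] * inner G b v =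
     kap * inner G (b.:[3] *: a + (- a.:[3]) *: b) v.
    by rewrite innerDl !innerZl; ring.
  rewrite horiz//.
  have -> : row4 (b.:[3] *: a + (- a.:[3]) *: b).:[0] (b.:[3] *: a + (- a.:[3]) *: b).:[1] 0 0 = h.
    by rewrite -hab; apply: row4P; rewrite !row4E ?wedgeE ?coordE //; ring.
  by rewrite {1}hv innerZl vv mulr1 mulf_neq0// gt_eqF.
have d0 : det2 (prj (acoord v) (dleft (- p) p (d1 Phi1 0)))
    (prj (acoord v) (dleft (- p) p (d2 Phi1 0))) != 0.
  by apply: gen; rewrite /h /hvec /om Phi10.
have [W [Phi [gc W0 Phi0]]] := graph_chart_exists gc1.1 W10 Phi10 d0.
have Tv : homogeneous_tangent Y S p = [set s *: v + t *: evg | s in setT & t in setT].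
  rewrite T1; apply/seteqP; split=> _ [s _ [t _ <-]].
    exists (s * nh) => //; exists (t * kap) => //.
    by rewrite hv /evg /ev !scalerA mulfK// gt_eqF.
  exists (s / nh) => //; exists (t / kap) => //.
  by rewrite hv /evg /ev !scalerA mulfVK// gt_eqF.
have pd : pdegree Y S (Phi 0) = 4%N by rewrite Phi0.
exists v, W, Phi; split => //; split => //.
have [D1 D2] := graph_chart_deriv gc W0.
have gen3 x u r : x = p -> prj (acoord v) (dleft (- p) x u) = r ->
    inner G (triv p u) v = r.1 /\ kap * (triv p u).:[3] = r.2.
  by move=> -> <-; rewrite dleftV prj_acoord (inner_ev hg hg').
have [av a3] := gen3 _ _ _ Phi0 D1; have [_ b3] := gen3 _ _ _ Phi0 D2.
have omE' : om Phi 0 = wedge (triv p (d1 Phi 0)) (triv p (d2 Phi 0)) by rewrite /om Phi0.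
have fin a b : inner G a v = 1 -> kap * a.:[3] = 0 -> kap * b.:[3] = 1 ->
    om Phi 0 = wedge a b -> a = v /\ hvec Phi 0 = kap^-1 *: v.
  move=> {}av {}a3 {}b3 {}omE'.
  have {}a3 : a.:[3] = 0 by move/eqP: a3; rewrite mulf_eq0 (negbTE kn0) => /eqP.
  have {}b3 : b.:[3] = kap^-1 by rewrite -[LHS](mulKf kn0) b3 mulr1.
  have omE i j : om Phi 0 i j = a 0 i * b 0 j - b 0 i * a 0 j by rewrite omE' wedgeE.
  have hE : hvec Phi 0 = kap^-1 *: row4 a.:[0] a.:[1] 0 0.
    by apply: row4P; rewrite /hvec ?coordE ?omE ?a3 ?b3; ring.
  have [c hc] : exists c, hvec Phi 0 = c *: v.
    have T := homogeneous_tangentE gc hY W0 pd; rewrite Phi0 Tv in T.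
    have : [set s *: hvec Phi 0 + t *: @e4 R | s in setT & t in setT] (hvec Phi 0).
      by exists 1 => //; exists 0 => //; rewrite scale1r scale0r addr0.
    rewrite -T => -[s _ [t _ e]]; exists s; rewrite -e.
    have : (s *: v + t *: evg).:[3] = 0 by rewrite e row4E.
    rewrite coordD (coordZ s) (coordZ t) v3 mulr0 add0r (ev_coord g) => /eqP.
    by rewrite mulf_eq0 invr_eq0 (negbTE kn0) orbF => /eqP ->; rewrite scale0r addr0.
  have cE : c = kap^-1.
    have : inner G (hvec Phi 0) v = kap^-1 by rewrite hE innerZl -horiz// av mulr1.
    by rewrite hc innerZl vv mulr1.
  have a01 : row4 a.:[0] a.:[1] 0 0 = v.
    have e := hE; rewrite hc cE in e.
    by have := congr1 (fun x => kap *: x) e; rewrite !scalerA mulfV// !scale1r.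
  have a2 : a.:[2] = 0.
    have h4 : (pdegree Y S (Phi 0%R) <= 4)%N by rewrite pd.
    have /matrixP/(_ (inord 2) (inord 3)) := om_degree5 gc hY W0 h4.
    rewrite [LHS]mxE [RHS]mxE /deg !inordK//= omE a3 b3 mulr0 subr0 => /eqP.
    by rewrite mulf_eq0 invr_eq0 (negbTE kn0) orbF => /eqP.
  split; last by rewrite hc cE.
  by rewrite -a01; apply: row4P; rewrite ?row4E.
exact: fin av a3 b3 omE'.
Qed.

End Adapted.

Section EntrywiseContinuity.
Context {R : realType}.
Local Notation P := (R * R)%type.
Local Notation E := 'rV[R]_4.
Local Notation M4 := 'M[R]_4.

(** Continuity of each entry, which passes directly through matrix products. *)
Definition econt m n (A : P -> 'M[R]_(m, n)) (z0 : P) :=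
  forall i j, {for z0, continuous (fun z => A z i j)}.

Lemma cont_sum n (F : 'I_n -> P -> R) z0 : (forall l, {for z0, continuous (F l)}) ->
  {for z0, continuous (fun z => \sum_l F l z)}.
Proof.
move=> cF; move: (index_enum _) => s; elim: s => [|l s IH].
  by rewrite (_ : (fun z => _) = fun=> 0); [exact: cvg_cst|apply/funext => z; rewrite big_nil].
rewrite (_ : (fun z => _) = fun z => F l z + \sum_(j <- s) F j z).
  by apply: cvgD; [exact: cF|exact: IH].
by apply/funext => z; rewrite big_cons.
Qed.

Lemma econt_mul m n k (A : P -> 'M[R]_(m, n)) (B : P -> 'M[R]_(n, k)) z0 :
  econt A z0 -> econt B z0 -> econt (fun z => A z *m B z) z0.
Proof.
move=> cA cB i j; rewrite (_ : (fun z => _) = (fun z => \sum_l A z i l * B z l j)).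
  by apply: cont_sum => l; apply: cvgM; [exact: cA|exact: cB].
by apply/funext => z; rewrite mxE.
Qed.

Lemma econt_tr m n (A : P -> 'M[R]_(m, n)) z0 :
  econt A z0 -> econt (fun z => (A z)^T) z0.
Proof.
move=> cA i j; rewrite (_ : (fun z => _) = (fun z => A z j i)); first exact: cA.
by apply/funext => z; rewrite mxE.
Qed.

Lemma econt_wedge (a b : P -> E) z0 : econt a z0 -> econt b z0 ->
  econt (fun z => wedge (a z) (b z)) z0.
Proof.
move=> ca cb i j.
rewrite (_ : (fun z => _) = (fun z => a z 0 i * b z 0 j - b z 0 i * a z 0 j)).
  by apply: cvgB; apply: cvgM; [exact: ca|exact: cb|exact: cb|exact: ca].
by apply/funext => z; rewrite wedgeE.
Qed.

Lemma cont_sqrt (f : P -> R) z0 : {for z0, continuous f} ->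
  {for z0, continuous (fun z => Num.sqrt (f z))}.
Proof. by move=> cf; apply: (continuous_comp cf); exact: sqrt_continuous. Qed.

Lemma cont_norm2 (H w : P -> M4) z0 : econt H z0 -> econt w z0 ->
  {for z0, continuous (fun z => norm2 (H z) (w z))}.
Proof.
move=> cH cw; apply: cont_sqrt; apply: cvgM; first exact: cvg_cst.
have c := econt_mul (econt_mul (econt_mul cw cH) (econt_tr cw)) cH.
by apply: cont_sum => i; exact: c.
Qed.

Lemma cont_vnorm (G : M4) (a : P -> E) z0 : econt a z0 ->
  {for z0, continuous (fun z => vnorm G (a z))}.
Proof.
move=> ca; apply: cont_sqrt.
have cG : econt (fun=> G) z0 by move=> i j; exact: cvg_cst.
exact: (econt_mul (econt_mul ca cG) (econt_tr ca)).
Qed.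

Lemma econt_row4 (a b c d : P -> R) z0 : {for z0, continuous a} -> {for z0, continuous b} ->
  {for z0, continuous c} -> {for z0, continuous d} ->
  econt (fun z => row4 (a z) (b z) (c z) (d z)) z0.
Proof.
move=> ca cb cc cd i; move: i => i0 i; rewrite ord1; elim/ord4P: i.
- by rewrite (_ : (fun z => _) = a)//; apply/funext => z; rewrite row4E.
- by rewrite (_ : (fun z => _) = b)//; apply/funext => z; rewrite row4E.
- by rewrite (_ : (fun z => _) = c)//; apply/funext => z; rewrite row4E.
- by rewrite (_ : (fun z => _) = d)//; apply/funext => z; rewrite row4E.
Qed.

Lemma econt_triv (x v : P -> E) z0 : econt x z0 -> econt v z0 ->
  econt (fun z => triv (x z) (v z)) z0.
Proof.
move=> cx cv.
have ca : {for z0, continuous (fun z => area (x z) (v z))}.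
  by apply: cvgB; apply: cvgM; [exact: cx|exact: cv|exact: cx|exact: cv].
apply: econt_row4; [exact: cv|exact: cv| |].
  by apply: cvgB; [exact: cv|apply: cvgM; [exact: cvg_cst|exact: ca]].
apply: cvgD; last by apply: cvgM; [exact: cvg_cst|apply: cvgM; [exact: cx|exact: ca]].
apply: cvgB; first exact: cv.
apply: cvgM; first exact: cvg_cst.
by apply: cvgB; apply: cvgM; [exact: cx|exact: cv|exact: cx|exact: cv].
Qed.

Lemma econt_cont m n (A : P -> 'M[R]_(m, n)) z0 : {for z0, continuous A} -> econt A z0.
Proof. by move=> c i j; exact: cont_coord. Qed.

Lemma cont_near (f : P -> R) (W : set P) (e : R) : open W -> W 0 -> {for 0, continuous f} -> 0 < e ->
  exists2 r, 0 < r & forall z, `|z| < r -> W z /\ `|f z - f 0| <= e.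
Proof.
move=> oW W0 /cvgrPdist_le/(_ _ _)/nbhs_normE h e0.
have [r1 r10 h1] := h _ e0.
have := oW; rewrite openE => /(_ _ W0)/nbhs_normE[r2 r20 h2].
exists (Num.min r1 r2) => [|z]; first by rewrite lt_min r10.
rewrite lt_min => /andP[z1 z2]; split; first by apply: h2; rewrite subr0.
by rewrite distrC; apply: h1; rewrite subr0.
Qed.

End EntrywiseContinuity.

Section Densities.
Context {R : realType}.
Local Notation P := (R * R)%type.
Local Notation E := 'rV[R]_4.
Local Notation M4 := 'M[R]_4.
Variables (S : set E) (Y : M4) (g gt : E -> M4).
Hypothesis hY : graded_basis Y.
Hypothesis hg : riemannian_metric g.
Hypothesis hg' : graded_metric g.
Hypothesis hgt : riemannian_metric gt.
Variables (p v : E) (W : set P) (Phi : P -> E).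
Hypothesis gc : graph_chart S W Phi (acoord g v) p.
Hypothesis W0 : W 0.
Hypothesis vv : inner (g 0) v v = 1.
Hypothesis h0 : hvec Phi 0 = (kap g)^-1 *: v.

Let cont_data : [/\ econt Phi 0, econt (d1 Phi) 0 & econt (d2 Phi) 0].
Proof.
have [c h] := chart_C1 gc.1.
split; apply: econt_cont; first exact: c.
  exact: (h (1, 0)).2.1.
exact: (h (0, 1)).2.1.
Qed.

Lemma cont_jac : {for 0, continuous (jac gt Phi)}.
Proof.
have [cP c1 c2] := cont_data.
have cgt : econt (gt \o Phi) 0.
  apply: econt_cont; apply: continuous_comp; first by have [c _] := chart_C1 gc.1; exact: c.
  by have [+ _] := metric_smooth hgt 0; apply.
exact: cont_norm2 cgt (econt_wedge c1 c2).
Qed.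

Lemma cont_hvec : {for 0, continuous (fun z => vnorm (g 0) (hvec Phi z))}.
Proof.
have [cP c1 c2] := cont_data.
have cw := econt_wedge (econt_triv cP c1) (econt_triv cP c2).
apply: cont_vnorm; apply: econt_row4; [exact: cw|exact: cw|exact: cvg_cst|exact: cvg_cst].
Qed.

(** In the adapted chart the two densities are continuous with product 1 at 0. *)
Theorem density_near (e : R) : 0 < e < 1 -> exists2 r, 0 < r & forall z, `|z| < r ->
  [/\ W z, (1 - e) * jac gt Phi 0 <= jac gt Phi z <= (1 + e) * jac gt Phi 0 &
    1 - e <= tau_density S Y g gt Phi z * jac gt Phi 0 <= 1 + e].
Proof.
move=> /andP[e0 e1].
have core (j j0 t h h' : R) : 0 < j -> 0 < j0 -> 0 <= t -> `|j - j0| <= e / 3 * j0 ->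
    `|h - h'| <= e / 3 -> t * j = h -> h' = 1 ->
    (1 - e) * j0 <= j <= (1 + e) * j0 /\ 1 - e <= t * j0 <= 1 + e.
  move=> jp j0p tp A1 A2 th h1; move: A1 A2; rewrite -th h1.
  rewrite !ler_norml => /andP[a1 a2] /andP[b1 b2].
  split=> //; first by apply/andP; split; nra.
  have tj0 : 0 <= t * j0 by rewrite mulr_ge0// ltW.
  have c1 : t * j <= (1 + e / 3) * (t * j0) by nra.
  have c2 : (1 - e / 3) * (t * j0) <= t * j by nra.
  by apply/andP; split; nra.
have J0 : 0 < jac gt Phi 0 := area_density_gt0 hgt gc W0.
have k0 : 0 < kap g := kap_gt0 hg.
have v0 : vnorm (g 0) (hvec Phi 0) * kap g = 1.
  by rewrite h0 /vnorm innerZl innerZr vv mulr1 -expr2 sqrtr_sqr ger0_norm ?invr_ge0 ?ltW// mulVf// gt_eqF.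
have e30 : 0 < e / 3 by lra.
have oW := chart_open gc.1.
have [r1 r10 hr1] := cont_near oW W0 cont_jac (mulr_gt0 e30 J0).
have cH : {for 0, continuous (fun z => vnorm (g 0) (hvec Phi z) * kap g)}.
  by apply: cvgM; [exact: cont_hvec|exact: cvg_cst].
have [r2 r20 hr2] := cont_near oW W0 cH e30.
exists (Num.min r1 r2) => [|z]; first by rewrite lt_min r10.
rewrite lt_min => /andP[/hr1[Wz j1] /hr2[_ j2]].
have T := tau_density_jac hY hg hg' hgt gc Wz.
have Jz : 0 < jac gt Phi z := area_density_gt0 hgt gc Wz.
have tz : 0 <= tau_density S Y g gt Phi z by exact: sqrtr_ge0.
have [c1 c2] := core _ _ _ _ _ Jz J0 tz j1 j2 T v0.
by split.
Qed.

End Densities.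

Section ContactOrder.
Context {R : realType}.
Local Notation P := (R * R)%type.
Local Notation E := 'rV[R]_4.
Local Notation M4 := 'M[R]_4.
Variables (S : set E) (Y : M4) (g : E -> M4).
Hypothesis hY : graded_basis Y.
Hypothesis hdeg : degree Y S = 4%N.
Hypothesis hg : riemannian_metric g.
Hypothesis hg' : graded_metric g.
Variables (p v : E) (W : set P) (Phi : P -> E).
Hypothesis gc : graph_chart S W Phi (acoord g v) p.
Hypothesis W0 : W 0.
Hypothesis Phi0 : Phi 0 = p.
Hypothesis v2 : v.:[2] = 0.
Hypothesis a0 : triv p (d1 Phi 0) = v.

Definition recenter (Phi : P -> E) p z := engel_mul (- p) (Phi z).

Lemma recenter_coord z : W z ->
  inner (g 0) (recenter Phi p z) v = z.1 /\ kap g * (recenter Phi p z).:[3] = z.2.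
Proof.
have gen (x : E) z' : gcoord (acoord g v) p x = z' ->
    inner (g 0) (engel_mul (- p) x) v = z'.1 /\ kap g * (engel_mul (- p) x).:[3] = z'.2.
  by move=> <-; rewrite /gcoord prj_acoord (inner_ev hg hg').
by move=> Wz; apply: gen; exact: gc.2.
Qed.

(** The hypothesis on the degree of the whole surface, not only at p, provides
    the contact equation at all points of the chart. *)
Theorem contact_order : exists2 C, 0 <= C & forall e, 0 < e -> exists2 r, 0 < r &
  forall z, `|z| < r -> [/\ W z,
     forall i, `|recenter Phi p z 0 i - z.1 * v 0 i| <= e * `|z.1| + C * `|z.2| &
     `|(recenter Phi p z).:[2]| <= e * z.1 ^+ 2 + C * `|z.2| ].
Proof.
have kn0 : kap g != 0 by rewrite gt_eqF// kap_gt0.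
pose a z := dleft (- p) (Phi z) (d1 Phi z).
pose b z := dleft (- p) (Phi z) (d2 Phi z).
have deriv z : W z -> (a z).:[3] = 0 /\ (b z).:[3] = (kap g)^-1.
  have gen (u w : E) : prj (acoord g v) u = (1, 0) -> prj (acoord g v) w = (0, 1) ->
      u.:[3] = 0 /\ w.:[3] = (kap g)^-1.
    rewrite !prj_acoord !(inner_ev hg hg') => -[_ h1] -[_ h2]; split.
      by apply: (mulfI kn0); rewrite h1 mulr0.
    by apply: (mulfI kn0); rewrite h2 mulfV.
  by move=> Wz; have [h1 h2] := graph_chart_deriv gc Wz; exact: gen h1 h2.
have sf z : W z -> sdiff (recenter Phi p) z (a z) (b z).
  by move=> Wz; apply: sdiff_engel_mul; exact: chart_sdiff gc.1 Wz.
have f0 : recenter Phi p 0 = 0 by rewrite /recenter Phi0 engel_mulVx.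
have a0' : a 0 = v.
  have gen x u : x = p -> triv p u = v -> dleft (- p) x u = v by move=> -> <-; exact: dleftV.
  exact: gen Phi0 a0.
have b03 : (b 0).:[3] != 0 by rewrite (deriv 0 W0).2 invr_eq0.
have contact z : W z ->
    (triv (recenter Phi p z) (a z)).:[2] * (triv (recenter Phi p z) (b z)).:[3] =
    (triv (recenter Phi p z) (a z)).:[3] * (triv (recenter Phi p z) (b z)).:[2].
  have gen (x u w : E) : wedge (triv x u) (triv x w) (inord 2) (inord 3) = 0 ->
    (triv (engel_mul (- p) x) (dleft (- p) x u)).:[2] *
    (triv (engel_mul (- p) x) (dleft (- p) x w)).:[3] =
    (triv (engel_mul (- p) x) (dleft (- p) x u)).:[3] *
    (triv (engel_mul (- p) x) (dleft (- p) x w)).:[2].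
    rewrite !triv_dleft wedgeE => /eqP; rewrite subr_eq0 => /eqP ->.
    by rewrite mulrC.
  move=> Wz; apply: gen.
  have Sz : S (Phi z) := chart_sub gc.1 Wz.
  have h4 : (pdegree Y S (Phi z) <= 4)%N by rewrite -hdeg pdegree_le_degree.
  have /matrixP/(_ (inord 2) (inord 3)) := om_degree5 gc hY Wz h4.
  by rewrite [LHS]mxE [RHS]mxE /deg !inordK.
exact: second_order (chart_open gc.1) W0 sf f0 a0' v2 (fun z Wz => (deriv z Wz).1) b03 contact.
Qed.
End ContactOrder.

(** * Balls of a homogeneous distance *)

Section HomogeneousBalls.
Context {R : realType}.
Local Notation E := 'rV[R]_4.
Variable d : E -> E -> R.
Hypothesis hd : homogeneous_distance d.

Lemma hdist_left p x y : d p x <= y <-> d 0 (engel_mul (- p) x) <= y.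
Proof. by rewrite -{1}(hdist_left_invariant hd (- p)) engel_mulVx. Qed.

Lemma hdist_leftE p x : d (engel_mul p x) p = d x 0.
Proof. by rewrite -{2}(engel_mulx0 p) hdist_left_invariant. Qed.

Lemma hdist_cont2 (T : topologicalType) (f g : T -> E) :
  continuous f -> continuous g -> continuous (fun t => d (f t) (g t)).
Proof.
move=> cf cg t.
apply: (@continuous_comp _ _ _ (fun t => (f t, g t)) (fun xy : E * E => d xy.1 xy.2)).
  exact: cvg_pair (cf t) (cg t).
exact: hdist_continuous hd _.
Qed.

Lemma hdist_contr x : continuous (d x).
Proof. by apply: (@hdist_cont2 E (fun=> x) id); [exact: cst_continuous|move=> t; exact: cvg_id]. Qed.

Lemma closed_ball_closed x r : closed (closed_ball_of d x r).
Proof.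
have -> : closed_ball_of d x r = d x @^-1` [set t | t <= r] by [].
by apply: preimage_closed; [move=> t _; exact: hdist_contr|exact: closed_le].
Qed.

Lemma dilation_norm_le (r : R) (x : E) : 0 <= r -> `|dilation r x| <= Num.max 1 r ^+ 3 * `|x|.
Proof.
move=> r0; have h1 : 1 <= Num.max 1 r by rewrite le_max lexx.
have hr : r <= Num.max 1 r by rewrite le_max lexx orbT.
set m := Num.max 1 r in h1 hr *.
have m0 : 0 <= m by exact: le_trans hr.
apply: rV_norm_le => [|i]; first by rewrite mulr_ge0// exprn_ge0.
have hx := rV_norm_ge x i; rewrite mxE normrM ler_pM// normrX ger0_norm//.
have d3 : (deg i <= 3)%N by rewrite /deg; case: i {hx} => -[|[|[|[|//]]]].
apply: (@le_trans _ _ (m ^+ deg i)); first by rewrite lerXn2r ?nnegrE.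
by rewrite ler_weXn2l.
Qed.

Lemma half_dilation_norm (x : E) : `|x| / 8 <= `|dilation 2^-1 x| <= `|x| / 2.
Proof.
apply/andP; split.
  have := dilation_norm_le (dilation 2^-1 x) (ler0n R 2).
  rewrite dilationVK// (_ : Num.max 1 2 = 2); last by rewrite /Num.max ltr1n.
  by rewrite -natrX ler_pdivrMr// mulrC.
apply: rV_norm_le => [|i]; first by rewrite divr_ge0.
have hx := rV_norm_ge x i; rewrite mxE normrM mulrC ler_pM// normrX ger0_norm//.
by rewrite ler_iXnr//= ?invr_ge0// ?invf_le1 ?ler1n// /deg; case: i {hx} => -[|[|[|[|//]]]].
Qed.

(** A halving divides the norm by at most 8, so repeated halvings of a point
    outside the unit ball end in the shell 1 <= |y| <= 8. *)
Lemma normalize_dilation (x : E) : 1 <= `|x| ->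
  exists2 c, 0 < c <= 1 & 1 <= `|dilation c x| <= 8.
Proof.
have [n] : exists n : nat, `|x| <= 8 * 2 ^+ n.
  have hn : `|x| <= (Num.bound `|x|)%:R by exact/ltW/archi_boundP.
  exists (Num.bound `|x|); rewrite (le_trans hn)// -natrX -natrM ler_nat.
  by rewrite (leq_trans (ltnW (ltn_expl _ (isT : 1 < 2)%N)))// leq_pmull.
elim: n x => [|n IH] x xn x1.
  by exists 1; rewrite ?lexx ?ltr01// dilation1 x1 (le_trans xn)// mulr1.
have [x8|x8] := leP `|x| 8; first by exists 1; rewrite ?lexx ?ltr01// dilation1 x1 x8.
have /andP[h1 h2] := half_dilation_norm x.
have [| |c /andP[c0 c1] hc] := IH (dilation 2^-1 x).
- by rewrite (le_trans h2)// ler_pdivrMr// -mulrA -exprSr.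
- by rewrite (le_trans _ h1)// ler_pdivlMr// mul1r ltW.
- rewrite dilation_comp in hc; exists (c * 2^-1) => //.
  by apply/andP; split; [rewrite divr_gt0|lra].
Qed.

(** The distance to 0 has a positive minimum m on the shell of
    [normalize_dilation], so that a point at distance at most 1 is reached from
    the shell by a dilation of factor at most 1 / m. *)
Lemma unit_ball_bounded : exists2 M, 0 < M & forall x, d 0 x <= 1 -> `|x| <= M.
Proof.
pose K : set E := [set x | 1 <= `|x| <= 8].
have cK : compact K.
  apply: bounded_closed_compact.
    by exists 8; split=> // y y8 x /andP[_ /le_trans]; apply; exact: ltW.
  have -> : K = [set x | 1 <= `|x|] `&` [set x | `|x| <= 8].
    by apply/seteqP; split=> x /= => [/andP|[? ?]] //; apply/andP.
  apply: closedI.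
    have -> : [set x : E | 1 <= `|x|] = Num.norm @^-1` [set t : R | 1 <= t] by [].
    by apply: preimage_closed; [move=> ? _; exact: norm_continuous|exact: closed_ge].
  have -> : [set x : E | `|x| <= 8] = Num.norm @^-1` [set t : R | t <= 8] by [].
  by apply: preimage_closed; [move=> ? _; exact: norm_continuous|exact: closed_le].
have [m m0 hm] : exists2 m, 0 < m & forall x, K x -> m <= d 0 x.
  have [K0|/nonemptyPn K0] := pselect (K !=set0); last first.
    by exists 1 => // x Kx; exfalso; have : set0 x by rewrite -K0.
  have [|c cK' hc] := compact_EVT_min K0 cK (f := d 0).
    by apply: continuous_subspaceT => t; exact: hdist_contr.
  exists (d 0 c) => [|x Kx]; last by apply: hc; rewrite inE.
  rewrite lt_neqAle hdist_ge0// andbT eq_sym; apply/eqP => /(hdist_eq0 hd) c0.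
  by move: cK'; rewrite inE /K /= -c0 normr0 ler10.
exists (8 * Num.max 1 m^-1 ^+ 3) => [|x x1].
  by rewrite mulr_gt0// exprn_gt0// lt_max ltr01.
have m1 : 1 <= Num.max 1 m^-1 by rewrite le_max lexx.
have [/normalize_dilation[c /andP[c0 c1] hc]|xl] := leP 1 `|x|; last first.
  by rewrite (le_trans (ltW xl))// (le_trans (_ : 1 <= 8))// ?ler1n// ler_peMr// exprn_ege1.
have cm : m <= c.
  have := hm _ hc; rewrite -{1}(dilation0 c) (hdist_dilation hd)// => /le_trans; apply.
  by rewrite ler_piMr// ltW.
rewrite -(dilationK x (_ : c != 0)) ?gt_eqF//.
apply: (le_trans (dilation_norm_le _ _)); first by rewrite invr_ge0 ltW.
rewrite mulrC ler_pM// ?exprn_ge0// ?le_max ?ler01//; first by case/andP: hc.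
rewrite lerXn2r// ?nnegrE ?le_max ?ler01//.
have cm' : c^-1 <= Num.max 1 m^-1 by rewrite le_max lef_pV2 ?posrE// cm orbT.
by rewrite -le_max ge_max m1 cm'.
Qed.

Lemma hball_bounded r : 0 <= r -> exists2 M, 0 < M & forall x, d 0 x <= r -> `|x| <= M.
Proof.
move=> r0; have [M M0 hM] := unit_ball_bounded.
exists (Num.max 1 (1 + r) ^+ 3 * M) => [|x xr]; first by rewrite mulr_gt0// exprn_gt0// lt_max ltr01.
have r10 : 0 < 1 + r by rewrite ltr_pwDl.
rewrite -(dilationVK x (_ : 1 + r != 0)) ?gt_eqF//.
apply: (le_trans (dilation_norm_le _ (ltW r10))); rewrite ler_wpM2l ?exprn_ge0 ?le_max ?ler01//.
apply: hM; rewrite -{1}(dilation0 (1 + r)^-1) (hdist_dilation hd) ?invr_gt0//.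
by rewrite mulrC ler_pdivrMr// mul1r (le_trans xr)// lerDr.
Qed.

Lemma hball_compact x r : compact (closed_ball_of d x r).
Proof.
have [r0|r0] := ltP r 0.
  rewrite (_ : closed_ball_of d x r = set0); first exact: compact0.
  by rewrite -subset0 => y /= /(le_trans (hdist_ge0 hd x y)); rewrite leNgt r0.
apply: bounded_closed_compact; last exact: closed_ball_closed.
have [M M0 hM] : exists2 M, 0 < M & forall y, d 0 y <= r + d 0 x -> `|y| <= M.
  by apply: hball_bounded; rewrite addr_ge0// hdist_ge0.
exists M; split; first exact: num_real.
move=> m Mm y yr; rewrite /= (le_trans _ (ltW Mm))//; apply: hM.
by rewrite (le_trans (hdist_triangle hd _ x _))// addrC lerD2r.
Qed.

Lemma hdist_small (e : R) : 0 < e -> exists2 r, 0 < r & forall x, d 0 x <= r -> `|x| < e.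
Proof.
move=> e0; have [M M0 hM] := unit_ball_bounded.
pose r := Num.min 1 (e / 2 / M).
have r0 : 0 < r by rewrite lt_min ltr01 !divr_gt0.
exists r => // x xr.
have h : `|dilation r^-1 x| <= M.
  apply: hM; rewrite -{1}(dilation0 r^-1) (hdist_dilation hd) ?invr_gt0//.
  by rewrite mulrC ler_pdivrMr// mul1r.
have rM : r * M < e.
  apply: (@le_lt_trans _ _ (e / 2)); last lra.
  by rewrite -ler_pdivlMr// ge_min lexx orbT.
apply: le_lt_trans rM; rewrite -(dilationVK x (_ : r != 0)) ?gt_eqF//.
apply: rV_norm_le => [|i]; first by rewrite mulr_ge0// ltW.
have hx := le_trans (rV_norm_ge _ i) h.
have r1 : r <= 1 by rewrite ge_min lexx.
have di : (0 < deg i)%N by rewrite /deg; case: i {hx} => -[|[|[|[|//]]]].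
by rewrite mxE normrM ler_pM// normrX (gtr0_norm r0) ler_iXnr// (ltW r0).
Qed.

Lemma bracket_cont (T : topologicalType) (a b : T -> E) : continuous a -> continuous b ->
  continuous (fun t => bracket (a t) (b t)).
Proof.
move=> ca cb t; have A i : {for t, continuous (fun t => a t 0 i)} := cont_coord (ca t).
have B i : {for t, continuous (fun t => b t 0 i)} := cont_coord (cb t).
apply: cvgD.
  apply: cvgZ; last exact: cvg_cst.
  apply: cvgB; apply: cvgM; [exact: A|exact: B|exact: A|exact: B].
apply: cvgZ; last exact: cvg_cst.
by apply: cvgB; apply: cvgM; [exact: A|exact: B|exact: A|exact: B].
Qed.

Lemma engel_mul_cont (p : E) : continuous (engel_mul p).
Proof.
have ci : continuous (fun x : E => x) by move=> x; exact: cvg_id.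
have cc : continuous (fun x : E => p) by exact: cst_continuous.
have b1 := bracket_cont cc ci; have b2 := bracket_cont ci cc.
have b3 := bracket_cont cc b1; have b4 := bracket_cont ci b2.
move=> x; exact: cvgD (cvgD (cvgD (cc x) (ci x)) (cvgZ (cvg_cst _) (b1 x)))
  (cvgZ (cvg_cst _) (cvgD (b3 x) (b4 x))).
Qed.

Lemma hball_open_sub (U : set E) p : open U -> U p ->
  exists2 r, 0 < r & closed_ball_of d p r `<=` U.
Proof.
move=> oU Up.
have : nbhs (0 : E) (engel_mul p @^-1` U).
  by apply: engel_mul_cont; rewrite engel_mulx0; exact: open_nbhs_nbhs.
move=> /nbhs_normE[s s0 hs]; have [r r0 hr] := hdist_small s0.
exists r => // x /(hdist_left p x r) /hr xs.
by rewrite -(engel_mulVK p x); apply: hs; rewrite subr0.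
Qed.

Definition e1 : E := row4 1 0 0 0.

(** For horizontal h one has h h = 2 h, a dilation of h by 2; so x h and x h^-1
    are at distance 2 r when h is at distance r from 0. *)
Lemma diam_hball x r : 0 < r -> diam d (closed_ball_of d x r) = (2 * r)%:E.
Proof.
move=> r0; apply/eqP; rewrite eq_le; apply/andP; split.
  apply: ge_ereal_sup => _ [y [z [yr zr ->]]]; rewrite lee_fin.
  rewrite (le_trans (hdist_triangle hd _ x _))// (hdist_sym hd) mulr_natl mulr2n.
  exact: lerD.
have n0 : 0 < d 0 e1.
  rewrite lt_neqAle hdist_ge0// andbT eq_sym; apply/eqP => /(hdist_eq0 hd) /rowP/(_ (inord 0)).
  by rewrite row4E mxE => /eqP; rewrite eq_sym oner_eq0.
pose h := dilation (r / d 0 e1) e1.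
have h2 : h.:[2] = 0 by rewrite /h dilationE !row4E mulr0.
have h3 : h.:[3] = 0 by rewrite /h dilationE !row4E mulr0.
have hr : d 0 h = r.
  by rewrite -(dilation0 (r / d 0 e1)) (hdist_dilation hd) ?divr_gt0// mulfVK// gt_eqF.
have hN : d 0 (- h) = r.
  rewrite -(hdist_left_invariant hd h) engel_mulx0 -{2}(opprK h) engel_mulVx.
  by rewrite (hdist_sym hd).
have hh : d (- h) h = 2 * r.
  rewrite -(hdist_left_invariant hd h) -{1}(opprK h) engel_mulVx engel_mulxx//.
  rewrite -hr -(hdist_dilation hd)// dilation0; congr d.
  by apply: row4P; rewrite dilationE !row4E !coordE ?h2 ?h3; ring.
apply: ereal_sup_ubound; exists (engel_mul x (- h)), (engel_mul x h).
rewrite /closed_ball_of /= (hdist_left_invariant hd) hh; split=> //.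
  by apply/hdist_left; rewrite engel_mulKV hN.
by apply/hdist_left; rewrite engel_mulKV hr.
Qed.

Lemma hball_rescale p u r y : 0 < r ->
  closed_ball_of d (engel_mul p (dilation r u)) r y <->
  d u (dilation r^-1 (engel_mul (- p) y)) <= 1.
Proof.
move=> r0; rewrite /closed_ball_of /= -(hdist_left_invariant hd (- p)) engel_mulKV.
set z := engel_mul _ y; rewrite -{1}(dilationVK z (_ : r != 0)) ?gt_eqF//.
by rewrite (hdist_dilation hd)// -[X in _ <= X <-> _](mulr1 r) ler_pM2l.
Qed.

(** On bounded sets the coordinates of x^-1 y are O(|y - x|), and the distance
    to 0 is continuous. *)
Lemma hdist_unif (M e : R) : 0 < M -> 0 < e -> exists2 t, 0 < t &
  forall x y : E, `|x| <= M -> `|y| <= M -> (forall i, `|y 0 i - x 0 i| <= t) -> d x y <= e.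
Proof.
move=> M0 e0.
have := @hdist_contr 0 0; move=> /cvgrPdist_le/(_ e e0)/nbhs_normE[s s0 hs].
have {}hs w : `|w| < s -> d 0 w <= e.
  move=> ws; have := hs w; rewrite subr0 => /(_ ws).
  by rewrite (iffRL (hdist_eq0 hd 0 0))// sub0r normrN ger0_norm// hdist_ge0.
pose K := 1 + M + M + M * M; have K0 : 0 < K by rewrite !addr_gt0// mulr_gt0.
have M1 : 1 <= K by rewrite /K -!addrA lerDl !addr_ge0// ?ltW// mulr_gt0.
exists (s / 2 / K) => [|x y xM yM h]; first by rewrite !divr_gt0.
set t := s / 2 / K in h.
have t0 : 0 < t by rewrite !divr_gt0.
apply: (iffRL (hdist_left x y e)); apply: hs.
apply: (@le_lt_trans _ _ (K * t)); last by rewrite /t mulrC mulfVK ?gt_eqF//; lra.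
have X i := le_trans (rV_norm_ge x i) xM; have Y i := le_trans (rV_norm_ge y i) yM.
set h0 := y.:[0] - x.:[0]; set h1 := y.:[1] - x.:[1].
set h2 := y.:[2] - x.:[2]; set h3 := y.:[3] - x.:[3].
have H0 : `|h0| <= t by exact: h. have H1 : `|h1| <= t by exact: h.
have H2 : `|h2| <= t by exact: h. have H3 : `|h3| <= t by exact: h.
pose ar := x.:[0] * h1 - x.:[1] * h0.
have Har : `|ar| <= M * t + M * t by apply: normB_le; apply: normM_le.
have N2 : `|2^-1 : R| <= 2^-1 by rewrite ger0_norm// invr_ge0.
have N12 : `|12^-1 : R| <= 12^-1 by rewrite ger0_norm// invr_ge0.
have tK : t <= K * t by rewrite ler_peMl// ltW.
have Mt : 0 <= M * t by rewrite mulr_ge0// ltW.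
have MMt : 0 <= M * M * t by exact: mulr_ge0 (mulr_ge0 (ltW M0) (ltW M0)) (ltW t0).
have KE : K * t = t + M * t + M * t + M * M * t by rewrite /K; ring.
apply: rV_norm_le => [|i]; first exact: mulr_ge0 (ltW K0) (ltW t0).
rewrite mulE; elim/ord4P: i; rewrite row4E !coordN ?/area ?coordN.
- by rewrite addrC; apply: le_trans tK.
- by rewrite addrC; apply: le_trans tK.
- rewrite (_ : _ + _ = h2 + 2^-1 * - ar); last by rewrite /h2 /ar /h0 /h1; ring.
  have HarN : `|- ar| <= M * t + M * t by rewrite normrN.
  apply: le_trans (normD_le H2 (normM_le N2 HarN)) _.
  by rewrite KE; lra.
- rewrite (_ : _ + _ = h3 + (2^-1 * (x.:[2] * h0 - x.:[0] * h2) + 12^-1 * ((x.:[0] + y.:[0]) * ar))); last first.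
    by rewrite /h3 /h2 /ar /h0 /h1; ring.
  have A1 : `|x.:[2] * h0 - x.:[0] * h2| <= M * t + M * t by apply: normB_le; apply: normM_le.
  have A2 : `|(x.:[0] + y.:[0]) * ar| <= (M + M) * (M * t + M * t) by apply: normM_le => //; exact: normD_le.
  apply: le_trans (normD_le H3 (normD_le (normM_le N2 A1) (normM_le N12 A2))) _.
  rewrite KE.
  have ME : (M + M) * (M * t + M * t) = 4 * (M * M * t) by ring.
  lra.
Qed.

End HomogeneousBalls.

(** * Sections of balls by the homogeneous tangent plane, and blow-up *)

Section Strips.
Context {R : realType}.
Local Notation P := (R * R)%type.
Local Notation E := 'rV[R]_4.
Local Notation Pm := (measurableTypeR R * measurableTypeR R)%type.
Local Notation L2 := ((@lebesgue_measure R) \x (@lebesgue_measure R))%E.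
Variable d : E -> E -> R.
Hypothesis hd : homogeneous_distance d.
Variables (v e : E) (c0 c1 k : R).
Hypothesis v2 : v.:[2] = 0.
Hypothesis v3 : v.:[3] = 0.
Hypothesis cv : c0 * v.:[0] + c1 * v.:[1] = 1.
Hypothesis k0 : 0 < k.
Hypothesis e_0 : e.:[0] = 0.
Hypothesis e_1 : e.:[1] = 0.
Hypothesis e_2 : e.:[2] = 0.
Hypothesis e_3 : e.:[3] = k^-1.

Definition plane (z : P) : E := z.1 *: v + z.2 *: e.

(** The action of the dilations on the parameters of the plane. *)
Definition aniso (r : R) (z : P) : P := (r * z.1, r ^+ 3 * z.2).

Lemma dilation_plane r z : dilation r (plane z) = plane (aniso r z).
Proof.
apply: row4P; rewrite dilationE row4E /plane /aniso !coordE ?v2 ?v3 ?e_0 ?e_1 ?e_2 ?e_3 /=; ring.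
Qed.

Lemma plane_cont : continuous plane.
Proof.
have cst1 (w : E) : continuous ((fun=> w) : P -> E) by exact: cst_continuous.
move=> z; exact: cvgD (cvgZ (@cvg_fst _ _ (nbhs z.1) (nbhs z.2) _) (cst1 v z)) (cvgZ (@cvg_snd _ _ (nbhs z.1) (nbhs z.2) _) (cst1 e z)).
Qed.

(** The section of a ball by the plane, in parameters. *)
Definition strip u (l : R) : set P := [set z | d u (plane z) <= l].

Lemma strip_closed u l : closed (strip u l).
Proof.
have -> : strip u l = plane @^-1` closed_ball_of d u l by [].
by apply: preimage_closed; [move=> z _; exact: plane_cont|exact: closed_ball_closed].
Qed.

Lemma measurable_strip u l : measurable (strip u l : set Pm).
Proof. by apply: closed_measurable2; exact: strip_closed. Qed.

(** Any map whose coordinates determine the parameters in the same way as for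
    the plane has bounded parameters over a bounded set. *)
Lemma param_bounded : exists2 M, 0 < M & forall (u x : E) (z : P), d u 0 <= 1 -> d u x <= 2 ->
  c0 * x.:[0] + c1 * x.:[1] = z.1 -> k * x.:[3] = z.2 -> `|x| <= M /\ `|z| <= M.
Proof.
have [M M0 hM] : exists2 M, 0 < M & forall x, d 0 x <= 3 -> `|x| <= M by exact: hball_bounded.
exists (M + (`|c0| * M + `|c1| * M) + k * M) => [|u x z u1 ux h1 h2].
  by rewrite ltr_wpDr ?mulr_ge0 ?ltW// ltr_wpDr// addr_ge0// mulr_ge0// ltW.
have M0' := ltW M0.
have ci : 0 <= `|c0| * M + `|c1| * M by rewrite addr_ge0// mulr_ge0.
have kM : 0 <= k * M by exact: mulr_ge0 (ltW k0) _.
have xM : `|x| <= M.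
  apply: hM; rewrite (le_trans (hdist_triangle hd _ u _))// (hdist_sym hd 0).
  by rewrite (le_trans (lerD u1 ux))//; lra.
split; first by rewrite (le_trans xM)// -addrA lerDl addr_ge0.
have X i := le_trans (rV_norm_ge x i) xM.
rewrite prod_norm_le -h1 -h2; apply/andP; split.
  apply: (le_trans (ler_normD _ _)); rewrite !normrM.
  have : `|c0| * `|x.:[0]| <= `|c0| * M by exact: ler_wpM2l.
  have : `|c1| * `|x.:[1]| <= `|c1| * M by exact: ler_wpM2l.
  lra.
rewrite normrM (gtr0_norm k0).
have : k * `|x.:[3]| <= k * M by rewrite ler_pM2l.
lra.
Qed.

Lemma aniso_strip u l z : 0 < l -> strip u l z <-> strip (dilation l^-1 u) 1 (aniso l^-1 z).
Proof.
move=> l0; rewrite /strip /= -dilation_plane (hdist_dilation hd) ?invr_gt0//.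
by rewrite mulrC ler_pdivrMr// mul1r.
Qed.

Lemma L2_aniso (r : R) (A : set Pm) : 0 < r -> measurable A ->
  L2 [set z | A (aniso r^-1 z)] = ((r ^+ 4)%:E * L2 A)%E.
Proof.
move=> r0 mA; rewrite (_ : r ^+ 4 = r * r ^+ 3); last by rewrite -exprS.
rewrite -L2_scale ?exprn_gt0//; congr (L2 _); apply/seteqP; split=> z;
by rewrite /aniso /= exprVn !(mulrC _^-1).
Qed.

Lemma L2_strip u l : 0 < l -> L2 (strip u l) = ((l ^+ 4)%:E * L2 (strip (dilation l^-1 u) 1))%E.
Proof.
move=> l0; rewrite -L2_aniso//; last exact: measurable_strip.
by congr (L2 _); apply/seteqP; split=> z h; [exact: (iffLR (aniso_strip u z l0) h)|exact: (iffRL (aniso_strip u z l0) h)].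
Qed.

Lemma strip_bounded : exists2 M, 0 < M & forall u l z, d u 0 <= 1 -> l <= 2 -> strip u l z -> `|z| <= M.
Proof.
have [M M0 hM] := param_bounded; exists M => // u l z u1 l2 uz.
have [| | | _ //] := hM u (plane z) z u1.
- exact: le_trans uz l2.
- rewrite /plane !coordE e_0 e_1 !mulr0 !addr0 /=.
  by rewrite -[RHS]mulr1 -cv; ring.
- by rewrite /plane !coordE e_3 v3 mulr0 add0r mulrCA mulfV ?mulr1// gt_eqF.
Qed.

Lemma L2_strip_fin u l : d u 0 <= 1 -> l <= 2 -> (L2 (strip u l) < +oo)%E.
Proof.
move=> u1 l2; have [M _ hM] := strip_bounded.
by apply: (@L2_bounded _ _ M); [exact: measurable_strip|move=> z; exact: hM].
Qed.

(** A ball centred near u lies in a slightly larger ball centred at u, and the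
    sections of the latter decrease to that of the unit ball. *)
Lemma strip_usc u (eps : R) : d u 0 <= 1 -> 0 < eps -> exists2 t, 0 < t &
  forall u', d u u' <= t -> (L2 (strip u' 1) <= L2 (strip u 1) + eps%:E)%E.
Proof.
move=> u1 eps0.
pose F n := strip u (1 + mesh n) : set Pm.
have F0 : (L2 (F 0%N) < +oo)%E by apply: L2_strip_fin => //; rewrite /mesh invr1.
have Fle : {homo F : n m / (n <= m)%N >-> m `<=` n}.
  move=> n m nm z /le_trans; apply; rewrite lerD2l lef_pV2 ?posrE ?ltr0n// ler_nat ltnS.
  exact: nm.
have Fcap : \bigcap_n F n = strip u 1.
  apply/seteqP; split=> z.
    move=> h; rewrite /strip /= leNgt; apply/negP => lt1.
    have du : 0 < d u (plane z) - 1 by rewrite subr_gt0.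
    have [n hn] := mesh_lt du.
    have := h n I; rewrite /F /strip /= leNgt => /negP; apply.
    by rewrite -ltrBrDl.
  by move=> h n _; apply: (le_trans h); rewrite lerDl ltW// mesh_gt0.
have [n hn] := decreasing_measure_le eps0 F0 (fun n => measurable_strip _ _) Fle.
rewrite Fcap in hn.
exists (mesh n); first exact: mesh_gt0.
move=> u' uu'; apply: le_trans hn; apply: le_measure; rewrite ?inE; [exact: measurable_strip..|].
move=> z u'z; apply: (le_trans (hdist_triangle hd _ u' _)).
by rewrite addrC lerD.
Qed.

(** By upper semicontinuity, any cluster point of a maximizing sequence is a
    maximizer. *)
Theorem strip_max : exists2 u0, d u0 0 <= 1 &
  forall u, d u 0 <= 1 -> (L2 (strip u 1) <= L2 (strip u0 1))%E.
Proof.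
pose K : set E := [set u | d u 0 <= 1].
have KE : K = closed_ball_of d 0 1 by apply/seteqP; split=> u; rewrite /K /closed_ball_of /= hdist_sym.
have cK : compact K by rewrite KE; exact: hball_compact.
pose m u := fine (L2 (strip u 1)).
have mE u : K u -> L2 (strip u 1) = (m u)%:E.
  move=> Ku; rewrite /m fineK// ge0_fin_numE//; apply: L2_strip_fin => //; lra.
have K0 : K 0 by rewrite /K /= (iffRL (hdist_eq0 hd 0 0)).
have [M _ hM] := strip_bounded.
have bnd : has_sup [set m u | u in K].
  split; first by exists (m 0), 0.
  exists (fine (L2 [set z : P | `|z| <= M])) => _ [u Ku <-].
  have mM : measurable ([set z : P | `|z| <= M] : set Pm).
    apply: closed_measurable2.
    have -> : [set z : P | `|z| <= M] = Num.norm @^-1` [set t : R | t <= M] by [].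
    by apply: preimage_closed; [move=> ? _; exact: norm_continuous|exact: closed_le].
  have fM : (L2 [set z : P | (`|z| <= M)%R] < +oo)%E by apply: (@L2_bounded _ _ M).
  rewrite -lee_fin -mE// fineK ?ge0_fin_numE//; apply: le_measure; rewrite ?inE//.
    exact: measurable_strip.
  by move=> z zs; apply: (hM u 1) => //; lra.
set s := sup [set m u | u in K].
have ex n : exists u, K u /\ s - mesh n < m u.
  by have [_ [u Ku <-] hu] := sup_adherent (mesh_gt0 n) bnd; exists u.
have [un hun] := choice ex.
have [|u0 [Ku0 clu0]] := cK (un @ \oo) _.
  by exists 0%N => // n _; exact: (hun n).1.
exists u0 => // u Ku; rewrite !mE// lee_fin.
have ms : m u <= s by apply: sup_upper_bound => //; exists u.
apply: (le_trans ms); apply/ler_addgt0Pr => eps eps0.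
have eps20 : 0 < eps / 2 by rewrite divr_gt0.
have [t t0 ht] := strip_usc Ku0 eps20; have [n0 hn0] := mesh_lt eps20.
have nU : nbhs u0 [set u' | d u0 u' <= t].
  have := @hdist_contr _ _ hd u0 u0; move=> /cvgrPdist_le/(_ t t0); apply: filterS => u' /=.
  by rewrite (iffRL (hdist_eq0 hd u0 u0))// sub0r normrN ger0_norm// hdist_ge0.
have nN : (un @ \oo) [set un n | n in [set n | (n0 <= n)%N]].
  by exists n0 => // n n0n; exists n.
have [_ [[n /= n0n <-] hn]] := clu0 _ _ nN nU.
have [Kn hs] := hun n.
have := ht _ hn; rewrite !mE// -EFinD lee_fin => h.
have mm : mesh n <= mesh n0 :> R by rewrite lef_pV2 ?posrE ?ltr0n// ler_nat ltnS.
lra.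
Qed.

(* A parametrized surface through 0, to be compared with the plane. *)
Variables (W : set P) (f : P -> E).
Hypothesis f1 : forall z, W z -> c0 * (f z).:[0] + c1 * (f z).:[1] = z.1.
Hypothesis f3 : forall z, W z -> k * (f z).:[3] = z.2.
Variable C : R.
Hypothesis C0 : 0 <= C.
Hypothesis contact : forall eps, 0 < eps -> exists2 r, 0 < r &
  forall z, `|z| < r -> [/\ W z,
     forall i, `|f z 0 i - z.1 * v 0 i| <= eps * `|z.1| + C * `|z.2| &
     `|(f z).:[2]| <= eps * z.1 ^+ 2 + C * `|z.2| ].

Lemma aniso_norm r z : 0 < r <= 1 -> `|aniso r z| <= r * `|z|.
Proof.
move=> /andP[r0 r1]; have r0' := ltW r0.
have r3 : r ^+ 3 <= r by rewrite ler_iXnr.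
have r30 : 0 <= r ^+ 3 by rewrite exprn_ge0.
rewrite prod_norm_le /aniso /= (normrM r) (normrM (r ^+ 3)) (gtr0_norm r0) (ger0_norm r30).
apply/andP; split; first by rewrite ler_pM2l// norm_fst_le.
by rewrite ler_pM// norm_snd_le.
Qed.

(** Rescaling divides the coordinate of degree i by r^i. At the parameters
    (r z_1, r^3 z_2) the first layer has error o(r) + O(r^3), the second one
    o(r^2) + O(r^3), and the coordinate along X_4 is exact. *)
Lemma blowup_close (M eps : R) : 0 < M -> 0 < eps -> exists2 r0, 0 < r0 <= 1 &
  forall r z, 0 < r < r0 -> `|z| <= M -> W (aniso r z) /\
    forall i, `|plane z 0 i - dilation r^-1 (f (aniso r z)) 0 i| <= eps.
Proof.
move=> M0 eps0.
pose a := eps / 2 / (1 + M + M ^+ 2).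
have M2 : 0 <= M ^+ 2 by exact: sqr_ge0.
have D0 : 0 < 1 + M + M ^+ 2 by lra.
have a0 : 0 < a by rewrite !divr_gt0.
have aM : a * M <= eps / 2.
  by rewrite /a mulrAC ler_pdivrMr// ler_pM2l//; lra.
have aM2 : a * M ^+ 2 <= eps / 2.
  by rewrite /a mulrAC ler_pdivrMr// ler_pM2l//; lra.
have [r1 r10 h1] := contact a0.
pose r0 := Num.min (Num.min 1 (r1 / M)) (eps / 2 / (C * M + 1)).
have CM0 : 0 < C * M + 1 by rewrite ltr_wpDl// mulr_ge0// ltW.
have r00 : 0 < r0 by rewrite !lt_min ltr01 !divr_gt0.
exists r0 => [|r z /andP[rp rr] zM]; first by rewrite r00 !ge_min lexx.
move: rr; rewrite !lt_min => /andP[/andP[rl1 rr1] rr2].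
have rM : r * M < r1 by rewrite -ltr_pdivlMr.
have rC : r * (C * M) <= eps / 2.
  have : r * (C * M + 1) <= eps / 2 by rewrite -ler_pdivlMr// ltW.
  by rewrite mulrDr mulr1; lra.
have r01 : 0 < r <= 1 by rewrite rp ltW.
have wr : `|aniso r z| < r1.
  by apply: (le_lt_trans (aniso_norm _ r01)); apply: le_lt_trans rM; rewrite ler_pM2l.
have [Ww hi h2] := h1 _ wr; split=> //.
have z1 : `|z.1| <= M by apply: le_trans zM; exact: norm_fst_le.
have z2 : `|z.2| <= M by apply: le_trans zM; exact: norm_snd_le.
have rn0 : r != 0 by rewrite gt_eqF.
have r3 : 0 < r ^+ 3 by rewrite exprn_gt0.
have r2 : 0 < r ^+ 2 by rewrite exprn_gt0.
have CMr : r * (C * `|z.2|) <= eps / 2.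
  by apply: le_trans rC; rewrite ler_pM2l// ler_wpM2l.
have horiz i : `|z.1 * v 0 i - r^-1 * f (aniso r z) 0 i| <= eps.
  have := hi i; rewrite /aniso /= (normrM r) (normrM (r ^+ 3)) (gtr0_norm rp) (gtr0_norm r3) => h.
  have -> : z.1 * v 0 i - r^-1 * f (aniso r z) 0 i = - (r^-1 * (f (aniso r z) 0 i - r * z.1 * v 0 i)).
    by field.
  rewrite normrN (normrM r^-1) normfV (gtr0_norm rp) mulrC ler_pdivrMr//; apply: (le_trans h).
  have : r * (a * `|z.1|) <= r * (eps / 2).
    by rewrite ler_pM2l//; apply: le_trans aM; rewrite ler_pM2l.
  have : r * (r * (r * (C * `|z.2|))) <= r * (eps / 2).
    rewrite ler_pM2l//; apply: le_trans CMr.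
    rewrite ler_piMl// ?(ltW rl1)//; exact: mulr_ge0 (ltW rp) (mulr_ge0 C0 (normr_ge0 _)).
  rewrite (_ : C * (r ^+ 3 * `|z.2|) = r * (r * (r * (C * `|z.2|)))); last by ring.
  by rewrite (_ : a * (r * `|z.1|) = r * (a * `|z.1|)); [lra|ring].
apply: ord4P; rewrite dilationE row4E /plane !coordE ?e_0 ?e_1 ?e_2 ?e_3 ?v2 ?v3.
- by rewrite mulr0 addr0; exact: horiz.
- by rewrite mulr0 addr0; exact: horiz.
- rewrite !mulr0 addr0 sub0r normrN (normrM (r^-1 ^+ 2)) exprVn normfV (gtr0_norm r2).
  rewrite mulrC ler_pdivrMr//; apply: (le_trans h2).
  rewrite /aniso /= (normrM (r ^+ 3)) (gtr0_norm r3).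
  have : r ^+ 2 * (a * z.1 ^+ 2) <= r ^+ 2 * (eps / 2).
    rewrite ler_pM2l ?exprn_gt0//; apply: le_trans aM2; rewrite ler_pM2l//.
    by rewrite -real_normK ?num_real// lerXn2r ?nnegrE// ltW.
  have : r ^+ 2 * (r * (C * `|z.2|)) <= r ^+ 2 * (eps / 2) by rewrite ler_pM2l ?exprn_gt0.
  rewrite (_ : C * (r ^+ 3 * `|z.2|) = r ^+ 2 * (r * (C * `|z.2|))); last by ring.
  by rewrite (_ : a * (r * z.1) ^+ 2 = r ^+ 2 * (a * z.1 ^+ 2)); [lra|ring].
- have -> : (f (aniso r z)).:[3] = k^-1 * (r ^+ 3 * z.2).
    by rewrite -[r ^+ 3 * z.2]/((aniso r z).2) -(f3 Ww) mulKf// gt_eqF.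
  rewrite (_ : _ - _ = 0) ?normr0 ?ltW//.
  by field; rewrite rn0 gt_eqF.
Qed.

(** By [blowup_close] the rescaled surface is within [eps] of the plane for d,
    uniformly over bounded parameters; the parameters of points in a ball are
    bounded by [param_bounded]. *)
Theorem ball_sandwich : exists2 M, 0 < M & forall eps, 0 < eps < 1 -> exists2 r0, 0 < r0 &
  forall r u, 0 < r < r0 -> d u 0 <= 1 ->
  (forall z, strip u (1 - eps) z -> W (aniso r z) /\ d u (dilation r^-1 (f (aniso r z))) <= 1) /\
  (forall z, W (aniso r z) -> d u (dilation r^-1 (f (aniso r z))) <= 1 ->
     strip u (1 + eps) z /\ `|z| <= M).
Proof.
have [M1 M10 hM1] := strip_bounded; have [M2 M20 hM2] := param_bounded.
pose M := M1 + M2; have M0 : 0 < M by rewrite addr_gt0.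
exists M => // eps /andP[eps0 eps1].
pose M' := M + (M * `|v| + M * `|e|) + 1.
have M'0 : 0 < M' by rewrite ltr_wpDl ?ltr01// !addr_ge0// ?mulr_ge0// ltW.
have [t t0 ht] := hdist_unif hd M'0 eps0.
have M'E : M + (M * `|v| + M * `|e|) + 1 = M' by [].
have v0' : 0 <= M * `|v| by rewrite mulr_ge0// ltW.
have e0' : 0 <= M * `|e| by rewrite mulr_ge0// ltW.
pose s := Num.min t 1.
have s0 : 0 < s by rewrite lt_min t0 ltr01.
have [r0 /andP[r00 _] hr0] := blowup_close M0 s0.
exists r0 => // r u rr u1.
have close z : `|z| <= M -> W (aniso r z) /\ d (plane z) (dilation r^-1 (f (aniso r z))) <= eps.
  move=> zM; have [Ww hi] := hr0 r z rr zM; split=> //.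
  have pM : `|plane z| <= M * `|v| + M * `|e|.
    rewrite (le_trans (ler_normD _ _))// !normrZ lerD// ler_wpM2r//; apply: le_trans zM;
    [exact: norm_fst_le|exact: norm_snd_le].
  rewrite (hdist_sym hd); apply: ht; last by move=> i; rewrite (le_trans (hi i))// ge_min lexx.
    rewrite -M'E; apply: (@le_trans _ _ (M * `|v| + M * `|e| + 1)); last lra.
    apply: rV_norm_le => [|i]; first by rewrite !addr_ge0.
    have := hi i; have := le_trans (rV_norm_ge (plane z) i) pM.
    set x := plane z 0 i; set y := dilation _ _ 0 i => h1 h2.
    rewrite (_ : y = x - (x - y)); last by ring.
    by rewrite (le_trans (ler_normB _ _))// lerD// (le_trans h2)// ge_min lexx orbT.
  by rewrite -M'E (le_trans pM)//; lra.
split=> z.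
  move=> uz; have [|Ww cz] := close z.
    by apply: (@le_trans _ _ M1); [apply: hM1 uz => //; lra|rewrite lerDl ltW].
  by split=> //; rewrite (le_trans (hdist_triangle hd _ (plane z) _))//; rewrite /strip /= in uz; lra.
move=> Ww uw.
have [|||_ zM2] := hM2 u (dilation r^-1 (f (aniso r z))) z u1; first lra.
- rewrite dilationE !row4E (_ : _ + _ = r^-1 * (c0 * (f (aniso r z)).:[0] + c1 * (f (aniso r z)).:[1])); last by ring.
  by rewrite f1// /aniso /= mulKf// gt_eqF//; case/andP: rr.
- rewrite dilationE !row4E mulrCA f3// /aniso /= exprVn mulKf//.
  by rewrite expf_neq0// gt_eqF//; case/andP: rr.
have zM : `|z| <= M by rewrite (le_trans zM2)// lerDr ltW.
split=> //; have [_ cz] := close z zM.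
rewrite /strip /= (le_trans (hdist_triangle hd _ (dilation r^-1 (f (aniso r z))) _))//.
by rewrite lerD// (hdist_sym hd).
Qed.

End Strips.

(** * The intrinsic measure of small balls *)

Section NonmeasurableIntegrals.
Context {R : realType} {dT : measure_display} {T : measurableType dT}.
Variable mu : {measure set T -> \bar R}.

(** The integral of a nonnegative function is a supremum over simple functions
    below it, so it is monotone without any measurability. *)
Lemma le_integral_sub (A B : set T) (f g : T -> \bar R) : A `<=` B ->
  (forall x, A x -> (0 <= f x)%E) -> (forall x, B x -> (0 <= g x)%E) ->
  (forall x, A x -> (f x <= g x)%E) ->
  (\int[mu]_(x in A) f x <= \int[mu]_(x in B) g x)%E.
Proof.
move=> AB f0 g0 fg; rewrite !ge0_integralE//.
apply: le_ereal_sup => _ [h hf <-]; exists h => // x; apply: (le_trans (hf x)).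
rewrite !patchE; case: ifPn => [|_]; last first.
  by case: ifPn => //; rewrite inE => /g0.
by rewrite inE => Ax; rewrite ifT ?inE; [exact: fg|exact: AB].
Qed.

Lemma integral_le_cst (A B : set T) (f : T -> R) (c : R) : A `<=` B -> measurable B -> 0 <= c ->
  (forall x, A x -> 0 <= f x <= c) ->
  (\int[mu]_(x in A) (f x)%:E <= c%:E * mu B)%E.
Proof.
move=> AB mB c0 h; rewrite -(integral_cst mu mB c%:E); apply: le_integral_sub => // x Ax.
- by rewrite lee_fin; case/andP: (h x Ax).
- by rewrite lee_fin; case/andP: (h x Ax).
Qed.

Lemma integral_ge_cst (A B : set T) (f : T -> R) (c : R) : B `<=` A -> measurable B -> 0 <= c ->
  (forall x, A x -> 0 <= f x) -> (forall x, B x -> c <= f x) ->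
  (c%:E * mu B <= \int[mu]_(x in A) (f x)%:E)%E.
Proof.
move=> BA mB c0 f0 h; rewrite -(integral_cst mu mB c%:E); apply: le_integral_sub => //.
Qed.

End NonmeasurableIntegrals.

Lemma compact_borel {R : realType} (K : set 'rV[R]_4) : compact K -> measurable (K : set (borelE R)).
Proof.
move=> cK; rewrite -[K]setCK; apply: measurableC; apply: sub_sigma_algebra.
by rewrite /= openC; apply: compact_closed.
Qed.

Section SmallBalls.
Context {R : realType}.
Local Notation P := (R * R)%type.
Local Notation E := 'rV[R]_4.
Local Notation Pm := (measurableTypeR R * measurableTypeR R)%type.
Local Notation L2 := ((@lebesgue_measure R) \x (@lebesgue_measure R))%E.
Variable d : E -> E -> R.
Hypothesis hd : homogeneous_distance d.
Variables (S : set E) (W : set P) (Phi : P -> E) (p v e : E) (tau : E -> R) (J : P -> R) (J0 : R).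
Hypothesis ch : chart S W Phi.
Hypothesis Phi0 : Phi 0 = p.
Hypothesis J00 : 0 < J0.
Hypothesis dens : forall e, 0 < e < 1 -> exists2 r, 0 < r & forall z, `|z| < r ->
  [/\ W z, (1 - e) * J0 <= J z <= (1 + e) * J0 & 1 - e <= tau (Phi z) * J0 <= 1 + e].
Hypothesis J_ge0 : forall z, 0 <= J z.
Hypothesis tau_ge0 : forall x, 0 <= tau x.
Variable sigma : {measure set (borelE R) -> \bar R}.
Hypothesis sigmaE : forall A : set (borelE R), measurable A -> A `<=` Phi @` W ->
    sigma A = (\int[L2]_(q in (W `&` Phi @^-1` A)) (J q)%:E)%E.
Hypothesis sandwich : exists2 M, 0 < M & forall eps, 0 < eps < 1 -> exists2 r0, 0 < r0 &
  forall r u, 0 < r < r0 -> d u 0 <= 1 ->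
  (forall z, strip d v e u (1 - eps) z -> W (aniso r z) /\
     d u (dilation r^-1 (recenter Phi p (aniso r z))) <= 1) /\
  (forall z, W (aniso r z) -> d u (dilation r^-1 (recenter Phi p (aniso r z))) <= 1 ->
     strip d v e u (1 + eps) z /\ `|z| <= M).

Lemma anisoK r : r != 0 -> cancel (aniso r^-1) (@aniso R r).
Proof.
move=> r0 z; rewrite /aniso /= exprVn !mulVKf//; last by rewrite expf_neq0.
by rewrite -surjective_pairing.
Qed.

(** The part of the surface in a small ball is the image of a compact set of
    parameters, hence a Borel set, and lies between the images of two rescaled
    strips. On it the densities of the measure are almost constant, with product
    almost 1, so its intrinsic measure is almost r^4 times the area of a strip. *)
Theorem small_ball_measure (eps : R) : 0 < eps < 1 -> exists2 r0, 0 < r0 &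
  forall r u, 0 < r < r0 -> d u 0 <= 1 ->
  let B := closed_ball_of d (engel_mul p (dilation r u)) r in
  let mu := (\int[sigma]_(x in B `&` S) (tau x)%:E)%E in
  (((1 - eps) ^+ 2 * r ^+ 4)%:E * L2 (strip d v e u (1 - eps)) <= mu)%E /\
  (mu <= ((1 + eps) ^+ 2 * r ^+ 4)%:E * L2 (strip d v e u (1 + eps)))%E.
Proof.
move=> eps01; have /andP[eps0 eps1] := eps01.
have [r1 r10 h1] := dens eps01; have [M M0 hM] := sandwich; have [r2 r20 h2] := hM _ eps01.
pose O : set P := [set z | `|z| < r1].
have oO : open O.
  have -> : O = Num.norm @^-1` [set t : R | t < r1] by [].
  by apply: open_comp; [move=> ? _; exact: norm_continuous|exact: open_lt].
have OW : O `<=` W by move=> z /h1[].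
have [U oU hU] := chart_homeo ch oO OW.
have [Sp Up] : (S `&` U) p by rewrite -hU; exists 0 => //; rewrite /O /= normr0.
have [s s0 hs] := hball_open_sub hd oU Up.
have SPhi z : W z -> S (Phi z) by exact: chart_sub ch.
pose r0 := Num.min (Num.min r2 (s / 2)) (Num.min (r1 / M) 1).
have r00 : 0 < r0 by rewrite !lt_min r20 ltr01 !divr_gt0.
exists r0 => // r u /andP[rp]; rewrite !lt_min => /andP[/andP[rr2 rs] /andP[rr1 rl1]] u1 B mu.
have rn0 : r != 0 by rewrite gt_eqF.
have r01 : 0 < r <= 1 by rewrite rp ltW.
have rr : 0 < r < r2 by rewrite rp.
have rM : r * M < r1 by rewrite -ltr_pdivlMr.
have [hin hout] := h2 r u rr u1.
have BE y : B y <-> d u (dilation r^-1 (engel_mul (- p) y)) <= 1 by exact: hball_rescale.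
have BU : B `<=` U.
  move=> y By; apply: hs; rewrite /closed_ball_of /=.
  apply: (le_trans (hdist_triangle hd _ (engel_mul p (dilation r u)) _)).
  rewrite (hdist_sym hd) hdist_leftE// -(dilation0 r) (hdist_dilation hd)//.
  have : r * d u 0 <= r by rewrite ler_piMr// ltW.
  by rewrite /B /closed_ball_of /= in By; lra.
pose Q : set P := [set w | `|w| <= r * M].
have QO : Q `<=` O by move=> w /le_lt_trans; exact.
pose T l : set P := [set w | strip d v e u l (aniso r^-1 w)].
have mT l : measurable (T l : set Pm).
  apply: closed_measurable2.
  have -> : T l = (aniso r^-1) @^-1` strip d v e u l by [].
  apply: preimage_closed; last exact: strip_closed.
  move=> z _; exact: cvg_pair (cvgM (cvg_cst _) (@cvg_fst _ _ (nbhs z.1) (nbhs z.2) _))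
    (cvgM (cvg_cst _) (@cvg_snd _ _ (nbhs z.1) (nbhs z.2) _)).
have L2T l : L2 (T l) = ((r ^+ 4)%:E * L2 (strip d v e u l))%E.
  by apply: L2_aniso => //; exact: measurable_strip.
have out w : W w -> B (Phi w) -> T (1 + eps) w /\ Q w.
  move=> Ww /BE; rewrite -{1}(anisoK rn0 w) => Bw; have := hout (aniso r^-1 w).
  rewrite /recenter (anisoK rn0) in Bw *; move=> /(_ Ww Bw)[h3 h4]; split=> //.
  rewrite /Q /= -(anisoK rn0 w); apply: (le_trans (aniso_norm _ r01)).
  by rewrite ler_pM2l.
have inn w : T (1 - eps) w -> W w /\ B (Phi w).
  by move=> /hin[]; rewrite /recenter (anisoK rn0) => Ww /BE.
have DE : W `&` Phi @^-1` (B `&` S) = [set w | W w /\ B (Phi w)].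
  by apply/seteqP; split=> w /= [Ww]; [move=> [? ?]|move=> ?; split=> //; split=> //; exact: SPhi].
have BS : B `&` S = Phi @` Q `&` B.
  apply/seteqP; split=> y [].
    move=> By Sy; split=> //; have : (S `&` U) y by split=> //; exact: BU.
    rewrite -hU => -[w Ow Pw]; exists w => //.
    by rewrite -Pw in By; have [] := out w (OW _ Ow) By.
  by move=> [w Qw <-] Bw; split=> //; apply: SPhi; exact/OW/QO.
have cQ : compact Q.
  have -> : Q = `[- (r * M), r * M]%classic `*` `[- (r * M), r * M]%classic.
    by apply/seteqP; split=> w; rewrite /Q /= prod_norm_le !ler_norml !in_itv /= => /andP.
  by apply: compact_setX; exact: segment_compact.
have mBS : measurable (B `&` S : set (borelE R)).
  apply: compact_borel; rewrite BS; apply: compact_closedI; last exact: closed_ball_closed.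
  apply: continuous_compact => //; apply: continuous_in_subspaceT => w.
  by rewrite inE => Qw; have [c _] := chart_C1 ch; exact/c/OW/QO.
have BSW : B `&` S `<=` Phi @` W.
  by rewrite BS => y [[w Qw <-] _]; exists w => //; exact/OW/QO.
have sE := sigmaE mBS BSW; rewrite DE in sE.
have J1 w : W w -> B (Phi w) -> (1 - eps) * J0 <= J w <= (1 + eps) * J0.
  by move=> Ww Bw; have [_ Qw] := out w Ww Bw; have [] := h1 w (QO _ Qw).
have tau1 x : (B `&` S) x -> (1 - eps) / J0 <= tau x <= (1 + eps) / J0.
  rewrite BS => -[[w Qw <-] _]; have [_ _] := h1 w (QO _ Qw).
  by rewrite ler_pdivrMr// ler_pdivlMr.
have sup : (sigma (B `&` S) <= ((1 + eps) * J0 * r ^+ 4)%:E * L2 (strip d v e u (1 + eps)))%E.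
  rewrite sE EFinM -muleA -L2T; apply: integral_le_cst => //.
  - by move=> w [Ww Bw]; have [] := out w Ww Bw.
  - by rewrite mulr_ge0 ?ltW// ltr_wpDl// ltW.
  - by move=> w [Ww Bw]; rewrite J_ge0; case/andP: (J1 w Ww Bw).
have inf : (((1 - eps) * J0 * r ^+ 4)%:E * L2 (strip d v e u (1 - eps)) <= sigma (B `&` S))%E.
  rewrite sE EFinM -muleA -L2T; apply: integral_ge_cst => //.
  - by rewrite mulr_ge0 ?subr_ge0 ?ltW.
  - by move=> w /inn[Ww Bw]; case/andP: (J1 w Ww Bw).
split.
  apply: (@le_trans _ _ (((1 - eps) / J0)%:E * sigma (B `&` S))%E).
    have -> : (1 - eps) ^+ 2 * r ^+ 4 = (1 - eps) / J0 * ((1 - eps) * J0 * r ^+ 4).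
      by field; rewrite gt_eqF.
    by rewrite EFinM -muleA lee_wpmul2l// lee_fin divr_ge0 ?subr_ge0 ?ltW.
  apply: integral_ge_cst => //; first by rewrite divr_ge0 ?subr_ge0 ?ltW.
  by move=> x /tau1/andP[].
apply: (@le_trans _ _ (((1 + eps) / J0)%:E * sigma (B `&` S))%E).
  apply: integral_le_cst => //; first by rewrite divr_ge0 ?ltW// ltr_wpDl// ltW.
  by move=> x /tau1/andP[_ h]; rewrite tau_ge0.
have -> : (1 + eps) ^+ 2 * r ^+ 4 = (1 + eps) / J0 * ((1 + eps) * J0 * r ^+ 4).
  by field; rewrite gt_eqF.
rewrite [((1 + eps) / J0 * _)%:E]EFinM -muleA lee_wpmul2l// lee_fin divr_ge0 ?ltW//.
by rewrite ltr_wpDl// ltW.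
Qed.

End SmallBalls.

(** * The spherical density *)

Section Limits.
Context {R : realType}.

(** The sixth power collects two factors from the densities and four from
    [L2_strip]. *)
Lemma ge_of_shrink (m : R) (s : \bar R) : 0 <= m ->
  (forall t : R, 0 < t < 1 -> (((1 - t) ^+ 6 * m)%:E <= s)%E) -> (m%:E <= s)%E.
Proof.
move=> m0 h; apply/lee_addgt0Pr => e e0.
pose t := Num.min (1 / 2) (e / (6 * m + 1)).
have D0 : 0 < 6 * m + 1 by lra.
have t0 : 0 < t by rewrite lt_min !divr_gt0.
have t1 : t <= 1 / 2 by rewrite ge_min lexx.
have te : t * (6 * m + 1) <= e by rewrite -ler_pdivlMr// ge_min lexx orbT.
clearbody t; have t01 : 0 < t < 1 by apply/andP; split; lra.
apply: (@le_trans _ _ (((1 - t) ^+ 6 * m)%:E + e%:E)%E); last by rewrite leeD2r// h.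
rewrite -EFinD lee_fin.
have b2 : 1 - 2 * t <= (1 - t) ^+ 2 by nra.
have b6 : 1 - 6 * t <= (1 - t) ^+ 6.
  rewrite (_ : (1 - t) ^+ 6 = ((1 - t) ^+ 2) ^+ 3); last by rewrite -exprM.
  have tt : 0 <= t * (1 / 2 - t) by rewrite mulr_ge0 ?subr_ge0// ltW.
  have s1 : (1 - t) ^+ 2 <= 1 by lra.
  have s0 : 0 <= (1 - t) ^+ 2 by exact: sqr_ge0.
  move: ((1 - t) ^+ 2) b2 s0 s1 => q b2 s0 s1.
  have q1 : 0 <= (1 - q) ^+ 2 by exact: sqr_ge0.
  have q2 : 0 <= q * (1 - q) ^+ 2 by rewrite mulr_ge0.
  rewrite (_ : q ^+ 3 = 3 * q - 2 + (q * (1 - q) ^+ 2 + 2 * (1 - q) ^+ 2)); last by ring.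
  lra.
nra.
Qed.

Lemma le_of_grow (m : R) (s : \bar R) : 0 <= m ->
  (forall t : R, 0 < t < 1 -> (s <= ((1 + t) ^+ 6 * m)%:E)%E) -> (s <= m%:E)%E.
Proof.
move=> m0 h; apply/lee_addgt0Pr => e e0.
pose t := Num.min (1 / 2) (e / (63 * m + 1)).
have D0 : 0 < 63 * m + 1 by lra.
have t0 : 0 < t by rewrite lt_min !divr_gt0.
have t1 : t <= 1 / 2 by rewrite ge_min lexx.
have te : t * (63 * m + 1) <= e by rewrite -ler_pdivlMr// ge_min lexx orbT.
clearbody t; have t01 : 0 < t < 1 by apply/andP; split; lra.
apply: (le_trans (h t t01)); rewrite -EFinD lee_fin.
have b2 : (1 + t) ^+ 2 <= 1 + 3 * t by nra.
have b6 : (1 + t) ^+ 6 <= 1 + 63 * t.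
  rewrite (_ : (1 + t) ^+ 6 = ((1 + t) ^+ 2) ^+ 3); last by rewrite -exprM.
  have s0 : 0 <= (1 + t) ^+ 2 by nra.
  apply: (@le_trans _ _ ((1 + 3 * t) ^+ 3)); first by rewrite lerXn2r ?nnegrE//; lra.
  have t2 : t ^+ 2 <= t by nra.
  have t3 : t ^+ 3 <= t by nra.
  rewrite (_ : (1 + 3 * t) ^+ 3 = 1 + 9 * t + 27 * t ^+ 2 + 27 * t ^+ 3); last by ring.
  lra.
nra.
Qed.

End Limits.

Section SphericalDensity.
Context {R : realType}.
Local Notation E := 'rV[R]_4.
Local Notation L2 := ((@lebesgue_measure R) \x (@lebesgue_measure R))%E.
Variable d : E -> E -> R.
Hypothesis hd : homogeneous_distance d.
Variables (v e : E) (c0 c1 k : R).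
Hypothesis v2 : v.:[2] = 0.
Hypothesis v3 : v.:[3] = 0.
Hypothesis cv : c0 * v.:[0] + c1 * v.:[1] = 1.
Hypothesis k0 : 0 < k.
Hypothesis e_0 : e.:[0] = 0.
Hypothesis e_1 : e.:[1] = 0.
Hypothesis e_2 : e.:[2] = 0.
Hypothesis e_3 : e.:[3] = k^-1.
Variables (mu : set E -> \bar R) (p : E).
Hypothesis small : forall eps, 0 < eps < 1 -> exists2 r0, 0 < r0 &
  forall r u, 0 < r < r0 -> d u 0 <= 1 ->
  let B := closed_ball_of d (engel_mul p (dilation r u)) r in
  (((1 - eps) ^+ 2 * r ^+ 4)%:E * L2 (strip d v e u (1 - eps)) <= mu B)%E /\
  (mu B <= ((1 + eps) ^+ 2 * r ^+ 4)%:E * L2 (strip d v e u (1 + eps)))%E.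
Variable u0 : E.
Hypothesis u01 : d u0 0 <= 1.
Hypothesis u0max : forall u, d u 0 <= 1 -> (L2 (strip d v e u 1) <= L2 (strip d v e u0 1))%E.

Lemma density_factor (r : R) : 0 < r ->
  2 `^ 4 / fine (2 * r)%:E `^ 4 = (r ^+ 4)^-1.
Proof.
move=> r0; rewrite /= !powR_mulrn ?mulr_ge0 ?ltW// exprMn invfM mulrA divff ?mul1r//.
Qed.

Lemma dilation_dist0 r u : 0 < r -> d (dilation r u) 0 = r * d u 0.
Proof. by move=> r0; rewrite -{1}(dilation0 r) (hdist_dilation hd). Qed.

(** A ball of radius r that contains p is centred at p times the dilation by r of
    some u with d(u, 0) <= 1, and has diameter 2 r. Its normalized measure is
    therefore close to the area of the strip at u, with an error that [L2_strip]
    absorbs into a dilation of u. *)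
Theorem spherical_density_max : spherical_density d 4 mu p = L2 (strip d v e u0 1).
Proof.
pose m := fine (L2 (strip d v e u0 1)).
have mE : L2 (strip d v e u0 1) = m%:E.
  rewrite /m fineK// ge0_fin_numE//.
  apply: (L2_strip_fin hd v3 cv k0 e_0 e_1 e_3 u01); lra.
have m0 : 0 <= m by rewrite /m fine_ge0.
have L2s := L2_strip hd v2 v3 e_0 e_1 e_2 e_3.
rewrite mE; apply/eqP; rewrite eq_le; apply/andP; split.
- apply: le_of_grow => // t t01; have /andP[t0 t1] := t01.
  have [r0 r00 hr] := small t01.
  apply: (@le_trans _ _ (ereal_sup [set s | exists x r, let B := closed_ball_of d x r in
      [/\ 0 < r, B p, (diam d B < (2 * r0)%:E)%E &
          s = ((2 `^ 4 / fine (diam d B) `^ 4)%:E * mu B)%E]])).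
    by apply: ereal_inf_lbound; exists (2 * r0) => //; rewrite mulr_gt0.
  apply: ge_ereal_sup => _ [x [r [rp Bp dB ->]]].
  rewrite diam_hball// in dB *; rewrite lte_fin ltr_pM2l// in dB.
  rewrite density_factor//.
  pose u := dilation r^-1 (engel_mul (- p) x).
  have xE : x = engel_mul p (dilation r u).
    by rewrite /u dilationVK ?gt_eqF// engel_mulVK.
  have u1 : d u 0 <= 1.
    rewrite /closed_ball_of /= xE hdist_leftE// dilation_dist0// in Bp.
    by rewrite -(ler_pM2l rp) mulr1.
  have rr : 0 < r < r0 by rewrite rp.
  have [_ hu] := hr r u rr u1; rewrite -xE in hu.
  have t10 : 0 < 1 + t by lra.
  have u'1 : d (dilation (1 + t)^-1 u) 0 <= 1.
    rewrite dilation_dist0 ?invr_gt0// mulrC ler_pdivrMr// mul1r.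
    by apply: (le_trans u1); lra.
  have := u0max u'1; rewrite mE => hm.
  apply: (@le_trans _ _ (((r ^+ 4)^-1)%:E * (((1 + t) ^+ 2 * r ^+ 4)%:E * ((1 + t) ^+ 4 * m)%:E))%E).
    apply: lee_wpmul2l; first by rewrite lee_fin invr_ge0 exprn_ge0// ltW.
    apply: (le_trans hu); apply: lee_wpmul2l.
      by rewrite lee_fin mulr_ge0// exprn_ge0// ltW.
    by rewrite L2s// (EFinM ((1 + t) ^+ 4)) lee_wpmul2l// lee_fin exprn_ge0// ltW.
  rewrite -!EFinM lee_fin le_eqVlt; apply/orP; left; apply/eqP; field.
  by rewrite gt_eqF.
apply: le_ereal_inf_tmp => _ [eps eps0 ->]; apply: ge_of_shrink => // t t01.
have /andP[t0 t1] := t01; have [r0 r00 hr] := small t01.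
pose r := Num.min r0 eps / 3.
have mn0 : 0 < Num.min r0 eps by rewrite lt_min r00.
have rp : 0 < r by rewrite divr_gt0.
have rr0 : r < r0.
  have : Num.min r0 eps <= r0 by rewrite ge_min lexx.
  by rewrite /r; lra.
have re : 2 * r < eps.
  have : Num.min r0 eps <= eps by rewrite ge_min lexx orbT.
  by rewrite /r; lra.
have t10 : 0 < 1 - t by lra.
(* The section of radius 1 - t at this centre is a dilation of the maximal one. *)
pose u := dilation (1 - t) u0.
have u1 : d u 0 <= 1.
  rewrite dilation_dist0//; apply: (@le_trans _ _ (1 - t)); last lra.
  by rewrite ler_piMr// ltW.
have rr : 0 < r < r0 by rewrite rp.
have [hu _] := hr r u rr u1.
pose B := closed_ball_of d (engel_mul p (dilation r u)) r.
rewrite -/B in hu.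
have Bp : B p.
  by rewrite /B /closed_ball_of /= hdist_leftE// dilation_dist0// ler_piMr// ltW.
apply: (@le_trans _ _ ((2 `^ 4 / fine (diam d B) `^ 4)%:E * mu B)%E); last first.
  apply: ereal_sup_ubound; exists (engel_mul p (dilation r u)), r; split => //.
  by rewrite diam_hball// lte_fin.
rewrite diam_hball// density_factor//.
apply: (@le_trans _ _ (((r ^+ 4)^-1)%:E * (((1 - t) ^+ 2 * r ^+ 4)%:E * ((1 - t) ^+ 4 * m)%:E))%E).
  rewrite -!EFinM lee_fin le_eqVlt; apply/orP; left; apply/eqP; field.
  by rewrite gt_eqF.
apply: lee_wpmul2l; first by rewrite lee_fin invr_ge0 exprn_ge0// ltW.
apply: le_trans hu; apply: lee_wpmul2l.
  by rewrite lee_fin mulr_ge0// exprn_ge0// ltW.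
by rewrite L2s// /u dilationK ?gt_eqF// mE.
Qed.

End SphericalDensity.

Theorem proposition6p4 (R : realType)
    (d : 'rV[R]_4 -> 'rV[R]_4 -> R) (hd : homogeneous_distance d)
    (g : 'rV[R]_4 -> 'M[R]_4)
    (hg : riemannian_metric g) (hg' : graded_metric g)
    (Y : 'M[R]_4) (hY : graded_basis Y)
    (Sigma : set 'rV[R]_4) (hS : C1_surface Sigma) (hdeg : degree Y Sigma = 4%N)
    (gt : 'rV[R]_4 -> 'M[R]_4) (hgt : riemannian_metric gt)
    (sigma : {measure set (borelE R) -> \bar R})
    (hsigma : surface_measure gt Sigma sigma)
    (p : 'rV[R]_4) (hp : Sigma p) (hpmax : pdegree Y Sigma p = degree Y Sigma) :
  is_spherical_factor d g 2%N (homogeneous_tangent Y Sigma p)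
    (spherical_density d 4 (intrinsic_measure g gt Y Sigma sigma) p).
Proof.
have hp4 : pdegree Y Sigma p = 4%N by rewrite hpmax.
have [v [W [Phi [gc W0 Phi0 [v2 v3 vv TE [a0 h0]]]]]] := adapted_chart hS hY hg hg' hp hp4.
set G := g 0 in vv *; set ev' := ev g in TE *.
have k0 := kap_gt0 hg; set k := kap g in k0 *.
have evE := ev_coord g; rewrite -/ev' -/k in evE.
(* The linear form <., v> only sees the horizontal coordinates. *)
pose c0 := G (inord 0) (inord 0) * v.:[0] + G (inord 0) (inord 1) * v.:[1].
pose c1 := G (inord 1) (inord 0) * v.:[0] + G (inord 1) (inord 1) * v.:[1].
have innv x : inner G x v = c0 * x.:[0] + c1 * x.:[1].
  by rewrite /G (innerGE hg') v2 v3 /c0 /c1 /G; ring.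
have cv : c0 * v.:[0] + c1 * v.:[1] = 1 by rewrite -innv.
have e_0 : ev'.:[0] = 0 by rewrite evE.
have e_1 : ev'.:[1] = 0 by rewrite evE.
have e_2 : ev'.:[2] = 0 by rewrite evE.
have e_3 : ev'.:[3] = k^-1 by rewrite evE.
have coord z (Wz : W z) := recenter_coord hg hg' gc Wz.
have f1 z : W z -> c0 * (recenter Phi p z).:[0] + c1 * (recenter Phi p z).:[1] = z.1.
  by move=> Wz; rewrite -innv; exact: (coord z Wz).1.
have f3 z : W z -> k * (recenter Phi p z).:[3] = z.2 by move=> Wz; exact: (coord z Wz).2.
have [C C0 hC] := contact_order hY hdeg hg hg' gc W0 Phi0 v2 a0.
have sand := ball_sandwich hd v2 v3 cv k0 e_0 e_1 e_2 e_3 f1 f3 C0 hC.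
have J0 : 0 < jac gt Phi 0 := area_density_gt0 hgt gc W0.
have dens := density_near hY hg hg' hgt gc W0 vv h0.
pose tau x := norm2 (g x) (tau_part gt Y Sigma 4 x).
have tau0 x : 0 <= tau x by exact: sqrtr_ge0.
have jac0 z : 0 <= jac gt Phi z by exact: sqrtr_ge0.
have sE := hsigma.2 W Phi gc.1.
have small := small_ball_measure hd gc.1 Phi0 J0 dens jac0 tau0 sE sand.
have [u0 u01 u0max] := strip_max hd v3 cv k0 e_0 e_1 e_3.
have small' eps : 0 < eps < 1 -> exists2 r0, 0 < r0 &
  forall r u, 0 < r < r0 -> d u 0 <= 1 ->
  let B := closed_ball_of d (engel_mul p (dilation r u)) r in
  (((1 - eps) ^+ 2 * r ^+ 4)%:E * (lebesgue_measure \x lebesgue_measure) (strip d v ev' u (1 - eps)) <= intrinsic_measure g gt Y Sigma sigma B)%E /\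
  (intrinsic_measure g gt Y Sigma sigma B <= ((1 + eps) ^+ 2 * r ^+ 4)%:E * (lebesgue_measure \x lebesgue_measure) (strip d v ev' u (1 + eps)))%E.
  by rewrite /intrinsic_measure hdeg; exact: small.
rewrite (spherical_density_max hd v2 v3 cv k0 e_0 e_1 e_2 e_3 small' u01 u0max).
have rhoI z w : euclidean g (plane v ev' z) (plane v ev' w) =
    Num.sqrt ((z.1 - w.1) ^+ 2 + (z.2 - w.2) ^+ 2).
  rewrite /euclidean; have -> : plane v ev' z - plane v ev' w = (z.1 - w.1) *: v + (z.2 - w.2) *: ev'.
    by rewrite /plane !scalerBl opprD addrACA.
  rewrite /vnorm; congr Num.sqrt.
  have Gs : G^T = G by exact: Defs.metric_sym hg _.
  have vev : inner G v ev' = 0 by rewrite (inner_ev hg hg') v3 mulr0.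
  have evv : inner G ev' v = 0 by rewrite (innerC _ _ Gs).
  have evev : inner G ev' ev' = 1 by exact: inner_evev.
  move: (ev') vev evv evev => q vq qv qq.
  by rewrite -/G !(innerDl, innerDr, innerZl, innerZr) vv vq qv qq; ring.
have valE u : d u 0 <= 1 -> hausdorff (euclidean g) 2
    (closed_ball_of d u 1 `&` homogeneous_tangent Y Sigma p) =
    (lebesgue_measure \x lebesgue_measure)%E (strip d v ev' u 1).
  move=> u1; rewrite TE.
  have -> : closed_ball_of d u 1 `&` [set s *: v + t *: ev' | s in setT & t in setT] =
      plane v ev' @` strip d v ev' u 1.
    apply/seteqP; split=> x.
      by move=> [Bx [s _ [t _ xE]]]; exists (s, t); rewrite ?/strip /plane /= xE.
    by move=> [z hz <-]; split=> //; exists z.1 => //; exists z.2.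
  apply: hausdorff_plane => //.
    by move=> x y; exact: sqrtr_ge0.
  have [M M0 hM] := strip_bounded hd v3 cv k0 e_0 e_1 e_3.
  apply: (@subclosed_compact _ _ (`[- M, M]%classic `*` `[- M, M]%classic)).
  - exact: strip_closed.
  - by apply: compact_setX; exact: segment_compact.
  - move=> z hz; have : `|z| <= M by apply: hM hz => //; lra.
    by rewrite prod_norm_le !ler_norml => /andP[? ?]; split; rewrite /= in_itv.
split; first by exists u0 => //; exact: valE.
by move=> _ [u u1 <-]; rewrite valE//; exact: u0max.
Qed.
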